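(* In the model described in the context, let $n\ge1$ be an integer and suppose that $u_{j,\lambda}$ vanishes to order $n$ at $\lambda=\lambda_0$ for $j=1,2$. Then for any $p\in[0,2n)$ and $l=1,2$, there exists a family of intervals $\mathscr{I}_{l,\alpha}$ symmetric around $\lambda_l(\alpha)$ such that $|\mathscr{I}_{l,\alpha}|=o(|\alpha-\alpha_0|^p)$ as $\alpha\to\alpha_0$ and $E_\alpha(\mathscr{I}_{l,\alpha})\to P_{\psi_l}$ strongly as $\alpha\to\alpha_0$, where $P_{\psi_l}$ is the orthogonal projection onto the span of $\psi_l$. In particular, for any $p\in[0,2n)$, the spectrum of $H_\alpha$ is concentrated near $\lambda_0$ to order $p$ as $\alpha\to\alpha_0$.
   Context: Inner products are linear in the first argument. On $\mathbb{R}^3$, $\widehat f(\xi)=(2\pi)^{-3/2}\int f(x)e^{-i\xi\cdot x}\,dx$. $H_0$ is the self-adjoint realization of $-\Delta$ on $L^2(\mathbb{R}^3)$. For $v\in L^2(\mathbb{R}^3)$, $\lambda\ge 0$, let $v_\lambda\in L^2(S^2)$, $v_\lambda(\omega)=2^{-1/2}\lambda^{1/4}\widehat v(\sqrt\lambda\,\omega)$; $v\mapsto(v_\lambda)_\lambda$ is unitary onto $L^2([0,\infty);L^2(S^2))$ and $(H_0v)_\lambda=\lambda v_\lambda$. $\mathcal{E}$ is the set of $v\in L^2(\mathbb{R}^3)$ such that $\lambda\mapsto v_\lambda$ is strongly smooth on $[0,\infty)$ and decays rapidly as $\lambda\to0$ and $\lambda\to\infty$ (for all $k,N\ge0$ the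 $k$-th strong derivative $v^{(k)}_\lambda$ satisfies $\lambda^{-N}\|v^{(k)}_\lambda\|\to0$ as $\lambda\to0$ and $\lambda^{N}\|v^{(k)}_\lambda\|\to0$ as $\lambda\to\infty$). ''$v_\lambda$ vanishes to order $n$ at $\lambda=s$'' means $v_s^{(k)}=0$ for $0\le k<n$ and $v_s^{(n)}\ne0$. For $v,w\in\mathcal{E}$, $\eta_{v,w}(\lambda)=\langle v_\lambda,w_\lambda\rangle$ for $\lambda\ge0$ and $0$ for $\lambda<0$. For $f\in\mathcal{S}(\mathbb{R})$, $\gamma(f,\lambda)=\lim_{\epsilon\to0^+}\int_{\mathbb{R}\setminus(\lambda-\epsilon,\lambda+\epsilon)}\frac{f(x)}{x-\lambda}\,dx$. For $v\in\mathcal{E}$ with $v_a=0$ ($a\ge0$), $\Phi_{v,a}\in L^2(\mathbb{R}^3)$ is given by $(\Phi_{v,a})_\lambda=v_\lambda/(\lambda-a)$ for $\lambda\ne a$ and $(\Phi_{v,a})_a=v'_a$. Perturbation: $u_1,u_2\in\mathcal{E}$, $u_1\perp u_2$, $V=\sum_{j=1}^2\langle\cdot,u_j\rangle u_j$, $H_\alpha=H_0+\alpha V$ ($\alpha\in\mathbb{R}$), with spectral measure $E_\alpha$. Write $u_{j,\lambda}=(u_j)_\lambda$, $\eta_{jk}=\eta_{u_j,u_k}$. For real $\alpha,\lambda$, $B(\alpha,\lambda+i0)=C(\alpha,\lambda)+iD(\alpha,\lambda)$ is the $2\times2$ matrix with $c_{jk}(\alpha,\lambda)=\delta_{jk}+\alpha\gamma(\eta_{kj},\lambda)$,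 $d_{jk}(\alpha,\lambda)=\alpha\pi\eta_{kj}(\lambda)$; $F=\det B(\alpha,\lambda+i0)=F_1+iF_2$ with $F_1,F_2$ real. Model: $\alpha_0\in\mathbb{R}$ and $\lambda_0>0$ are fixed, and (b) $u_{1,\lambda_0}=u_{2,\lambda_0}=0$ and $\delta_{jk}+\alpha_0\gamma(\eta_{jk},\lambda_0)=0$ for $j,k\in\{1,2\}$ (equivalently $B(\alpha_0,\lambda_0+i0)=0$); put $\phi_j=\Phi_{u_j,\lambda_0}$; (c) $\langle\phi_1,\phi_2\rangle\ne0$ or $\|\phi_1\|\ne\|\phi_2\|$; the labelling is such that $\|\phi_1\|\le\|\phi_2\|$. Put $d=\sqrt{(\|\phi_1\|^2-\|\phi_2\|^2)^2+4|\langle\phi_1,\phi_2\rangle|^2}$. Paths: $I\ni\alpha_0$ and $J\ni\lambda_0$ are bounded open intervals with $\overline J\subset(0,\infty)$, and $\lambda_1,\lambda_2:I\to J$ are distinct smooth functions with $\lambda_j(\alpha_0)=\lambda_0$, $F_1(\alpha,\lambda_j(\alpha))=0$ for $\alpha\in I$, and $\lambda_j'(\alpha_0)=\frac{\|\phi_1\|^2+\|\phi_2\|^2+(-1)^{j+1}d}{2\alpha_0^2(\|\phi_1\|^2\|\phi_2\|^2-|\langle\phi_1,\phi_2\rangle|^2)}$; $I,J$ are small enough that for each $\alpha\in I$ the zeros of $F_1(\alpha,\cdot)$ in $\overline J$ are exactly $\lambda_1(\alpha),\lambda_2(\alpha)$. (d) $F_2(\alpha,\lambda_j(\alpha))\ne0$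 for all $\alpha\in I\setminus\{\alpha_0\}$, $j=1,2$. Canonical eigenbasis: $\psi_1=a_{11}\phi_1+a_{12}\phi_2$, $\psi_2=a_{21}\phi_1+a_{22}\phi_2$, where, with $q(z)=z/|z|$ for $z\neq 0$ and $q(0)=1$, $a_{11}=\sqrt{(-1+\alpha_0^2\|\phi_2\|^2\lambda_1'(\alpha_0))/d}$, $a_{12}=-q(\langle\phi_1,\phi_2\rangle)\sqrt{(-1+\alpha_0^2\|\phi_1\|^2\lambda_1'(\alpha_0))/d}$, $a_{21}=\sqrt{(1-\alpha_0^2\|\phi_2\|^2\lambda_2'(\alpha_0))/d}$, $a_{22}=q(\langle\phi_1,\phi_2\rangle)\sqrt{(1-\alpha_0^2\|\phi_1\|^2\lambda_2'(\alpha_0))/d}$. Spectral concentration: let $\{T_\alpha\}_{\alpha\in\mathbb{R}}$ be self-adjoint operators with spectral measures $E_\alpha$ and $\lambda_0$ an eigenvalue of $T_{\alpha_0}$. The spectrum of $T_\alpha$ is concentrated near $\lambda_0$ as $\alpha\to\alpha_0$ if there is a family of Borel sets $\mathscr{I}_\alpha$ such that $\inf\mathscr{I}_\alpha\to\lambda_0$, $\sup\mathscr{I}_\alpha\to\lambda_0$ and $E_\alpha(\mathscr{I}_\alpha)\to E_{\alpha_0}(\{\lambda_0\})$ strongly as $\alpha\to\alpha_0$. If in addition $\lim_{\alpha\to\alpha_0}|\mathscr{I}_\alpha|/|\alpha-\alpha_0|^p=0$ ($|\cdot|$ Lebesgue measure, $p\ge 0$), the spectrum is said to be concentrated to order $p$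 near $\lambda_0$. *)

(* Defs.v *)
From HB Require Import structures.
From mathcomp Require Import all_boot all_order all_algebra.
From mathcomp Require Import complex.
From mathcomp Require Import all_classical all_reals all_analysis.
From mathcomp Require Import measurable_realfun.

Set Implicit Arguments.
Unset Strict Implicit.
Unset Printing Implicit Defensive.

Import Order.TTheory GRing.Theory Num.Theory.
Import numFieldNormedType.Exports.

Local Open Scope classical_set_scope.
Local Open Scope ring_scope.
Local Open Scope complex_scope.

Section L2space.
Context d (T : measurableType d) (R : realType).
Variable mu : {measure set T -> \bar R}.

(* A complex function is square integrable iff its real and imaginary parts
   are. *)
Definition L2pred : {pred T -> R[i]} := fun f =>
  ((fun x => complex.Re (f x)) \in Lfun mu 2%:E) &&
  ((fun x => complex.Im (f x)) \in Lfun mu 2%:E).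

Lemma L2_submod_closed : submod_closed L2pred.
Proof.
have p1 : (1 <= 2%:E :> \bar R)%E by rewrite lee_fin ler1n.
have [L0 LD] := Lfun_submod_closed mu p1.
split=> [|a f g].
  by rewrite unfold_in; apply/andP; split; exact: L0.
rewrite !unfold_in => /andP[rf jf] /andP[rg jg]; apply/andP; split.
  have -> : (fun x => complex.Re ((a *: f + g) x)) =
    complex.Re a *: (fun x => complex.Re (f x)) +
    (- complex.Im a *: (fun x => complex.Im (f x)) + (fun x => complex.Re (g x))).
    apply/funext => x /=.
    rewrite /GRing.add/= /GRing.scale/=.
    case: a (f x) (g x) => [a1 a2] [f1 f2] [g1 g2] /=.
    by rewrite /GRing.scale /=  addrA mulNr.
  by apply: (LD) => //; exact: LD.
have -> : (fun x => complex.Im ((a *: f + g) x)) =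
  complex.Re a *: (fun x => complex.Im (f x)) +
  (complex.Im a *: (fun x => complex.Re (f x)) + (fun x => complex.Im (g x))).
  apply/funext => x /=.
  rewrite /GRing.add/= /GRing.scale/=.
  case: a (f x) (g x) => [a1 a2] [f1 f2] [g1 g2] /=.
  by rewrite /GRing.scale /= addrA.
by apply: (LD) => //; exact: LD.
Qed.

HB.instance Definition _ := GRing.isSubmodClosed.Build R[i] (T -> R[i]) L2pred
  L2_submod_closed.

Record L2fun := MkL2fun { L2val :> T -> R[i]; _ : L2val \in L2pred }.

HB.instance Definition _ := [isSub for L2val].
HB.instance Definition _ := [Choice of L2fun by <:].
HB.instance Definition _ := [SubChoice_isSubLmodule of L2fun by <:].

Definition L2eq (f g : L2fun) : bool :=
  `[< \forall x \ae mu, (f : T -> R[i]) x = (g : T -> R[i]) x >].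

Lemma L2eq_refl : reflexive L2eq.
Proof. by move=> f; apply/asboolP; exact: nearW. Qed.

Lemma L2eq_sym : symmetric L2eq.
Proof.
by move=> f g; apply/idP/idP => /asboolP fg; apply/asboolP; apply: filterS fg.
Qed.

Lemma L2eq_trans : transitive L2eq.
Proof.
move=> g f h /asboolP fg /asboolP gh; apply/asboolP.
by apply: filterS2 fg gh => x ->.
Qed.

Canonical L2eq_equiv := EquivRel L2eq L2eq_refl L2eq_sym L2eq_trans.

Local Open Scope quotient_scope.

Definition L2 : Type := {eq_quot L2eq}.
HB.instance Definition _ := Choice.on L2.
HB.instance Definition _ := EqQuotient.on L2.

(* A class in L2 is applied through a chosen representative; all uses below
   are insensitive to the choice. *)
Definition L2_to_fun (f : L2) : T -> R[i] := (repr f : L2fun).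
Coercion L2_to_fun : L2 >-> Funclass.

Lemma L2_piP (f g : L2fun) :
  (\pi_L2 f = \pi_L2 g :> L2) <-> \forall x \ae mu, f x = g x.
Proof.
split=> [/eqmodP/asboolP //|fg]; apply/eqmodP; exact/asboolP.
Qed.

Lemma L2_reprE (f : L2fun) : \forall x \ae mu, (\pi_L2 f : L2) x = f x.
Proof. by apply/L2_piP; rewrite reprK. Qed.

Definition L2add (f g : L2) : L2 := \pi_L2 ((repr f : L2fun) + repr g).
Definition L2opp (f : L2) : L2 := \pi_L2 (- (repr f : L2fun)).
Definition L2scale (a : R[i]) (f : L2) : L2 := \pi_L2 (a *: (repr f : L2fun)).

Lemma L2_piD (f g : L2fun) : L2add (\pi_L2 f) (\pi_L2 g) = \pi_L2 (f + g).
Proof.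
apply/L2_piP; have := L2_reprE g; have := L2_reprE f; apply: filterS2 => x fx gx.
by rewrite /= -[LHS]/(L2val _ x + L2val _ x) -[RHS]/(f x + g x) -fx -gx.
Qed.

Lemma L2_piN (f : L2fun) : L2opp (\pi_L2 f) = \pi_L2 (- f).
Proof.
apply/L2_piP; have := L2_reprE f; apply: filterS => x fx.
by rewrite /= -[LHS]/(- L2val _ x) -[RHS]/(- f x) -fx.
Qed.

Lemma L2_piZ a (f : L2fun) : L2scale a (\pi_L2 f) = \pi_L2 (a *: f).
Proof.
apply/L2_piP; have := L2_reprE f; apply: filterS => x fx.
by rewrite /= -[LHS]/(a *: L2val _ x) -[RHS]/(a *: f x) -fx.
Qed.

Lemma L2addA : associative L2add.
Proof.
elim/quotW=> f; elim/quotW=> g; elim/quotW=> h.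
by rewrite (L2_piD g h) (L2_piD f (g + h)) (L2_piD f g) (L2_piD (f + g) h) addrA.
Qed.

Lemma L2addC : commutative L2add.
Proof.
by elim/quotW=> f; elim/quotW=> g; rewrite (L2_piD f g) (L2_piD g f) addrC.
Qed.

Lemma L2add0 : left_id (\pi_L2 0 : L2) L2add.
Proof. by elim/quotW=> f; rewrite (L2_piD 0 f) add0r. Qed.

Lemma L2addN : left_inverse (\pi_L2 0 : L2) L2opp L2add.
Proof. by elim/quotW=> f; rewrite (L2_piN f) (L2_piD (- f) f) addNr. Qed.

HB.instance Definition _ := GRing.isZmodule.Build L2 L2addA L2addC L2add0 L2addN.

Lemma L2scaleA a b (f : L2) : L2scale a (L2scale b f) = L2scale (a * b) f.
Proof.
elim/quotW: f => f.
by rewrite (L2_piZ b f) (L2_piZ a (b *: f)) (L2_piZ (a * b) f) scalerA.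
Qed.

Lemma L2scale1 : left_id 1 L2scale.
Proof. by elim/quotW=> f; rewrite (L2_piZ 1 f) scale1r. Qed.

Lemma L2scaleDr : right_distributive L2scale +%R.
Proof.
move=> a; elim/quotW=> f; elim/quotW=> g.
rewrite -[_ (\pi f) (\pi g)]/(L2add (\pi f) (\pi g)) -[RHS]/(L2add _ _).
rewrite (L2_piD f g) (L2_piZ a (f + g)) (L2_piZ a f) (L2_piZ a g).
by rewrite (L2_piD (a *: f) (a *: g)) scalerDr.
Qed.

Lemma L2scaleDl (f : L2) : {morph L2scale^~ f : a b / a + b}.
Proof.
move=> a b; elim/quotW: f => f; rewrite -[RHS]/(L2add _ _).
rewrite (L2_piZ a f) (L2_piZ b f) (L2_piZ (a + b) f).
by rewrite (L2_piD (a *: f) (b *: f)) scalerDl.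
Qed.

HB.instance Definition _ := GRing.Zmodule_isLmodule.Build R[i] L2
  L2scaleA L2scale1 L2scaleDr L2scaleDl.

End L2space.

Section inner_product.
Context d (T : measurableType d) (R : realType).
Variable mu : {measure set T -> \bar R}.

Definition cintegral (D : set T) (f : T -> R[i]) : R[i] :=
  (\int[mu]_(x in D) complex.Re (f x)) +i* (\int[mu]_(x in D) complex.Im (f x)).

Definition innerL2 (f g : L2 mu) : R[i] := cintegral setT (fun x => f x * (g x)^*).

Definition normL2 (f : L2 mu) : R := Num.sqrt (complex.Re (innerL2 f f)).

(* Orthogonal projection onto the span of psi (0 when psi = 0). *)
Definition proj_span (psi f : L2 mu) : L2 mu :=
  (innerL2 f psi / innerL2 psi psi) *: psi.

(* Unbounded operators are given by their graphs: A f g means that f is in the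
   domain of A and A f = g. *)
Definition unbounded_op := L2 mu -> L2 mu -> Prop.

(* A = A^*; the first clause says that A^* is single valued, i.e. that the
   domain of A is dense. *)
Definition selfadjoint (A : unbounded_op) : Prop :=
  (forall f g1 g2, A f g1 -> A f g2 -> g1 = g2) /\
  (forall f g, A f g <-> forall h k, A h k -> innerL2 k f = innerL2 h g).

Definition orthogonal_projection (P : L2 mu -> L2 mu) : Prop :=
  [/\ linear P, (forall f, P (P f) = P f) &
      (forall f g, innerL2 (P f) g = innerL2 f (P g))].

(* E is the projection-valued measure with A = \int x dE(x): for each f,
   B |-> <E(B)f, f> is a measure, f is in dom A iff \int x^2 d<E(x)f, f> is
   finite, and then <A f, f> = \int x d<E(x)f, f>, which determines A by
   polarization. *)
Definition spectral_measure_of (A : unbounded_op)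
    (E : set (measurableTypeR R) -> L2 mu -> L2 mu) : Prop :=
  [/\ selfadjoint A,
      (forall B, measurable B -> orthogonal_projection (E B)),
      (forall f, E setT f = f) &
      (forall f, exists m : {measure set (measurableTypeR R) -> \bar R},
         [/\ (forall B, measurable B ->
                (m B = (complex.Re (innerL2 (E B f) f))%:E)%E),
             ((exists g, A f g) <-> (\int[m]_x (x ^+ 2)%:E < +oo)%E) &
             (forall g, A f g -> innerL2 g f = (\int[m]_x x)%:C)])].

Definition is_op_eigenvalue (A : unbounded_op) (l : R) : Prop :=
  exists2 f : L2 mu, f != 0 & A f (l%:C *: f).

(* P a -> Q strongly as a -> a0, with a <> a0. *)
Definition strong_cvg (a0 : R) (P : R -> L2 mu -> L2 mu) (Q : L2 mu -> L2 mu) :=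
  forall f, normL2 (P a f - Q f) @[a --> a0^'] --> 0.

(* |I a| = o(|a - a0|^p) as a -> a0. *)
Definition measure_littleo (a0 p : R) (I : R -> set (measurableTypeR R)) :=
  (lebesgue_measure (I a) * ((`|a - a0| `^ p)^-1)%:E)%E @[a --> a0^'] --> 0%E.

Definition concentrated_to_order (A : R -> unbounded_op)
    (E : R -> set (measurableTypeR R) -> L2 mu -> L2 mu) (a0 l0 p : R) : Prop :=
  [/\ (forall a, spectral_measure_of (A a) (E a)),
      is_op_eigenvalue (A a0) l0 &
      exists I : R -> set (measurableTypeR R),
        [/\ (forall a, measurable (I a)),
            ereal_inf (EFin @` I a) @[a --> a0^'] --> l0%:E,
            ereal_sup (EFin @` I a) @[a --> a0^'] --> l0%:E,
            strong_cvg a0 (fun a => E a (I a)) (E a0 [set l0]) &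
            measure_littleo a0 p I]].

End inner_product.

Section spaces.
Variable R : realType.

Definition R3 := (measurableTypeR R * measurableTypeR R * measurableTypeR R)%type.

Definition leb3 : {measure set R3 -> \bar R} :=
  ((@lebesgue_measure R \x @lebesgue_measure R) \x @lebesgue_measure R)%E.

Definition dot3 (x y : R3) : R := x.1.1 * y.1.1 + x.1.2 * y.1.2 + x.2 * y.2.

Definition scale3 (s : R) (x : R3) : R3 := (s * x.1.1, s * x.1.2, s * x.2).

Definition radial3 (x : R3) : R3 := scale3 (dot3 x x `^ (- 2^-1)) x.

Lemma measurable_dot3 : measurable_fun [set: R3] (fun x : R3 => dot3 x x).
Proof.
have m1 : measurable_fun [set: R3] (fun x : R3 => x.1.1 : R).
  exact: measurableT_comp measurable_fst measurable_fst.
have m2 : measurable_fun [set: R3] (fun x : R3 => x.1.2 : R).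
  exact: measurableT_comp measurable_snd measurable_fst.
have m3 : measurable_fun [set: R3] (fun x : R3 => x.2 : R) := measurable_snd.
by do 2?apply: measurable_funD; apply: measurable_funM.
Qed.

Lemma measurable_radial3 : measurable_fun [set: R3] radial3.
Proof.
have m1 : measurable_fun [set: R3] (fun x : R3 => x.1.1 : R).
  exact: measurableT_comp measurable_fst measurable_fst.
have m2 : measurable_fun [set: R3] (fun x : R3 => x.1.2 : R).
  exact: measurableT_comp measurable_snd measurable_fst.
have m3 : measurable_fun [set: R3] (fun x : R3 => x.2 : R) := measurable_snd.
have mp : measurable_fun [set: R3] (fun x : R3 => dot3 x x `^ (- 2^-1) : R).
  exact: measurableT_comp (measurable_powR _) measurable_dot3.
by do 2?apply: measurable_fun_pair; apply: measurable_funM.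
Qed.

Definition ball3 : set R3 := [set x | dot3 x x <= 1].

Lemma measurable_ball3 : measurable ball3.
Proof.
have -> : ball3 = setT `&` (fun x : R3 => dot3 x x) @^-1` [set` `]-oo, 1]].
  by rewrite setTI; apply/seteqP; split=> x; rewrite /= in_itv.
exact: measurable_dot3.
Qed.

Definition radial_image : set R3 -> \bar R :=
  pushforward (mrestr leb3 measurable_ball3) radial3.

Let radial_image0 : radial_image set0 = 0%E.
Proof. by rewrite /radial_image /pushforward preimage_set0 measure0. Qed.

Let radial_image_ge0 A : (0 <= radial_image A)%E.
Proof. by rewrite /radial_image /pushforward measure_ge0. Qed.

Let radial_image_sigma_additive : semi_sigma_additive radial_image.
Proof.
pose m := measure_function_pushforward__canonical__measure_function_Measure
  (mrestr leb3 measurable_ball3) measurable_radial3.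
exact: (@measure_semi_sigma_additive _ _ _ m).
Qed.

HB.instance Definition _ := isMeasure.Build _ _ _ radial_image
  radial_image0 radial_image_ge0 radial_image_sigma_additive.

(* Surface measure of S^2, as a measure on R^3 carried by S^2:
   sphere A = 3 |{x : |x| <= 1, x/|x| \in A}|, of total mass 4 pi. *)
Definition sphere : {measure set R3 -> \bar R} := mscale 3%:R%:nng radial_image.

End spaces.

Arguments leb3 {R}.
Arguments sphere {R}.

Notation L2R3 R := (L2 (@leb3 R)).
Notation L2S2 R := (L2 (@sphere R)).

Section model.
Variable R : realType.

Definition expNi (t : R) : R[i] := cos t -i* sin t.

(* The Fourier transform on L2(R^3): the unique unitary operator given by the
   Fourier integral on the integrable elements of L2(R^3) (Plancherel). *)
Definition is_fourier (Fr : L2R3 R -> L2R3 R) : Prop :=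
  [/\ linear Fr,
      (forall f g, innerL2 (Fr f) (Fr g) = innerL2 f g),
      (forall g, exists f, Fr f = g) &
      (forall f : L2 leb3,
         leb3.-integrable setT (fun x => (Normc.normc (f x))%:E) ->
         \forall xi \ae leb3, Fr f xi =
           ((2 * pi) `^ (- (3 / 2)))%:C *
           cintegral leb3 setT (fun x => f x * expNi (dot3 xi x)))].

Variable Fr : L2R3 R -> L2R3 R.

(* omega |-> v_lam(omega) = 2^(-1/2) lam^(1/4) Fr v (sqrt lam omega), in terms of
   a representative of Fr v; for a.e. lam its class in L2(S^2) is well defined. *)
Definition spec_fiber (v : L2R3 R) (lam : R) : R3 R -> R[i] :=
  fun w => (2 `^ (- 2^-1) * lam `^ 4^-1)%:C * Fr v (scale3 (Num.sqrt lam) w).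

Definition represents (v : L2R3 R) (c : R -> L2S2 R) : Prop :=
  \forall lam \ae @lebesgue_measure R,
    0 <= lam -> \forall w \ae sphere, c lam w = spec_fiber v lam w.

(* v belongs to the class E. The fibers v_lam are only defined for a.e. lam: V 0
   is the smooth representative of lam |-> v_lam and V k is its k-th strong
   derivative on [0, +oo[, one-sided at 0. On [0, +oo[, V is determined by v;
   its values on ]-oo, 0[ are junk. *)
Record in_calE (v : L2R3 R) (V : nat -> R -> L2S2 R) : Prop := {
  calE_repr : represents v (V 0%N) ;
  calE_deriv : forall k lam, 0 <= lam ->
    normL2 ((h^-1)%:C *: (V k (lam + h) - V k lam) - V k.+1 lam)
      @[h --> within [set h | 0 <= lam + h] 0^'] --> 0 ;
  calE_zero : forall k N, lam ^- N * normL2 (V k lam) @[lam --> 0^'+] --> 0 ;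
  calE_pinfty : forall k N, lam ^+ N * normL2 (V k lam) @[lam --> +oo] --> 0 }.

Definition vanishes_to_order (n : nat) (V : nat -> R -> L2S2 R) (s : R) :=
  (forall k, (k < n)%N -> V k s = 0) /\ V n s != 0.

Definition spec_pairing (V W : nat -> R -> L2S2 R) (lam : R) : R[i] :=
  if 0 <= lam then innerL2 (V 0%N lam) (W 0%N lam) else 0.

Definition pv_gammaR (f : R -> R) (lam : R) : R :=
  lim ((\int[@lebesgue_measure R]_(x in ~` `]lam - e, lam + e[)
          (f x / (x - lam))) @[e --> 0^'+]).

Definition pv_gamma (f : R -> R[i]) (lam : R) : R[i] :=
  pv_gammaR (fun x => complex.Re (f x)) lam +i*
  pv_gammaR (fun x => complex.Im (f x)) lam.

(* lam |-> (Phi_{v,a})_lam *)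
Definition Phi_curve (V : nat -> R -> L2S2 R) (a lam : R) : L2S2 R :=
  if lam == a then V 1%N a else ((lam - a)^-1)%:C *: V 0%N lam.

(* The self-adjoint realization of -Delta, i.e. multiplication by |xi|^2 on the
   Fourier side with its maximal domain. *)
Definition free_H : unbounded_op (@leb3 R) := fun f g =>
  \forall xi \ae leb3, Fr g xi = (dot3 xi xi)%:C * Fr f xi.

(* Indices 0, 1 : 'I_2 stand for the labels 1, 2. *)
Definition perturbed_H (u : 'I_2 -> L2R3 R) (alpha : R) : unbounded_op (@leb3 R) :=
  fun f g => exists2 h, free_H f h &
    g = h + alpha%:C *: \sum_(j < 2) innerL2 f (u j) *: u j.

Variable U : 'I_2 -> nat -> R -> L2S2 R.

Definition Cmx (alpha lam : R) : 'M[R[i]]_2 :=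
  \matrix_(j, k) ((j == k)%:R + alpha%:C * pv_gamma (spec_pairing (U k) (U j)) lam).

Definition Dmx (alpha lam : R) : 'M[R[i]]_2 :=
  \matrix_(j, k) ((alpha * pi)%:C * spec_pairing (U k) (U j) lam).

Definition Bmx (alpha lam : R) : 'M[R[i]]_2 :=
  Cmx alpha lam + (0 +i* 1) *: Dmx alpha lam.

Definition ReF (alpha lam : R) : R := complex.Re (\det (Bmx alpha lam)).
Definition ImF (alpha lam : R) : R := complex.Im (\det (Bmx alpha lam)).

Definition phase (z : R[i]) : R[i] := if z == 0 then 1 else z / `|z|.

End model.

(* Main.v *)
Require Import Defs.
From HB Require Import structures.
From mathcomp Require Import all_boot all_order all_algebra.
From mathcomp Require Import complex.
From mathcomp Require Import all_classical all_reals all_analysis.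
From mathcomp Require Import measurable_realfun.
From mathcomp Require Import ring lra.

Set Implicit Arguments.
Unset Strict Implicit.
Unset Printing Implicit Defensive.

Import Order.TTheory GRing.Theory Num.Theory.
Import numFieldNormedType.Exports.

Local Open Scope classical_set_scope.
Local Open Scope ring_scope.
Local Open Scope complex_scope.

(** * The inner product of L^2 *)

Section cintegral_theory.
Context d (T : measurableType d) (R : realType).
Variable mu : {measure set T -> \bar R}.
Implicit Types (D : set T) (h k : T -> R[i]).

Definition cintegrable D h :=
  mu.-integrable D (fun x => (complex.Re (h x))%:E) /\
  mu.-integrable D (fun x => (complex.Im (h x))%:E).

Lemma ReD (a b : R[i]) : complex.Re (a + b) = complex.Re a + complex.Re b.
Proof. by case: a; case: b. Qed.
Lemma ImD (a b : R[i]) : complex.Im (a + b) = complex.Im a + complex.Im b.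
Proof. by case: a; case: b. Qed.
Lemma ReN (a : R[i]) : complex.Re (- a) = - complex.Re a.
Proof. by case: a. Qed.
Lemma ImN (a : R[i]) : complex.Im (- a) = - complex.Im a.
Proof. by case: a. Qed.
Lemma ReM (a b : R[i]) : complex.Re (a * b) =
  complex.Re a * complex.Re b - complex.Im a * complex.Im b.
Proof. by case: a; case: b. Qed.
Lemma ImM (a b : R[i]) : complex.Im (a * b) =
  complex.Re a * complex.Im b + complex.Im a * complex.Re b.
Proof. by case: a; case: b. Qed.
Lemma Re_conj (a : R[i]) : complex.Re (conjc a) = complex.Re a.
Proof. by case: a. Qed.
Lemma Im_conj (a : R[i]) : complex.Im (conjc a) = - complex.Im a.
Proof. by case: a. Qed.

Lemma conjD (a b : R[i]) : conjc (a + b) = conjc a + conjc b.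
Proof. exact: rmorphD. Qed.
Lemma conjM (a b : R[i]) : conjc (a * b) = conjc a * conjc b.
Proof. exact: rmorphM. Qed.
Lemma conjN (a : R[i]) : conjc (- a) = - conjc a.
Proof. exact: rmorphN. Qed.

Lemma complex_ReIm (a b : R[i]) : complex.Re a = complex.Re b ->
  complex.Im a = complex.Im b -> a = b.
Proof. by case: a => ? ?; case: b => ? ? /= -> ->. Qed.

Lemma cintegrableD D h k : measurable D ->
  cintegrable D h -> cintegrable D k -> cintegrable D (fun x => h x + k x).
Proof.
move=> mD [h1 h2] [k1 k2]; split.
  under eq_fun do rewrite ReD EFinD; exact: integrableD.
under eq_fun do rewrite ImD EFinD; exact: integrableD.
Qed.

Lemma cintegrableZ D (a : R[i]) h : measurable D ->
  cintegrable D h -> cintegrable D (fun x => a * h x).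
Proof.
move=> mD [h1 h2]; split.
  under eq_fun do rewrite ReM EFinB !EFinM.
  by apply: integrableB => //; apply: integrableZl.
under eq_fun do rewrite ImM EFinD !EFinM.
by apply: integrableD => //; apply: integrableZl.
Qed.

Lemma cintegralD D h k : measurable D -> cintegrable D h -> cintegrable D k ->
  cintegral mu D (fun x => h x + k x) = cintegral mu D h + cintegral mu D k.
Proof.
move=> mD [h1 h2] [k1 k2]; apply: complex_ReIm; rewrite ?ReD ?ImD /=.
  by under eq_Rintegral do rewrite ReD; rewrite RintegralD.
by under eq_Rintegral do rewrite ImD; rewrite RintegralD.
Qed.

Lemma integrableZ_EFin D (a : R) (f : T -> R) : measurable D ->
  mu.-integrable D (EFin \o f) -> mu.-integrable D (EFin \o (fun x => a * f x)).
Proof.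
move=> mD fi; rewrite (_ : _ \o _ = (fun x => a%:E * (EFin \o f) x)%E)//.
exact: integrableZl.
Qed.

Lemma cintegralZ D (a : R[i]) h : measurable D -> cintegrable D h ->
  cintegral mu D (fun x => a * h x) = a * cintegral mu D h.
Proof.
move=> mD [h1 h2]; apply: complex_ReIm; rewrite ?ReM ?ImM /=.
  under eq_Rintegral do rewrite ReM.
  by rewrite RintegralB ?RintegralZl//; exact: integrableZ_EFin.
under eq_Rintegral do rewrite ImM.
by rewrite RintegralD ?RintegralZl//; exact: integrableZ_EFin.
Qed.

Lemma cintegral_conj D h : measurable D -> cintegrable D h ->
  cintegral mu D (fun x => conjc (h x)) = conjc (cintegral mu D h).
Proof.
move=> mD [h1 h2]; apply: complex_ReIm; rewrite ?Re_conj ?Im_conj /=.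
  by under eq_Rintegral do rewrite Re_conj.
under eq_Rintegral do rewrite Im_conj -mulN1r.
by rewrite RintegralZl// mulN1r.
Qed.

Lemma eq_Rintegral_ae D (f g : T -> R) : measurable D ->
  measurable_fun D f -> measurable_fun D g ->
  (\forall x \ae mu, D x -> f x = g x) ->
  \int[mu]_(x in D) f x = \int[mu]_(x in D) g x.
Proof.
move=> mD mf mg fg; congr fine; apply: ae_eq_integral => //.
- exact/measurable_EFinP.
- exact/measurable_EFinP.
- by apply: filterS fg => x /[apply] ->.
Qed.

End cintegral_theory.

Section inner_theory.
Context d (T : measurableType d) (R : realType).
Variable mu : {measure set T -> \bar R}.
Local Notation L2 := (L2 mu).
Implicit Types f g h : L2.

Lemma L2_val_pred f : (f : T -> R[i]) \in L2pred mu.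
Proof. by rewrite /L2_to_fun; case: (repr _). Qed.

Lemma L2pred_measurable (h : T -> R[i]) : h \in L2pred mu ->
  measurable_fun setT (fun x => complex.Re (h x)) /\
  measurable_fun setT (fun x => complex.Im (h x)).
Proof.
move=> /andP[/sub_Lfun_mfun /[!inE]/= mr /sub_Lfun_mfun /[!inE]/= mi].
by split.
Qed.

Lemma measurable_L2_Re f : measurable_fun setT (fun x => complex.Re (f x)).
Proof. exact: (L2pred_measurable (L2_val_pred f)).1. Qed.

Lemma measurable_L2_Im f : measurable_fun setT (fun x => complex.Im (f x)).
Proof. exact: (L2pred_measurable (L2_val_pred f)).2. Qed.

Lemma L2_eqP f g : f = g <-> \forall x \ae mu, f x = g x.
Proof. by rewrite -L2_piP !reprK. Qed.

Lemma L2_exists (h : T -> R[i]) : h \in L2pred mu ->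
  exists f : L2, \forall x \ae mu, f x = h x.
Proof.
by move=> hP; exists (\pi_L2 (MkL2fun hP))%qT; exact: L2_reprE.
Qed.

Lemma L2_addE f g : \forall x \ae mu, (f + g : L2) x = f x + g x.
Proof.
rewrite -[f]reprK -[g]reprK.
have -> : (\pi_L2 (repr f) + \pi_L2 (repr g) =
  \pi_L2 ((repr f : L2fun mu) + repr g) :> L2)%qT by exact: L2_piD.
apply: filterS3 (L2_reprE ((repr f : L2fun mu) + repr g)) (L2_reprE (repr f))
  (L2_reprE (repr g)) => x -> -> ->.
by [].
Qed.

Lemma L2_scaleE a f : \forall x \ae mu, (a *: f : L2) x = a * f x.
Proof.
rewrite -[f]reprK.
have -> : (a *: \pi_L2 (repr f) =
  \pi_L2 (a *: (repr f : L2fun mu)) :> L2)%qT by exact: L2_piZ.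
apply: filterS2 (L2_reprE (a *: (repr f : L2fun mu))) (L2_reprE (repr f))
   => x -> ->.
by [].
Qed.

Lemma L2pred_integrableM (h k : T -> R[i]) :
  h \in L2pred mu -> k \in L2pred mu ->
  cintegrable mu setT (fun x => h x * conjc (k x)).
Proof.
move=> /andP[hr hi] /andP[kr ki].
have iM (a b : T -> R) : a \in Lfun mu 2%:E -> b \in Lfun mu 2%:E ->
    mu.-integrable setT (fun x => (a x * b x)%:E).
  by move=> aP bP; apply/Lfun1_integrable; exact: Lfun2_mul_Lfun1.
split.
  under eq_fun do rewrite ReM Re_conj Im_conj mulrN opprK EFinD.
  by apply: integrableD => //; exact: iM.
under eq_fun do rewrite ImM Re_conj Im_conj mulrN addrC EFinB.
by apply: integrableB => //; exact: iM.
Qed.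

Lemma L2_integrableM f g : cintegrable mu setT (fun x => f x * conjc (g x)).
Proof. by apply: L2pred_integrableM; exact: L2_val_pred. Qed.

Lemma cintegrable_measurable (D : set T) (h : T -> R[i]) : cintegrable mu D h ->
  measurable_fun D (fun x => complex.Re (h x)) /\
  measurable_fun D (fun x => complex.Im (h x)).
Proof.
by case=> /measurable_int mr /measurable_int mi; split; apply/measurable_EFinP.
Qed.

Lemma cintegral_ae (D : set T) (h k : T -> R[i]) : measurable D ->
  cintegrable mu D h -> cintegrable mu D k ->
  (\forall x \ae mu, D x -> h x = k x) -> cintegral mu D h = cintegral mu D k.
Proof.
move=> mD /cintegrable_measurable[hr hi] /cintegrable_measurable[kr ki] hk.
apply: complex_ReIm; apply: eq_Rintegral_ae => //;
  by apply: filterS hk => x /[apply] ->.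
Qed.

Lemma innerL2_ae f g f' g' :
  (\forall x \ae mu, f x * conjc (g x) = f' x * conjc (g' x)) ->
  innerL2 f g = innerL2 f' g'.
Proof.
move=> e; apply: cintegral_ae => //; [exact: L2_integrableM|
  exact: L2_integrableM|by apply: filterS e].
Qed.

Lemma innerDl f g h : innerL2 (f + g) h = innerL2 f h + innerL2 g h.
Proof.
rewrite /innerL2 -cintegralD//; [|exact: L2_integrableM..].
apply: cintegral_ae => //; first exact: L2_integrableM.
  by apply: cintegrableD => //; exact: L2_integrableM.
by apply: filterS (L2_addE f g) => x -> _; rewrite mulrDl.
Qed.

Lemma innerZl a f h : innerL2 (a *: f) h = a * innerL2 f h.
Proof.
rewrite /innerL2 -cintegralZ//; [|exact: L2_integrableM..].
apply: cintegral_ae => //; first exact: L2_integrableM.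
  by apply: cintegrableZ => //; exact: L2_integrableM.
by apply: filterS (L2_scaleE a f) => x -> _; rewrite mulrA.
Qed.

Lemma innerC f g : innerL2 g f = conjc (innerL2 f g).
Proof.
rewrite /innerL2 -cintegral_conj//; last exact: L2_integrableM.
by congr cintegral; apply/funext => x; rewrite conjM conjcK mulrC.
Qed.

Lemma inner0l h : innerL2 0 h = 0.
Proof. by rewrite -(scale0r h) innerZl mul0r. Qed.

Lemma innerNl f h : innerL2 (- f) h = - innerL2 f h.
Proof. by rewrite -scaleN1r innerZl mulN1r. Qed.

Lemma innerBl f g h : innerL2 (f - g) h = innerL2 f h - innerL2 g h.
Proof. by rewrite innerDl innerNl. Qed.

Lemma innerDr f g h : innerL2 h (f + g) = innerL2 h f + innerL2 h g.
Proof. by rewrite innerC innerDl conjD -!innerC. Qed.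

Lemma innerZr a f h : innerL2 h (a *: f) = conjc a * innerL2 h f.
Proof. by rewrite innerC innerZl conjM -innerC. Qed.

Lemma inner0r h : innerL2 h 0 = 0.
Proof. by rewrite innerC inner0l conjc0. Qed.

Lemma innerNr f h : innerL2 h (- f) = - innerL2 h f.
Proof. by rewrite innerC innerNl conjN -innerC. Qed.

Lemma innerBr f g h : innerL2 h (f - g) = innerL2 h f - innerL2 h g.
Proof. by rewrite innerDr innerNr. Qed.

Lemma inner_suml (I : finType) (F : I -> L2) h :
  innerL2 (\sum_i F i) h = \sum_i innerL2 (F i) h.
Proof.
exact: (big_morph (fun f => innerL2 f h) (fun f g => innerDl f g h) (inner0l h)).
Qed.

Lemma inner_ge0 f : 0 <= complex.Re (innerL2 f f).
Proof.
by apply: Rintegral_ge0 => x _; rewrite ReM Re_conj Im_conj mulrN opprK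
  addr_ge0// -expr2 sqr_ge0.
Qed.

Lemma inner_selfE f : innerL2 f f = (normL2 f ^+ 2)%:C.
Proof.
have := innerC f f; rewrite /normL2 sqr_sqrtr ?inner_ge0//.
case: (innerL2 f f) => a b [] /eqP; rewrite -subr_eq0 opprK -mulr2n mulrn_eq0.
by move=> /= /eqP ->.
Qed.

Lemma normL2_ge0 f : 0 <= normL2 f. Proof. exact: sqrtr_ge0. Qed.

Lemma normL2_sqr f : normL2 f ^+ 2 = complex.Re (innerL2 f f).
Proof. by rewrite inner_selfE. Qed.

Lemma normL2_eq0 f : normL2 f = 0 -> f = 0.
Proof.
move=> f0; have [ir _] := L2_integrableM f f.
have : (\int[mu]_x (complex.Re (f x * conjc (f x)))%:E = 0)%E.
  rewrite -[LHS]fineK; last exact: integrable_fin_num ir.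
  rewrite -[fine _]/(complex.Re (innerL2 f f)) -normL2_sqr f0 expr0n//.
move=> i0; apply/L2_eqP.
have : ae_eq mu setT (fun x => (complex.Re (f x * conjc (f x)))%:E) (cst 0%E).
  apply/ae_eq_integral_abs => //; first exact: measurable_int ir.
  rewrite -[RHS]i0; apply: eq_integral => x _; rewrite gee0_abs// lee_fin.
  by rewrite ReM Re_conj Im_conj mulrN opprK addr_ge0// -expr2 sqr_ge0.
move=> e; have z : \forall x \ae mu, (0 : L2) x = 0.
  have := L2_scaleE 0 (0 : L2); rewrite scale0r.
  by apply: filterS => x ->; rewrite mul0r.
apply: filterS2 e z => x /(_ Logic.I) /= e ->.
move: e => []; rewrite ReM Re_conj Im_conj mulrN opprK -!expr2 => /eqP.
rewrite paddr_eq0 ?sqr_ge0// !sqrf_eq0 => /andP[/eqP a /eqP b].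
exact: complex_ReIm.
Qed.

Lemma normc_sqr (z : R[i]) :
  Normc.normc z ^+ 2 = complex.Re z ^+ 2 + complex.Im z ^+ 2.
Proof. by case: z => a b /=; rewrite sqr_sqrtr// addr_ge0// sqr_ge0. Qed.

Lemma normL2Z a f : normL2 (a *: f) = Normc.normc a * normL2 f.
Proof.
rewrite {1}/normL2 innerZl innerZr mulrA inner_selfE.
case: a => a b /=.
rewrite (_ : _ - _ = (a ^+ 2 + b ^+ 2) * normL2 f ^+ 2); last by ring.
by rewrite sqrtrM ?addr_ge0 ?sqr_ge0// sqrtr_sqr ger0_norm ?normL2_ge0.
Qed.

Lemma normL20 : normL2 (0 : L2) = 0.
Proof. by rewrite /normL2 inner0l sqrtr0. Qed.

(** The square $\|f - t \langle f, g\rangle g\|^2 \ge 0$ is expanded with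
    $t = \|g\|^{-2}$. *)
Lemma inner_CauchySchwarz f g :
  Normc.normc (innerL2 f g) <= normL2 f * normL2 g.
Proof.
have [g0|g0] := eqVneq (normL2 g) 0.
  by rewrite (normL2_eq0 g0) inner0r normL20 mulr0 Normc.normc0.
have gp : 0 < normL2 g ^+ 2 by rewrite exprn_gt0// lt_neqAle eq_sym g0 normL2_ge0.
rewrite -ler_sqr ?nnegrE ?mulr_ge0 ?normL2_ge0//;
  last by case: (innerL2 f g) => a b; exact: sqrtr_ge0.
have := inner_ge0 (f - (((normL2 g ^+ 2)^-1)%:C * innerL2 f g) *: g).
rewrite innerBl !innerBr !innerZl !innerZr !inner_selfE (innerC f g).
rewrite normc_sqr exprMn; case: (innerL2 f g) => a b /= H.
have {H} : 0 <= normL2 f ^+ 2 - (normL2 g ^+ 2)^-1 * (a ^+ 2 + b ^+ 2).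
  by move: H; congr (0 <= _); field.
by rewrite subr_ge0 ler_pdivrMl// mulrC.
Qed.

Lemma normc_Re (z : R[i]) : `|complex.Re z| <= Normc.normc z.
Proof.
case: z => a b /=; rewrite -sqrtr_sqr ler_wsqrtr// lerDl sqr_ge0//.
Qed.

Lemma normc_ge0 (z : R[i]) : 0 <= Normc.normc z.
Proof. by case: z => a b; exact: sqrtr_ge0. Qed.

Lemma ler_normL2D f g : normL2 (f + g) <= normL2 f + normL2 g.
Proof.
rewrite -ler_sqr ?nnegrE ?addr_ge0 ?normL2_ge0// sqrrD !normL2_sqr.
rewrite innerDl !innerDr !ReD (innerC f g) Re_conj.
have : complex.Re (innerL2 f g) <= normL2 f * normL2 g.
  by rewrite (le_trans _ (inner_CauchySchwarz f g))// (le_trans (ler_norm _))// normc_Re.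
by move=> ?; lra.
Qed.

Lemma normL2N f : normL2 (- f) = normL2 f.
Proof. by rewrite /normL2 innerNl innerNr opprK. Qed.

Lemma ler_normL2B f g : normL2 (f - g) <= normL2 f + normL2 g.
Proof. by rewrite (le_trans (ler_normL2D _ _))// normL2N. Qed.

Lemma ler_normL2_sum (I : finType) (F : I -> L2) :
  normL2 (\sum_i F i) <= \sum_i normL2 (F i).
Proof.
elim/big_ind2 : _ => [|f a g b fa gb|//]; first by rewrite normL20.
by rewrite (le_trans (ler_normL2D _ _))// lerD.
Qed.

Lemma normL2_dist f g : `|normL2 f - normL2 g| <= normL2 (f - g).
Proof.
rewrite ler_norml; apply/andP; split.
  rewrite lerNl opprB lerBlDr -{1}(subrK f g) (le_trans (ler_normL2D _ _))//.
  by rewrite lerD2r -normL2N opprB.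
by rewrite lerBlDr -{1}(subrK g f) ler_normL2D.
Qed.

(** The four unit multiples of one argument recover a sesquilinear form from
    its real part on the diagonal; here only the vanishing is used. *)
Lemma inner_eq0_ext f g : (forall h, innerL2 f h = innerL2 g h) -> f = g.
Proof.
move=> H; apply/eqP; rewrite -subr_eq0; apply/eqP/normL2_eq0/eqP.
by rewrite -sqrf_eq0 normL2_sqr innerBl H subrr.
Qed.

End inner_theory.

(** * Spectral projections *)

Section spectral.
Context d (T : measurableType d) (R : realType).
Variable mu : {measure set T -> \bar R}.
Local Notation L2 := (L2 mu).
Variables (A : unbounded_op mu) (E : set (measurableTypeR R) -> L2 -> L2).
Hypothesis hE : spectral_measure_of A E.
Implicit Types (f g h : L2) (B C : set (measurableTypeR R)).

Lemma selfadj_add f g a b : A f a -> A g b -> A (f + g) (a + b).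
Proof.
case: hE => -[_ sa] _ _ _ /sa Af /sa Ag; apply/sa => h k Ahk.
by rewrite !innerDr (Af _ _ Ahk) (Ag _ _ Ahk).
Qed.

Lemma selfadj_scale c f a : A f a -> A (c *: f) (c *: a).
Proof.
case: hE => -[_ sa] _ _ _ /sa Af; apply/sa => h k Ahk.
by rewrite !innerZr (Af _ _ Ahk).
Qed.

Lemma selfadj_sub f g a b : A f a -> A g b -> A (f - g) (a - b).
Proof.
by move=> Af /(selfadj_scale (-1)); rewrite !scaleN1r; exact: selfadj_add.
Qed.

Lemma selfadj_sym f g a b : A f a -> A g b -> innerL2 a g = innerL2 f b.
Proof. by case: hE => -[_ sa] _ _ _ Af /sa; apply. Qed.

Section projections.
Variables (B : set (measurableTypeR R)) (mB : measurable B).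

Lemma specD f g : E B (f + g) = E B f + E B g.
Proof.
by case: hE => _ /(_ _ mB)[lE _ _] _ _; have := lE 1 f g; rewrite !scale1r.
Qed.

Lemma specZ c f : E B (c *: f) = c *: E B f.
Proof.
case: hE => _ /(_ _ mB)[lE _ _] _ _.
have E0 : E B 0 = 0.
  have := lE 1 0 0; rewrite !scale1r addr0 => /eqP.
  by rewrite -[X in X == _]addr0 (inj_eq (addrI _)) => /eqP.
by have := lE c f 0; rewrite !addr0 E0 addr0.
Qed.

Lemma specN f : E B (- f) = - E B f.
Proof. by rewrite -scaleN1r specZ scaleN1r. Qed.

Lemma specB f g : E B (f - g) = E B f - E B g.
Proof. by rewrite specD specN. Qed.

Lemma spec_idem f : E B (E B f) = E B f.
Proof. by case: hE => _ /(_ _ mB)[]. Qed.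

Lemma spec_sym f g : innerL2 (E B f) g = innerL2 f (E B g).
Proof. by case: hE => _ /(_ _ mB)[]. Qed.

Lemma spec_normE f : normL2 (E B f) ^+ 2 = complex.Re (innerL2 (E B f) f).
Proof. by rewrite normL2_sqr -spec_sym spec_idem. Qed.

End projections.

Lemma specT f : E setT f = f. Proof. by case: hE. Qed.

Lemma spec_meas_exists f : exists m : {measure set (measurableTypeR R) -> \bar R},
  [/\ (forall B, measurable B -> (m B = (normL2 (E B f) ^+ 2)%:E)%E),
             ((exists g, A f g) <-> (\int[m]_x (x ^+ 2)%:E < +oo)%E) &
             (forall g, A f g -> innerL2 g f = (\int[m]_x x)%:C)].
Proof.
case: hE => _ _ _ /(_ f)[m [mE mdom mint]]; exists m; split => // B mB.
by rewrite mE// spec_normE.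
Qed.

Definition specm f := sval (cid (spec_meas_exists f)).

Lemma specmE f B : measurable B -> (specm f B = (normL2 (E B f) ^+ 2)%:E)%E.
Proof. by move=> mB; have [+ _ _] := svalP (cid (spec_meas_exists f)); apply. Qed.

Lemma specm_dom f : (exists g, A f g) <-> (\int[specm f]_x (x ^+ 2)%:E < +oo)%E.
Proof. by have [_ + _] := svalP (cid (spec_meas_exists f)); apply. Qed.

Lemma specm_form f g : A f g -> innerL2 g f = (\int[specm f]_x x)%:C.
Proof. by have [_ _ +] := svalP (cid (spec_meas_exists f)); apply. Qed.

Lemma spec_disj_sqr B C f : measurable B -> measurable C -> B `&` C = set0 ->
  normL2 (E (B `|` C) f) ^+ 2 = normL2 (E B f) ^+ 2 + normL2 (E C f) ^+ 2.
Proof.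
move=> mB mC BC; apply: EFin_inj; rewrite EFinD -!specmE//; last exact: measurableU.
exact: measureU.
Qed.

Lemma spec_norm_le B f : measurable B -> normL2 (E B f) <= normL2 f.
Proof.
move=> mB; rewrite -ler_sqr ?nnegrE ?normL2_ge0//.
have := @spec_disj_sqr B (~` B) f mB (measurableC mB) (setICr _).
by rewrite setUv specT => ->; rewrite lerDl sqr_ge0.
Qed.

(** The squared norms of the two projections of a vector fixed by one of them
    already add up to at most its own squared norm. *)
Lemma spec_disj B C f : measurable B -> measurable C -> B `&` C = set0 ->
  E B (E C f) = 0.
Proof.
move=> mB mC BC; apply: normL2_eq0; apply/eqP; rewrite -sqrf_eq0.
have := spec_disj_sqr (E C f) mB mC BC; rewrite (spec_idem mC).
have : normL2 (E (B `|` C) (E C f)) ^+ 2 <= normL2 (E C f) ^+ 2.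
  by rewrite ler_sqr ?nnegrE ?normL2_ge0// spec_norm_le//; exact: measurableU.
by move=> + e; rewrite {}e -lerBrDr subrr => le0; rewrite eq_le le0 sqr_ge0.
Qed.

Lemma specU B C f : measurable B -> measurable C -> B `&` C = set0 ->
  E (B `|` C) f = E B f + E C f.
Proof.
move=> mB mC BC; have mU := measurableU _ _ mB mC.
pose D := ~` (B `|` C); have mD : measurable D by exact: measurableC.
have BD : B `&` D = set0.
  by apply/seteqP; split=> // x [Bx]; apply; left.
have CD : C `&` D = set0.
  by apply/seteqP; split=> // x [Cx]; apply; right.
have DB : D `&` B = set0 by rewrite setIC.
have DC : D `&` C = set0 by rewrite setIC.
have CB : C `&` B = set0 by rewrite setIC.
have BCD : (B `|` C) `|` D = setT by exact: setUv.
(* the remainder is killed by the three projections, whose squared norms add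
   up to the full norm *)
have z g : E B g = 0 -> E C g = 0 -> E D g = 0 -> g = 0.
  move=> Bg Cg Dg; apply: normL2_eq0; apply/eqP; rewrite -sqrf_eq0.
  rewrite -(specT g) -BCD spec_disj_sqr//; last exact: setICr.
  by rewrite spec_disj_sqr// Bg Cg Dg normL20 expr0n/= !addr0.
have dec g : g = E B g + E C g + E D g.
  apply/eqP; rewrite -subr_eq0; apply/eqP/z.
  - by rewrite specB// !specD// spec_idem// !spec_disj// !addr0 subrr.
  - by rewrite specB// !specD// spec_idem// !spec_disj// !addr0 add0r subrr.
  - by rewrite specB// !specD// spec_idem// !spec_disj// !add0r subrr.
have uD g : E (B `|` C) (E D g) = 0 by rewrite spec_disj// setICr.
have sub X g : measurable X -> X `&` D = set0 -> X `<=` B `|` C ->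
    E (B `|` C) (E X g) = E X g.
  move=> mX XD XBC; apply/eqP; rewrite eq_sym -subr_eq0; apply/eqP.
  have := spec_disj_sqr (E X g) mU mD (setICr _).
  rewrite BCD specT (@spec_disj D X)//; last by rewrite setIC.
  rewrite normL20 expr0n/= addr0 => e.
  apply: normL2_eq0; apply/eqP; rewrite -sqrf_eq0 normL2_sqr innerBl !innerBr.
  rewrite (spec_sym mU _ (E (B `|` C) _)) (spec_idem mU) -(spec_sym mU) subrr subr0.
  by rewrite ReD ReN -normL2_sqr e (spec_normE mU) subrr.
rewrite {1}(dec f) !specD// uD addr0 !sub//.
Qed.

Lemma specC B f : measurable B -> E (~` B) f = f - E B f.
Proof.
move=> mB; have := @specU B (~` B) f mB (measurableC mB) (setICr _).
by rewrite setUv specT => {2}->; rewrite addrAC subrr add0r.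
Qed.

Lemma spec_sub B C f : measurable B -> measurable C -> C `<=` B ->
  E B (E C f) = E C f.
Proof.
move=> mB mC CB; apply/eqP; rewrite eq_sym -subr_eq0 -specC//; apply/eqP.
rewrite spec_disj//; first exact: measurableC.
by apply/seteqP; split=> // x [nB /CB].
Qed.

Lemma specI B C f : measurable B -> measurable C ->
  E B (E C f) = E (B `&` C) f.
Proof.
move=> mB mC; have mBC := measurableI _ _ mB mC.
have mCB := measurableD mC mB.
have eC : C = (B `&` C) `|` (C `\` B).
  by rewrite (setIC B) setUIDK.
rewrite {1}eC specU//; last by apply/seteqP; split => // x [[Bx _] [_ +]]; apply.
rewrite specD// spec_sub//.
rewrite (_ : E B (E (C `\` B) f) = 0) ?addr0//; apply: spec_disj => //.
by apply/seteqP; split=> // x [Bx [_]]; apply.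
Qed.

Lemma specm_proj B C f : measurable B -> measurable C ->
  specm (E B f) C = specm f (C `&` B).
Proof.
by move=> mB mC; rewrite !specmE ?specI//; exact: measurableI.
Qed.

Lemma specm_fin f : (specm f setT < +oo)%E.
Proof. by rewrite specmE// ltry. Qed.

Lemma specm_integrable (f a : L2) : A f a -> (specm f).-integrable setT (EFin \o @id R).
Proof.
move=> Af; have /specm_dom i2 : exists a, A f a by exists a.
have mx : measurable_fun [set: measurableTypeR R] (fun x : R => x) by exact: measurable_id.
have mx2 : measurable_fun [set: measurableTypeR R] (fun x : R => (x ^+ 2)%:E).
  by apply/measurable_EFinP; exact: measurable_funX.
apply: (@le_integrable _ (measurableTypeR R) R (specm f) setT measurableT _ (fun x : R => (1 + x ^+ 2 : R)%:E)) => //.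
- exact/measurable_EFinP.
- move=> x _; rewrite !abse_EFin lee_fin (ger0_norm (addr_ge0 ler01 (sqr_ge0 _))).
  by rewrite ler_norml; apply/andP; split; nra.
- under eq_fun do rewrite EFinD; apply: integrableD => //.
    apply/integrableP; split; first exact: measurable_cst.
    by rewrite integral_cst// normr1 mul1e specm_fin.
  apply/integrableP; split => //.
  by under eq_integral do rewrite gee0_abs ?lee_fin ?sqr_ge0//.
Qed.

Lemma integral_specm_proj B f (k : measurableTypeR R -> R) :
  measurable B -> measurable_fun setT k ->
  (\int[specm (E B f)]_x (k x)%:E = \int[specm f]_(x in B) (k x)%:E)%E.
Proof.
move=> mB mk; have mk' : measurable_fun setT (EFin \o k) by exact/measurable_EFinP.
rewrite -(setUv B) integral_setU_EFin//; last 3 first.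
- exact: measurableC.
- by rewrite setUv.
- by apply/disj_setPCl.
rewrite (@null_set_integral _ _ _ _ (~` B)).
- rewrite adde0; apply: eq_measure_integral => C mC CB.
  by rewrite specm_proj//; congr (specm _ _); exact/setIidPl.
- exact: measurableC.
- exact: measurable_funTS.
- by rewrite specm_proj ?setICl//; exact: measurableC.
Qed.

Lemma spec_dom B f a : measurable B -> A f a -> exists b, A (E B f) b.
Proof.
move=> mB Af; apply/specm_dom.
have mx2 : measurable_fun [set: measurableTypeR R] (fun x : R => (x ^+ 2)).
  exact: measurable_funX.
rewrite integral_specm_proj//.
have /specm_dom : exists a, A f a by exists a.
apply: le_lt_trans; apply: ge0_subset_integral => //.
  exact/measurable_EFinP.
by move=> x _; rewrite lee_fin sqr_ge0.
Qed.

Lemma spec_dom_bounded B f (r : R) : measurable B ->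
  (forall x, B x -> `|x| <= r) -> exists b, A (E B f) b.
Proof.
move=> mB Br; apply/specm_dom.
have mx2 : measurable_fun [set: measurableTypeR R] (fun x : R => (x ^+ 2)).
  exact: measurable_funX.
rewrite integral_specm_proj//.
apply: (@le_lt_trans _ _ (\int[specm f]_(x in B) (cst (r ^+ 2)%:E x))%E).
  apply: ge0_le_integral => //.
  - by move=> x _; rewrite lee_fin sqr_ge0.
  - by apply/measurable_EFinP; exact: measurable_funTS.
  - by move=> x /Br xr; rewrite lee_fin -real_normK ?num_real// ler_sqr ?nnegrE// (le_trans _ xr).
rewrite integral_cst// specmE// -EFinM ltry//.
Qed.

Lemma spec_form B f a b : measurable B -> A f a -> A (E B f) b ->
  innerL2 b (E B f) = (\int[specm f]_(x in B) x)%:C.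
Proof.
move=> mB Af AB; rewrite (specm_form AB); congr (_%:C); congr fine.
by rewrite integral_specm_proj//.
Qed.

Lemma spec_form_split B f a b c : measurable B -> A f a -> A (E B f) b ->
  A (E (~` B) f) c ->
  innerL2 a f = innerL2 b (E B f) + innerL2 c (E (~` B) f).
Proof.
move=> mB Af Ab Ac; have mC := measurableC mB.
rewrite (spec_form mB Af Ab) (spec_form mC Af Ac) (specm_form Af).
rewrite -[RHS]/(real_complex R _ + real_complex R _) -rmorphD/= -Rintegral_setU//.
- by rewrite setUv.
- by rewrite setUv; exact: specm_integrable Af.
- exact/disj_setPCl.
Qed.

(** The operator respects the splitting into a spectral subspace and its
    complement. Only its quadratic form is tied to the measure, so the cross
    term is isolated by testing against a sum, once with the factor [i]. *)
Lemma spec_reduces B f g a b : measurable B ->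
  A (E B f) a -> A (E (~` B) g) b -> innerL2 a (E (~` B) g) = 0.
Proof.
move=> mB Aa Ab; have mC := measurableC mB.
have key c : complex.Re (innerL2 a (E (~` B) (c *: g))) = 0.
  have Abc : A (E (~` B) (c *: g)) (c *: b).
    by rewrite specZ//; exact: selfadj_scale.
  set F := E B f + E (~` B) (c *: g).
  have FB : E B F = E B f by rewrite specD// spec_idem// spec_disj ?addr0// setICr.
  have FC : E (~` B) F = E (~` B) (c *: g).
    by rewrite specD// spec_idem// spec_disj ?add0r// setICl.
  have AF := selfadj_add Aa Abc.
  have := spec_form_split mB AF; rewrite FB FC => /(_ _ _ Aa Abc).
  rewrite innerDl !innerDr => H.
  have : innerL2 a (E (~` B) (c *: g)) + innerL2 (c *: b) (E B f) = 0.
    apply: (addrI (innerL2 a (E B f) + innerL2 (c *: b) (E (~` B) (c *: g)))).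
    by rewrite addr0 -[RHS]H; ring.
  rewrite (selfadj_sym Abc Aa) (innerC a) => /(congr1 (@complex.Re R)).
  by rewrite ReD Re_conj -mulr2n /= => /eqP; rewrite mulrn_eq0/= => /eqP.
apply: complex_ReIm.
  by have := key 1; rewrite scale1r.
have := key 'i%C; rewrite specZ// innerZr ReM/= mul0r mulN1r sub0r opprK => ->.
by [].
Qed.

End spectral.

Section spectral_bounds.
Context d (T : measurableType d) (R : realType).
Variable mu : {measure set T -> \bar R}.
Local Notation L2 := (L2 mu).
Variables (A : unbounded_op mu) (E : set (measurableTypeR R) -> L2 -> L2).
Hypothesis hE : spectral_measure_of A E.
Implicit Types (f g h : L2) (B C I : set (measurableTypeR R)).

Lemma spec_form_cross B f a : measurable B -> A f a ->
  innerL2 a (E B f) = (\int[specm hE f]_(x in B) x)%:C.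
Proof.
move=> mB Af; have [b Ab] := spec_dom hE mB Af.
have Ac : A (E (~` B) f) (a - b) by rewrite (specC hE)//; exact: (selfadj_sub hE).
rewrite -(spec_form hE mB Af Ab) -[in LHS](subrK b a) innerDl.
rewrite (selfadj_sym hE Ac Ab) innerC (spec_reduces hE mB Ab Ac).
by rewrite conjc0 add0r.
Qed.

Lemma spec_halfline_bound B f a (dl sg m : R) : measurable B -> A f a ->
  (forall x, B x -> dl <= sg * (x - m)) ->
  dl * normL2 (E B f) ^+ 2 <= sg * complex.Re (innerL2 (a - m%:C *: f) (E B f)).
Proof.
move=> mB Af Bm.
have mE : fine (specm hE f B) = normL2 (E B f) ^+ 2 by rewrite specmE.
have fin : (specm hE f B < +oo)%E by rewrite specmE// ltry.
have ii : (specm hE f).-integrable B (EFin \o @id R).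
  by apply: integrableS (specm_integrable hE Af).
have ic c : (specm hE f).-integrable B (EFin \o (fun=> c : R)).
  apply/integrableP; split; first exact: measurable_cst.
  by rewrite /= integral_cst// lte_mul_pinfty// lee_fin.
have isub : (specm hE f).-integrable B (EFin \o (fun x : R => x - m)).
  rewrite (_ : _ \o _ = (EFin \o @id R) \- (EFin \o (fun=> m)))%E//.
  by apply: integrableB => //; exact: (ic m).
have -> : complex.Re (innerL2 (a - m%:C *: f) (E B f)) =
    \int[specm hE f]_(x in B) (x - m).
  rewrite (@RintegralB _ _ _ _ B (fun x => x) (fun=> m))//.
  rewrite Rintegral_cst// mE innerBl spec_form_cross// innerZl.
  by rewrite (spec_normE hE)// (spec_sym hE)// ReD ReN ReM /= mul0r subr0.
rewrite -mE -(@Rintegral_cst _ _ _ _ B)// -RintegralZl//.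
by apply: le_Rintegral => //; exact: integrableZ_EFin.
Qed.

(** A vector that nearly solves the eigenvalue equation at [m] has most of its
    mass near [m]. Above and below [m] the form of [A - m] has a definite sign,
    so the two parts are tested separately. *)
Lemma spec_gap I f a (dl m : R) : measurable I -> A f a -> 0 <= dl ->
  (forall x, ~ I x -> dl <= `|x - m|) ->
  dl * normL2 (f - E I f) <= normL2 (a - m%:C *: f).
Proof.
move=> mI Af dl0 gap.
pose Bp := ~` I `&` `]m, +oo[%classic; pose Bm := ~` I `&` `]-oo, m]%classic.
have mBp : measurable (Bp : set (measurableTypeR R)).
  by apply: measurableI; [exact: measurableC|exact: measurable_itv].
have mBm : measurable (Bm : set (measurableTypeR R)).
  by apply: measurableI; [exact: measurableC|exact: measurable_itv].
have Bpm : Bp `&` Bm = set0.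
  apply/seteqP; split=> // x [[_]]; rewrite /= in_itv/= andbT => mx [_].
  by rewrite /= in_itv/= leNgt mx.
have BU : Bp `|` Bm = ~` I.
  apply/seteqP; split=> [x [[]|[]]//|x nIx].
  by case: (ltP m x) => mx; [left|right]; split => //; rewrite /= in_itv/= ?andbT.
rewrite -(specC hE)// -BU (specU hE)//.
have hp : dl * normL2 (E Bp f) ^+ 2 <=
    complex.Re (innerL2 (a - m%:C *: f) (E Bp f)).
  rewrite -[leRHS]mul1r; apply: spec_halfline_bound => // x [nI].
  rewrite /= in_itv/= andbT mul1r => mx; rewrite -[leRHS]ger0_norm ?gap//.
  by rewrite subr_ge0 ltW.
have hm : dl * normL2 (E Bm f) ^+ 2 <=
    - complex.Re (innerL2 (a - m%:C *: f) (E Bm f)).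
  rewrite -mulN1r; apply: spec_halfline_bound => // x [nI].
  rewrite /= in_itv/= mulN1r opprB => mx; rewrite -[leRHS]ger0_norm ?subr_ge0//.
  by rewrite distrC gap.
have orth : innerL2 (E Bp f) (E Bm f) = 0.
  by rewrite (spec_sym hE)// (spec_disj hE)// inner0r.
have nD : normL2 (E Bp f + E Bm f) ^+ 2 = normL2 (E Bp f) ^+ 2 + normL2 (E Bm f) ^+ 2.
  by rewrite -(specU hE)// (spec_disj_sqr hE).
have nB : normL2 (E Bp f - E Bm f) ^+ 2 = normL2 (E Bp f) ^+ 2 + normL2 (E Bm f) ^+ 2.
  by rewrite normL2_sqr innerBl !innerBr (innerC (E Bp f) (E Bm f)) orth conjc0 !normL2_sqr !(ReD, ReN)/=; ring.
have eN : normL2 (E Bp f - E Bm f) = normL2 (E Bp f + E Bm f).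
  by rewrite -[LHS]ger0_norm ?normL2_ge0// -sqrtr_sqr nB -nD sqrtr_sqr ger0_norm ?normL2_ge0.
have H : dl * normL2 (E Bp f + E Bm f) ^+ 2 <=
    normL2 (a - m%:C *: f) * normL2 (E Bp f + E Bm f).
  rewrite nD mulrDr (le_trans (lerD hp hm))// -eN.
  rewrite (le_trans _ (inner_CauchySchwarz _ _))// (le_trans _ (normc_Re _))//.
  by rewrite innerBr ReD ReN ler_norm.
have [->|n0] := eqVneq (normL2 (E Bp f + E Bm f)) 0; first by rewrite mulr0 normL2_ge0.
move: H; rewrite expr2 mulrA ler_pM2r// lt_neqAle eq_sym n0 normL2_ge0//.
Qed.

Lemma spec_eigenvector f (l : R) : A f (l%:C *: f) -> E [set l] f = f.
Proof.
move=> Af; apply/eqP; rewrite eq_sym -subr_eq0 -(specC hE)//; apply/eqP.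
apply: normL2_eq0; apply/eqP; rewrite -sqrf_eq0; apply/eqP; apply: EFin_inj.
rewrite -(specmE hE); last exact: measurableC.
pose I (n : nat) : set (measurableTypeR R) := `[l - n.+1%:R^-1, l + n.+1%:R^-1]%classic.
have mI n : measurable (I n) by exact: measurable_itv.
have I0 n : specm hE f (~` I n) = 0%E.
  rewrite specmE; last exact: measurableC.
  rewrite (specC hE)//; have := @spec_gap (I n) f _ n.+1%:R^-1 l (mI n) Af.
  rewrite subrr normL20 invr_ge0 ler0n => /(_ isT) H.
  have {}H : n.+1%:R^-1 * normL2 (f - E (I n) f) <= 0.
    apply: H => x; rewrite /I/= in_itv/= => /negP.
    rewrite -ler_distlC -ltNge => /ltW; by rewrite distrC.
  move: H; rewrite pmulr_rle0 ?invr_gt0// => H.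
  suff -> : normL2 (f - E (I n) f) = 0 by rewrite expr0n.
  by apply/eqP; rewrite eq_le H normL2_ge0.
have -> : ~` [set l] = \bigcup_n ~` I n.
  apply/seteqP; split=> [x xl|x [n _]]; last first.
    apply: contra_not => -> ; rewrite /I/= in_itv/= lerBlDr lerDl.
    by rewrite invr_ge0 ler0n.
  have xl0 : 0 < `|x - l| by rewrite normr_gt0 subr_eq0; apply/eqP.
  have [n /= nx] := ltr_add_invr xl0; exists n => //.
  move=> /=; rewrite /I/= in_itv/= -ler_distlC distrC leNgt.
  by move: nx; rewrite add0r => ->.
apply/(@negligibleP _ _ _ (specm hE f)).
  by apply: bigcup_measurable => n _; exact: measurableC.
by apply: negligible_bigcup => n; apply/negligibleP; [exact: measurableC|exact: I0].
Qed.

(** On the range of a spectral projection of a small interval [A - m] is small.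
    Its form is bounded there, and polarization of a symmetric form bounds the
    off-diagonal values; the rescaling by [t] makes the parallelogram estimate
    sharp enough. *)
Lemma spec_range_bound I f a (s m : R) : measurable I -> A f a -> 0 < s ->
  (forall x, I x -> `|x - m| <= s) ->
  normL2 (E I (a - m%:C *: f)) <= s * normL2 f.
Proof.
move=> mI Af s0 Is; set w := E I _.
have bI x : I x -> `|x| <= `|m| + s.
  by move=> /Is xs; have := ler_normD (x - m) m; rewrite subrK; lra.
have [c Ac] : exists c, A w c by exact: (spec_dom_bounded hE _ mI bI).
have [b Ab] : exists b, A (E I f) b by exact: (spec_dom hE mI Af).
have Iw : E I w = w by exact: (spec_idem hE).
have quad v e : A (E I v) e ->
    `|complex.Re (innerL2 (e - m%:C *: E I v) (E I v))| <= s * normL2 (E I v) ^+ 2.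
  move=> Ae; have nI : normL2 (E I (E I v)) = normL2 (E I v) by rewrite (spec_idem hE).
  have := @spec_halfline_bound I (E I v) e (- s) 1 m mI Ae.
  have := @spec_halfline_bound I (E I v) e (- s) (-1) m mI Ae.
  rewrite (spec_idem hE)// => h1 h2; rewrite ler_norml; apply/andP; split.
    rewrite -mulNr -[leRHS]mul1r; apply: h2 => x /Is.
    by rewrite mul1r ler_norml => /andP[].
  rewrite -lerN2 -mulNr -(mulN1r (complex.Re _)); apply: h1 => x /Is.
  by rewrite mulN1r lerN2; apply: le_trans; exact: ler_norm.
set g := E I f in Ab *.
have Ig : E I g = g by exact: (spec_idem hE).
pose B := b - m%:C *: g; pose C := c - m%:C *: w.
have BC : complex.Re (innerL2 B w) = complex.Re (innerL2 C g).
  rewrite !innerBl !innerZl (selfadj_sym hE Ab Ac) (innerC c) (innerC w).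
  by rewrite !(ReD, ReN, ReM, Re_conj, Im_conj)/=; ring.
have ww : normL2 w ^+ 2 = complex.Re (innerL2 C g).
  have Af' : A (E (~` I) f) (a - b) by rewrite (specC hE)//; exact: (selfadj_sub hE).
  have Ac' : A (E I w) c by rewrite Iw.
  have aw : innerL2 a w = innerL2 g c.
    rewrite (selfadj_sym hE Af Ac) -(subrK g f) innerDl -(specC hE)//.
    by rewrite (innerC c) (spec_reduces hE mI Ac' Af') conjc0 add0r.
  have fw : innerL2 f w = innerL2 g w by rewrite (spec_sym hE)// Iw.
  have wE : w = E I (a - m%:C *: f) by [].
  rewrite normL2_sqr {1}wE (spec_sym hE)// Iw !innerBl !innerZl aw fw.
  rewrite (innerC c) (innerC w).
  by rewrite !(ReD, ReN, ReM, Re_conj, Im_conj)/=; ring.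
have Ap : A (E I (s%:C *: f + w)) (s%:C *: b + c).
  by rewrite (specD hE)// (specZ hE)// Iw; apply: (selfadj_add hE) => //; exact: (selfadj_scale hE).
have Aq : A (E I (s%:C *: f - w)) (s%:C *: b - c).
  by rewrite (specB hE)// (specZ hE)// Iw; apply: (selfadj_sub hE) => //; exact: (selfadj_scale hE).
have := quad _ _ Ap; have := quad _ _ Aq.
rewrite (specB hE)// (specD hE)// !(specZ hE)// Iw -/g.
have -> : s%:C *: b - c - m%:C *: (s%:C *: g - w) = s%:C *: B - C.
  rewrite /B /C !scalerBr !scalerA (mulrC s%:C) !opprB addrACA [RHS]addrACA.
  by congr (_ + _); exact: addrC.
have -> : s%:C *: b + c - m%:C *: (s%:C *: g + w) = s%:C *: B + C.
  by rewrite /B /C !scalerBr scalerDr !scalerA (mulrC s%:C) opprD addrACA.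
have nP : normL2 (s%:C *: g + w) ^+ 2 =
    s ^+ 2 * normL2 g ^+ 2 + normL2 w ^+ 2 + 2 * s * complex.Re (innerL2 g w).
  rewrite !normL2_sqr !(innerDl, innerDr, innerZl, innerZr) (innerC g w).
  by rewrite !(ReD, ReN, ReM, ImM, Re_conj, Im_conj)/=; ring.
have nQ : normL2 (s%:C *: g - w) ^+ 2 =
    s ^+ 2 * normL2 g ^+ 2 + normL2 w ^+ 2 - 2 * s * complex.Re (innerL2 g w).
  rewrite !normL2_sqr !(innerBl, innerBr, innerZl, innerZr) (innerC g w).
  by rewrite !(ReD, ReN, ReM, ImM, Re_conj, Im_conj)/=; ring.
have tP : complex.Re (innerL2 (s%:C *: B + C) (s%:C *: g + w)) =
    s ^+ 2 * complex.Re (innerL2 B g) + complex.Re (innerL2 C w) +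
    2 * s * normL2 w ^+ 2.
  have -> : 2 * s * normL2 w ^+ 2 = s * complex.Re (innerL2 B w) + s * complex.Re (innerL2 C g).
    by rewrite BC -ww; ring.
  rewrite !(innerDl, innerDr, innerZl, innerZr).
  by rewrite !(ReD, ReN, ReM, ImM)/=; ring.
have tQ : complex.Re (innerL2 (s%:C *: B - C) (s%:C *: g - w)) =
    s ^+ 2 * complex.Re (innerL2 B g) + complex.Re (innerL2 C w) -
    2 * s * normL2 w ^+ 2.
  have -> : 2 * s * normL2 w ^+ 2 = s * complex.Re (innerL2 B w) + s * complex.Re (innerL2 C g).
    by rewrite BC -ww; ring.
  rewrite !(innerBl, innerBr, innerZl, innerZr).
  by rewrite !(ReD, ReN, ReM, ImM)/=; ring.
rewrite nP nQ tP tQ => /ler_normlP[+ _] /ler_normlP[_ +].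
have gf : normL2 g <= normL2 f by exact: (spec_norm_le hE).
move=> h1 h2.
have : normL2 w ^+ 2 <= (s * normL2 g) ^+ 2.
  rewrite -(ler_pM2l s0) exprMn; nra.
rewrite ler_sqr ?nnegrE ?mulr_ge0 ?normL2_ge0 ?(ltW s0)// => /le_trans; apply.
by rewrite ler_pM2l.
Qed.

End spectral_bounds.

(** * Polar coordinates *)

Section density_measure.
Local Open Scope ereal_scope.
Context d (T : measurableType d) (R : realType).
Variables (mu : {measure set T -> \bar R}) (w : T -> R).
Hypotheses (w0 : forall x, (0 <= w x)%R) (mw : measurable_fun setT w).

Definition density_measure (A : set T) : \bar R := \int[mu]_(x in A) (w x)%:E.

Let density0 : density_measure set0 = 0.
Proof. exact: integral_set0. Qed.

Let density_ge0 A : 0 <= density_measure A.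
Proof. by apply: integral_ge0 => x _; rewrite lee_fin. Qed.

Let density_sigma_additive : semi_sigma_additive density_measure.
Proof.
move=> /= A mA tA mUA.
rewrite /density_measure ge0_integral_bigcup//=; last 2 first.
- by apply/measurable_EFinP; exact: measurable_funTS.
- by move=> x _; rewrite lee_fin.
apply: is_cvg_ereal_nneg_natsum_cond => n _ _.
by apply: integral_ge0 => /= x _; rewrite lee_fin.
Qed.

HB.instance Definition _ := isMeasure.Build _ _ _ density_measure
  density0 density_ge0 density_sigma_additive.

Definition density : {measure set T -> \bar R} := density_measure.

Import HBNNSimple.

Let density_nnsfun (h : {nnsfun T >-> R}) :
  \int[density_measure]_x (h x)%:E = \int[mu]_x ((h x)%:E * (w x)%:E).
Proof.
have mwE : measurable_fun setT (EFin \o w) by exact/measurable_EFinP.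
under [LHS]eq_integral do rewrite fimfunE -fsumEFin//.
rewrite [LHS]ge0_integral_fsum//; last 2 first.
  - by move=> r; exact/measurable_EFinP/measurableT_comp.
  - by move=> n x _; rewrite EFinM nnfun_muleindic_ge0.
under [RHS]eq_integral.
  move=> x xD; rewrite fimfunE -fsumEFin// ge0_mule_fsuml; last first.
    by move=> r; rewrite EFinM nnfun_muleindic_ge0.
  over.
rewrite [RHS]ge0_integral_fsum//; last 2 first.
  - move=> r; apply: emeasurable_funM => //.
    by apply/measurable_EFinP; do 2 apply/measurableT_comp => //.
  - move=> n x _; apply: mule_ge0; last by rewrite lee_fin.
    by rewrite EFinM nnfun_muleindic_ge0.
apply: eq_fsbigr => r _.
rewrite (integralZl_indic_nnsfun density_measure measurableT h r).
rewrite integral_indic// setIT.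
rewrite -[X in _ * X = _]/(\int[mu]_(x in h @^-1` [set r]) (w x)%:E).
have [r0|r0] := ltP r 0%R.
  rewrite preimage_nnfun0// integral_set0 mule0 integral0_eq// => x _.
  by rewrite indic0 mulr0 mul0e.
rewrite -ge0_integralZl//; last 2 first.
- exact: measurable_funTS.
- by move=> x _; rewrite lee_fin.
rewrite integral_mkcond; apply: eq_integral => x _.
rewrite patchE /= indicE; case: ifPn => _; first by rewrite mulr1.
by rewrite mulr0 mul0e.
Qed.

Lemma integral_density (f : T -> \bar R) : measurable_fun setT f ->
  (forall x, 0 <= f x) ->
  \int[density]_x f x = \int[mu]_x (f x * (w x)%:E).
Proof.
move=> mf f0; pose f_ := nnsfun_approx measurableT mf.
transitivity (limn (fun n => \int[density_measure]_x (f_ n x)%:E)).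
  rewrite -monotone_convergence//=.
  - apply: eq_integral => x _; apply/esym/cvg_lim => //=.
    by apply: cvg_nnsfun_approx => //; exact: f0.
  - by move=> n; exact/measurable_EFinP.
  - by move=> n x _; rewrite lee_fin.
  - by move=> x _ a b ab; rewrite lee_fin//; exact/lefP/nd_nnsfun_approx.
rewrite (_ : \int[mu]_x _ =
    limn (fun n => \int[mu]_x ((f_ n x)%:E * (w x)%:E))); last first.
  rewrite -monotone_convergence//=.
  - apply: eq_integral => x _; apply/esym/cvg_lim => //.
    by apply: cvgeZr => //; apply: cvg_nnsfun_approx => //; exact: f0.
  - move=> n; apply: emeasurable_funM; exact/measurable_EFinP.
  - by move=> n x _; rewrite mule_ge0// lee_fin.
  - move=> x _ a b ab; rewrite -!EFinM lee_fin ler_wpM2r//.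
    exact/lefP/nd_nnsfun_approx.
by congr (limn _); apply/funext => n /=; rewrite density_nnsfun.
Qed.

End density_measure.

Section scaling.
Variable R : realType.
Local Notation leb := (@lebesgue_measure R).
Local Notation mR := (measurableTypeR R).

Lemma measurable_scale (t : R) : measurable_fun setT ((fun x => t * x) : mR -> mR).
Proof. exact: measurable_funM. Qed.

Lemma lebesgue_scale (t : R) (A : set mR) : 0 < t -> measurable A ->
  (leb ((fun x => t * x)%R @^-1` A) = (t^-1)%:E * leb A)%E.
Proof.
move=> t0 mA; pose m := mscale (NngNum (ltW t0))
  (measure_function_pushforward__canonical__measure_function_Measure leb (measurable_scale t)).
suff : leb A = m A.
  move=> ->; rewrite /m /mscale/= muleA -EFinM mulVf ?gt_eqF// mul1e//.
apply: lebesgue_measure_unique => // X [[a b] /= _ <-].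
rewrite /m /mscale/= /pushforward.
rewrite (_ : _ @^-1` _ = `](t^-1 * a), (t^-1 * b)]%classic); last first.
  apply/seteqP; split => x /=; rewrite !in_itv/=.
    by rewrite ltr_pdivrMl// ler_pdivlMl.
  by rewrite ltr_pdivrMl// ler_pdivlMl.
rewrite !lebesgue_measure_itv/= !lte_fin ltr_pM2l ?invr_gt0//.
case: ifPn => _; last by rewrite mule0.
by rewrite -!EFinB -EFinM -mulrBr mulrA mulfV ?gt_eqF// mul1r.
Qed.

Local Notation leb2 := ((@lebesgue_measure R \x @lebesgue_measure R)%E).

Lemma measurable_scale2 (t : R) :
  measurable_fun setT ((fun x => (t * x.1, t * x.2)) : mR * mR -> mR * mR).
Proof.
by apply: measurable_fun_pair; apply: measurable_funM.
Qed.

Lemma leb2_scale (t : R) (A : set (mR * mR)) : 0 < t -> measurable A ->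
  (leb2 ((fun x => (t * x.1, t * x.2)%R) @^-1` A) = (t^-1 ^+ 2)%:E * leb2 A)%E.
Proof.
move=> t0 mA; have t20 : 0 < t ^+ 2 by rewrite exprn_gt0.
pose m := mscale (NngNum (ltW t20))
  (measure_function_pushforward__canonical__measure_function_Measure leb2 (measurable_scale2 t)).
suff -> : leb2 A = m A.
  by rewrite /m /mscale/= muleA -EFinM -exprMn mulVf ?gt_eqF// expr1n mul1e//.
apply: product_measure_unique => // X Y mX mY.
have ms X' : measurable X' -> measurable ((fun x : mR => t * x) @^-1` X').
  by move=> mX'; rewrite -[X in measurable X]setTI; exact: measurable_scale.
rewrite -[LHS]/((t ^+ 2)%:E * leb2 (((fun x : mR => t * x)%R @^-1` X) `*`
    ((fun x : mR => t * x)%R @^-1` Y)))%E.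
rewrite product_measure1E; [|exact: ms|exact: ms].
rewrite [X in (_ * (X * _))%E](lebesgue_scale t0 mX).
rewrite [X in (_ * (_ * X))%E](lebesgue_scale t0 mY).
rewrite [X in (_ * X)%E]muleACA [LHS]muleA -!EFinM.
by rewrite (_ : t ^+ 2 * (t^-1 * t^-1) = 1) ?mul1e//; field; rewrite gt_eqF.
Qed.

Lemma sigma_finite_leb2 : sigma_finite setT leb2.
Proof.
pose F (k : nat) : set mR := `]-(k%:R), k%:R]%classic.
have mF k : measurable (F k) by exact: measurable_itv.
exists (fun k => F k `*` F k).
  apply/seteqP; split => // -[x y] _.
  have [k /andP[xk yk]] : exists k : nat, (`|x| < k%:R) && (`|y| < k%:R).
    exists (Num.truncn (`|x| + `|y|)).+1.
    have := truncnS_gt (`|x| + `|y|) => H.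
    by rewrite !(le_lt_trans _ H)// (lerDl, lerDr).
  exists k => //; split; rewrite /F /= in_itv/=.
    by move: xk; rewrite ltr_norml => /andP[-> /ltW].
  by move: yk; rewrite ltr_norml => /andP[-> /ltW].
move=> k; split; first exact: measurableX.
have Foo : (leb (F k) < +oo)%E.
  by rewrite lebesgue_measure_itv/=; case: ifPn => _; rewrite ltry.
rewrite [ltLHS]product_measure1E//.
by rewrite lte_mul_pinfty// ge0_fin_numE.
Qed.

Definition leb_plane : set (mR * mR)%type -> \bar R := leb2.
HB.instance Definition _ := Measure.on leb_plane.
HB.instance Definition _ := @Measure_isSigmaFinite.Build _ _ _
  leb_plane sigma_finite_leb2.

Lemma measurable_scale3 (t : R) : measurable_fun setT (scale3 t : R3 R -> R3 R).
Proof.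
apply: measurable_fun_pair; [apply: measurable_fun_pair|]; apply: measurable_funM => //.
- exact: measurableT_comp measurable_fst measurable_fst.
- exact: measurableT_comp measurable_snd measurable_fst.
Qed.

Lemma leb3_scale (t : R) (A : set (R3 R)) : 0 < t -> measurable A ->
  (leb3 (scale3 t @^-1` A) = (t^-1 ^+ 3)%:E * leb3 A)%E.
Proof.
move=> t0 mA; have t20 : 0 < t ^+ 3 by rewrite exprn_gt0.
pose m := mscale (NngNum (ltW t20))
  (measure_function_pushforward__canonical__measure_function_Measure leb3 (measurable_scale3 t)).
suff -> : leb3 A = m A.
  by rewrite /m /mscale/= muleA -EFinM -exprMn mulVf ?gt_eqF// expr1n mul1e//.
apply: (@product_measure_unique _ _ _ _ R leb_plane leb m) => // X Y mX mY.
have ms X' : measurable X' -> measurable ((fun x : mR => t * x) @^-1` X').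
  by move=> mX'; rewrite -[X in measurable X]setTI; exact: measurable_scale.
have ms2 X' : measurable X' -> measurable ((fun x : mR * mR => (t * x.1, t * x.2)) @^-1` X').
  by move=> mX'; rewrite -[X in measurable X]setTI; exact: measurable_scale2.
rewrite -[LHS]/((t ^+ 3)%:E *
    (leb_plane \x leb) (((fun x : mR * mR => (t * x.1, t * x.2)%R) @^-1` X) `*`
    ((fun x : mR => t * x)%R @^-1` Y)))%E.
rewrite product_measure1E; [|exact: ms2|exact: ms].
rewrite [X in (_ * (X * _))%E](leb2_scale t0 mX).
rewrite [X in (_ * (_ * X))%E](lebesgue_scale t0 mY).
rewrite [X in (_ * X)%E]muleACA [LHS]muleA -!EFinM.
by rewrite (_ : t ^+ 3 * (t^-1 ^+ 2 * t^-1) = 1) ?mul1e//; field; rewrite gt_eqF.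
Qed.

End scaling.

Section polar.
Variable R : realType.
Local Notation leb := (@lebesgue_measure R).
Local Notation mR := (measurableTypeR R).
Local Notation mR3 := (R3 R).

Definition polar_weight (l : mR) : R := Num.sqrt l / 2.

Lemma polar_weight_ge0 l : 0 <= polar_weight l.
Proof. by rewrite /polar_weight divr_ge0// sqrtr_ge0. Qed.

Lemma measurable_sqrt : measurable_fun setT (Num.sqrt : mR -> mR).
Proof. by apply: continuous_measurable_fun; exact: sqrt_continuous. Qed.

Lemma measurable_polar_weight : measurable_fun setT polar_weight.
Proof. by apply: measurable_funM => //; exact: measurable_sqrt. Qed.

Definition polar_radius : set mR -> \bar R :=
  density leb polar_weight_ge0 measurable_polar_weight.
HB.instance Definition _ := Measure.on polar_radius.

Lemma polar_radius_ray (b : R) :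
  (polar_radius `]-oo, b]%classic = (3^-1 * Num.sqrt b ^+ 3)%:E)%E.
Proof.
rewrite -[LHS]/(\int[leb]_(l in `]-oo, b]) (polar_weight l)%:E)%E.
have w0 l : l <= 0 -> (polar_weight l)%:E = 0%E.
  by move=> l0; rewrite /polar_weight ler0_sqrtr// mul0r.
have [b0|b0] := leP b 0.
  rewrite ler0_sqrtr// expr0n mulr0 integral0_eq// => l; rewrite /= in_itv/= => lb.
  by rewrite w0// (le_trans lb).
have mw D : measurable_fun D (fun l : mR => (polar_weight l)%:E).
  by apply/measurable_EFinP; apply: measurable_funTS; exact: measurable_polar_weight.
rewrite (@itv_bndbnd_setU _ _ _ (BLeft 0))//; last by rewrite bnd_simp ltW.
rewrite ge0_integral_setU//=; last 2 first.
- by move=> l _; rewrite lee_fin polar_weight_ge0.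
- by apply/disj_setPS => l [/=]; rewrite !in_itv/= => l0 /andP[]; rewrite leNgt l0.
rewrite integral0_eq ?add0e; last first.
  by move=> l; rewrite /= in_itv/= => l0; rewrite w0// ltW.
pose F (l : R) := 3^-1 * l `^ (3 / 2).
have pc : continuous (fun l : R => Num.sqrt l / 2).
  by move=> l; apply: cvgM; [exact: sqrt_continuous|exact: cvg_cst].
have sq3 (l : R) : 0 < l -> l `^ (3 / 2) = Num.sqrt l ^+ 3.
  by move=> l0; rewrite -powR12_sqrt ?ltW// -powR_mulrn ?powR_ge0// -powRrM mulrC.
have sq3' (l : R) : 0 <= l -> l `^ (3 / 2) = Num.sqrt l ^+ 3.
  rewrite le_eqVlt => /predU1P[<-|/sq3//].
  by rewrite powR0 ?mulf_neq0 ?invr_eq0// sqrtr0 expr0n.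
have Fc (l : R) : 0 <= l -> F l = 3^-1 * Num.sqrt l ^+ 3.
  by move=> l0; rewrite /F sq3'.
have cS : continuous (fun l : R => 3^-1 * Num.sqrt l ^+ 3).
  move=> l; apply: cvgM; first exact: cvg_cst.
  by apply: (@continuous_comp _ _ _ Num.sqrt (fun x => x ^+ 3));
    [exact: sqrt_continuous|exact: exprn_continuous].
have -> : (\int[leb]_(x in `[0%R, b]) (polar_weight x)%:E = (F b)%:E - (F 0%R)%:E)%E.
  apply: continuous_FTC2 => //.
  - exact: continuous_subspaceT.
  - split.
    + move=> x; rewrite in_itv/= => /andP[x0 _].
      by apply: derivableM => //; have := is_derive1_powR (3 / 2) x0; case.
    + rewrite Fc//; have H0 := cvg_at_right_filter (cS 0).
      apply: cvg_trans; last exact: H0.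
      apply: near_eq_cvg; near=> x.
      have x0 : 0 < x by near: x; exact: nbhs_right_gt.
      by rewrite (Fc x)// ltW.
    + rewrite Fc; last exact: ltW.
      have Hb := cvg_at_left_filter (cS b).
      apply: cvg_trans; last exact: Hb.
      apply: near_eq_cvg; near=> x.
      have x0 : 0 < x by near: x; exact: nbhs_left_gt.
      by rewrite (Fc x)// ltW.
  - move=> x; rewrite in_itv/= => /andP[x0 _].
    have D := is_derive1_powR (3 / 2) x0.
    rewrite derive1E deriveM//.
    rewrite derive_cst scaler0 addr0 (@derive_val _ _ _ _ _ _ _ D).
    have -> : 3 / 2 - 1 = 2^-1 :> R by field.
    by rewrite powR12_sqrt ?ltW// /polar_weight /GRing.scale/=; field.
rewrite !Fc//; last exact: ltW.
by rewrite sqrtr0 expr0n mulr0 sube0.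
Unshelve. all: by end_near. Qed.

Lemma polar_radius_sigma_finite : sigma_finite setT polar_radius.
Proof.
exists (fun n : nat => `]-oo, n%:R]%classic : set mR).
  apply/seteqP; split => // x _; exists (Num.truncn `|x|).+1 => //=.
  by rewrite in_itv/= ltW// (le_lt_trans (ler_norm _))// truncnS_gt.
move=> n; split; first exact: measurable_itv.
by rewrite polar_radius_ray ltry.
Qed.

HB.instance Definition _ := @Measure_isSigmaFinite.Build _ _ _
  polar_radius polar_radius_sigma_finite.

Lemma dot3_ge0 (x : mR3) : 0 <= dot3 x x.
Proof. by rewrite /dot3 !addr_ge0// -expr2 sqr_ge0. Qed.

Lemma dot3_eq0 (x : mR3) : dot3 x x = 0 -> x = (0, 0, 0).
Proof.
case: x => -[a b] c; rewrite /dot3/= => /eqP.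
rewrite -!expr2 !paddr_eq0 ?addr_ge0 ?sqr_ge0// !sqrf_eq0.
by move=> /andP[/andP[/eqP-> /eqP->] /eqP->].
Qed.

Lemma dot3_scale t (x : mR3) : dot3 (scale3 t x) (scale3 t x) = t ^+ 2 * dot3 x x.
Proof. by rewrite /dot3 /scale3/=; ring. Qed.

Lemma scale3A s t (x : mR3) : scale3 s (scale3 t x) = scale3 (s * t) x.
Proof. by rewrite /scale3/= !mulrA. Qed.

Lemma powRN12 (a : R) : 0 < a -> a `^ (- 2^-1) = (Num.sqrt a)^-1.
Proof. by move=> a0; rewrite powRN powR12_sqrt// ltW. Qed.

Lemma radial3_scale t (x : mR3) : 0 < t -> radial3 (scale3 t x) = radial3 x.
Proof.
move=> t0; rewrite /radial3 dot3_scale scale3A.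
have [x0|x0] := eqVneq (dot3 x x) 0.
  by rewrite (dot3_eq0 x0) /scale3/= !mulr0.
have xp : 0 < dot3 x x by rewrite lt_neqAle eq_sym x0 dot3_ge0.
rewrite !powRN12 ?mulr_gt0 ?exprn_gt0//.
rewrite sqrtrM ?sqr_ge0// sqrtr_sqr gtr0_norm// invfM mulrAC mulVf ?gt_eqF//.
by rewrite mul1r.
Qed.

Lemma scale3_radial (x : mR3) : scale3 (Num.sqrt (dot3 x x)) (radial3 x) = x.
Proof.
rewrite /radial3 scale3A; have [x0|x0] := eqVneq (dot3 x x) 0.
  by rewrite (dot3_eq0 x0) /scale3/= !mulr0.
have xp : 0 < dot3 x x by rewrite lt_neqAle eq_sym x0 dot3_ge0.
rewrite powRN12// mulfV ?sqrtr_eq0 -?ltNge// /scale3 !mul1r.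
by case: x {x0 xp} => -[].
Qed.

Definition polar (x : mR3) : mR * mR3 := (dot3 x x, radial3 x).

Lemma measurable_polar : measurable_fun setT polar.
Proof. by apply: measurable_fun_pair; [exact: measurable_dot3|exact: measurable_radial3]. Qed.

Lemma leb3_ball_fin : (leb3 (@ball3 R) < +oo)%E.
Proof.
have mI : measurable (`[-1, 1]%classic : set mR) by exact: measurable_itv.
pose I : set mR := `[-1, 1]%classic.
pose Q : set mR3 := (I `*` I) `*` I.
have mQ : measurable Q by apply: measurableX => //; exact: measurableX.
apply: (@le_lt_trans _ _ (leb3 Q)).
  apply: le_measure; rewrite ?inE//; first exact: measurable_ball3.
  have sq (a : R) : a * a <= 1 -> a \in `[-1, 1].
    by rewrite in_itv/= => a1; apply/andP; split; nra.
  move=> -[[a b] c]; rewrite /ball3/= /dot3/= => H.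
  split => /=; [split => /=|]; apply: sq; nra.
have -> : leb3 Q = (leb I * leb I * leb I)%E.
  rewrite [LHS]product_measure1E//; last exact: measurableX.
  by congr (_ * _)%E; rewrite [LHS]product_measure1E.
by rewrite !lebesgue_measure_itv/= lte_fin; case: ifPn => _; rewrite -?EFinB -?EFinM ?mule0 ltry.
Qed.

Lemma polar_ray (b : R) (B : set mR3) : measurable B ->
  (leb3 (polar @^-1` (`]-oo, b]%classic `*` B)) =
   (Num.sqrt b ^+ 3)%:E * leb3 (@radial3 R @^-1` B `&` @ball3 R))%E.
Proof.
move=> mB.
have mRB : measurable (@radial3 R @^-1` B : set mR3).
  by rewrite -[X in measurable X]setTI; exact: measurable_radial3.
have [b0|b0] := leP b 0.
  rewrite ler0_sqrtr// expr0n mul0e.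
  have m1 : measurable ([set 0] : set mR) by exact: measurable_set1.
  have m0 : measurable ([set 0] `*` [set 0] : set (mR * mR)%type).
    exact: measurableX.
  have z0 : leb3 (([set 0] `*` [set 0]) `*` [set 0] : set mR3) = 0%E.
    rewrite [LHS]product_measure1E//.
    by rewrite [X in (_ * X)%E]lebesgue_measure_set1 mule0.
  apply/eqP; rewrite eq_le measure_ge0 andbT -z0; apply: le_measure; rewrite ?inE.
  - rewrite -[X in measurable X]setTI; apply: measurable_polar => //.
    by apply: measurableX => //; exact: measurable_itv.
  - exact: measurableX.
  - move=> x [/= xb _]; have x0 : dot3 x x = 0.
      by apply/eqP; rewrite eq_le dot3_ge0 andbT (le_trans _ b0)//; move: xb; rewrite in_itv.
    by rewrite (dot3_eq0 x0).
have s0 : 0 < (Num.sqrt b)^-1 by rewrite invr_gt0 sqrtr_gt0.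
rewrite (_ : polar @^-1` _ =
    scale3 (Num.sqrt b)^-1 @^-1` (@radial3 R @^-1` B `&` @ball3 R)); last first.
  apply/seteqP; split => x; rewrite /polar /ball3 /= dot3_scale radial3_scale// in_itv/=;
    by rewrite exprVn sqr_sqrtr ?(ltW b0)// ler_pdivrMl// mulr1 => -[].
rewrite leb3_scale//; last by apply: measurableI => //; exact: measurable_ball3.
by rewrite invrK.
Qed.

Definition unit_sphere : set mR3 -> \bar R := @sphere R.
HB.instance Definition _ := Measure.on unit_sphere.

Lemma sphereE (B : set mR3) :
  (unit_sphere B = 3%:E * leb3 (@radial3 R @^-1` B `&` @ball3 R))%E.
Proof. by []. Qed.

Lemma unit_sphere_fin : fin_num_fun unit_sphere.
Proof.
move=> B mB; rewrite sphereE ge0_fin_numE; last by rewrite mule_ge0// lee_fin.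
rewrite lte_mul_pinfty// ?lee_fin//.
have mRB : measurable (@radial3 R @^-1` B : set mR3).
  by rewrite -[X in measurable X]setTI; exact: measurable_radial3.
apply: le_lt_trans leb3_ball_fin; apply: le_measure; rewrite ?inE//.
- by apply: measurableI => //; exact: measurable_ball3.
- exact: measurable_ball3.
Qed.

HB.instance Definition _ := @Measure_isFinite.Build _ _ _
  unit_sphere unit_sphere_fin.

End polar.

Global Instance ae_lebesgue_filter (R : realType) :
  Filter (nbhs (almost_everywhere (@lebesgue_measure R))).
Proof. exact: (@ae_filter_ringOfSetsType _ (measurableTypeR R) R lebesgue_measure). Qed.

Section polar_integral.
Variable R : realType.
Local Notation leb := (@lebesgue_measure R).
Local Notation mR := (measurableTypeR R).
Local Notation mR3 := (R3 R).

(** Rays generate the Borel sets and are stable under intersection. *)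
Lemma measure_ray_unique (m1 m2 : {measure set mR -> \bar R}) :
  (forall b : R, m1 `]-oo, b]%classic = m2 `]-oo, b]%classic) ->
  (forall b : R, (m1 `]-oo, b]%classic < +oo)%E) ->
  forall A, measurable A -> m1 A = m2 A.
Proof.
move=> m12 m1oo A mA.
pose G : set (set mR) := [set A | exists b : R, A = `]-oo, b]%classic].
apply: (measure_unique G (fun n : nat => `]-oo, n%:R]%classic)) => //.
- rewrite eqEsubset; split => [|]; last first.
    apply: smallest_sub; first exact: sigma_algebra_measurable.
    by move=> _ [b ->]; exact: measurable_itv.
  apply: smallest_sub; first exact: smallest_sigma_algebra.
  move=> _ [[a b] /= _ <-].
  rewrite (_ : `]a, b]%classic = `]-oo, b]%classic `\` `]-oo, a]%classic); last first.
    apply/seteqP; split => x; rewrite /= !in_itv/=.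
      by move=> /andP[ax xb]; split => //; apply/negP; rewrite -ltNge.
    by move=> [xb /negP]; rewrite -ltNge => ->.
  have gb c : <<s G >> `]-oo, c]%classic by apply: sub_sigma_algebra; exists c.
  by apply: (@measurableD _ (g_sigma_algebraType G)); exact: gb.
- move=> _ _ [b ->] [c ->]; exists (Num.min b c).
  apply/seteqP; split => x; rewrite /= !in_itv/= le_min.
    by move=> [-> ->].
  by move=> /andP[-> ->].
- by move=> n; exists n%:R.
- apply/seteqP; split => // x _; exists (Num.truncn `|x|).+1 => //=.
  by rewrite in_itv/= ltW// (le_lt_trans (ler_norm _))// truncnS_gt.
- by move=> _ [b ->].
Qed.

Local Notation rho := (@polar_radius R).
Local Notation sph := (@unit_sphere R).

Let nu : {measure set (mR * mR3)%type -> \bar R} :=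
  measure_function_pushforward__canonical__measure_function_Measure leb3
    (@measurable_polar R).

Lemma measurable_radial_preimage (B : set mR3) : measurable B ->
  measurable (@radial3 R @^-1` B).
Proof.
by move=> mB; rewrite -[X in measurable X]setTI; exact: measurable_radial3.
Qed.

Lemma polar_rect (A : set mR) (B : set mR3) : measurable A -> measurable B ->
  nu (A `*` B) = (rho A * sph B)%E.
Proof.
move=> mA mB; have mRB := measurable_radial_preimage mB.
have sB0 : 0 <= fine (sph B) by apply: fine_ge0; exact: measure_ge0.
have sBE : sph B = (fine (sph B))%:E.
  by rewrite fineK//; exact: unit_sphere_fin.
pose m2 : {measure set mR -> \bar R} := mscale (NngNum sB0) rho.
have mdot : measurable_fun setT ((fun x => dot3 x x) : mR3 -> mR) by exact: measurable_dot3.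
pose m1 : {measure set mR -> \bar R} :=
  measure_function_pushforward__canonical__measure_function_Measure
  (mrestr leb3 mRB) mdot.
have m1E X : measurable X -> m1 X = nu (X `*` B).
  by move=> mX.
rewrite -m1E//.
transitivity (m2 A).
  apply: (@measure_ray_unique m1 m2) => // b.
    rewrite m1E; last exact: measurable_itv.
    rewrite -[LHS]/(leb3 (@polar R @^-1` (`]-oo, b]%classic `*` B))) polar_ray//.
    rewrite -[RHS]/(((fine (sph B))%:E * rho `]-oo, b]%classic)%E) polar_radius_ray.
    rewrite -sBE sphereE muleAC -EFinM mulrA mulfV ?mul1r//.
  rewrite m1E; last exact: measurable_itv.
  rewrite -[ltLHS]/(leb3 (@polar R @^-1` (`]-oo, b]%classic `*` B))) polar_ray//.
  rewrite lte_mul_pinfty// ?lee_fin ?exprn_ge0 ?sqrtr_ge0//.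
  apply: le_lt_trans (leb3_ball_fin R); apply: le_measure; rewrite ?inE//.
  - by apply: measurableI => //; exact: measurable_ball3.
  - exact: measurable_ball3.
by rewrite -[m2 A]/(((fine (sph B))%:E * rho A)%E) -sBE muleC.
Qed.

Lemma measurable_polar_map :
  measurable_fun setT (fun z : mR * mR3 => scale3 (Num.sqrt z.1) z.2).
Proof.
have ms : measurable_fun setT (fun z : mR * mR3 => Num.sqrt z.1 : mR).
  by apply: (measurableT_comp (@measurable_sqrt R)).
have m2 : measurable_fun setT (fun z : mR * mR3 => z.2 : mR3) by exact: measurable_snd.
have m21 : measurable_fun setT (fun z : mR * mR3 => z.2.1) by exact: measurableT_comp measurable_fst m2.
apply: measurable_fun_pair; [apply: measurable_fun_pair|]; apply: measurable_funM => //.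
- exact: measurableT_comp measurable_fst m21.
- exact: measurableT_comp measurable_snd m21.
- exact: measurableT_comp measurable_snd m2.
Qed.

Lemma measurable_polar_comp (F : mR3 -> \bar R) : measurable_fun setT F ->
  measurable_fun setT (fun z : mR * mR3 => F (scale3 (Num.sqrt z.1) z.2)).
Proof. by move=> mF; exact: measurableT_comp mF measurable_polar_map. Qed.

(** Integration in polar coordinates, in the variable $|x|^2$. *)
Lemma polar_integral (F : mR3 -> \bar R) : measurable_fun setT F ->
  (forall x, 0 <= F x)%E ->
  (\int[leb3]_x F x = \int[leb]_l
    ((\int[sphere]_om F (scale3 (Num.sqrt l) om)) * (polar_weight l)%:E))%E.
Proof.
move=> mF F0; pose G (z : mR * mR3) := F (scale3 (Num.sqrt z.1) z.2).
have mG : measurable_fun setT G by exact: measurable_polar_comp.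
transitivity (\int[nu]_z G z)%E.
  rewrite -[RHS]/(integral (pushforward leb3 (@polar R)) _ _).
  rewrite (ge0_integral_pushforward (@measurable_polar R))//; last by move=> z _; exact: F0.
  rewrite preimage_setT; apply: eq_integral => x _.
  by rewrite /G /= scale3_radial.
transitivity (\int[rho \x sph]_z G z)%E.
  apply: eq_measure_integral => A mA _; apply/esym.
  exact: (@product_measure_unique _ _ _ _ R rho sph nu polar_rect).
rewrite fubini_tonelli1//; last by move=> z; exact: F0.
rewrite -[LHS]/(\int[density leb (@polar_weight_ge0 R) (@measurable_polar_weight R)]_l
   fubini_F sph G l)%E.
rewrite integral_density//.
- by apply: measurable_fun_fubini_tonelli_F => // z; exact: F0.
- by move=> l; apply: integral_ge0 => om _; exact: F0.
Qed.

Lemma polar_measurable_fiber (F : mR3 -> \bar R) : measurable_fun setT F ->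
  (forall x, 0 <= F x)%E ->
  measurable_fun setT (fun l : mR => \int[sphere]_om F (scale3 (Num.sqrt l) om))%E.
Proof.
move=> mF F0; pose G (z : mR * mR3) := F (scale3 (Num.sqrt z.1) z.2).
have mG : measurable_fun setT G by exact: measurable_polar_comp.
have := @measurable_fun_fubini_tonelli_F _ _ _ _ _ sph G mG.
by apply => z; exact: F0.
Qed.

Lemma measurable_scale3_fun (t : R) (F : mR3 -> \bar R) : measurable_fun setT F ->
  measurable_fun setT (fun om : mR3 => F (scale3 t om)).
Proof. by move=> mF; apply: measurableT_comp mF (measurable_scale3 t). Qed.

Lemma polar_null (N : set mR3) : measurable N ->
  (leb3 N = 0%E <-> \forall l \ae leb, 0 <= l ->
     sphere [set om | N (scale3 (Num.sqrt l) om)] = 0%E).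
Proof.
move=> mN.
pose F (x : mR3) : \bar R := (\1_N x)%:E.
have mF : measurable_fun setT F by apply/measurable_EFinP.
have F0 x : (0 <= F x)%E by rewrite lee_fin.
have mS l : measurable ([set om | N (scale3 (Num.sqrt l) om)] : set mR3).
  by rewrite -[X in measurable X]setTI; apply: measurable_scale3.
have FS l : (\int[sphere]_om F (scale3 (Num.sqrt l) om) =
    sphere [set om | N (scale3 (Num.sqrt l) om)])%E.
  rewrite -[RHS](_ : \int[sphere]_om (\1_[set om | N (scale3 (Num.sqrt l) om)] om)%:E = _)%E.
    by apply: eq_integral => om _.
  by rewrite integral_indic// setIT.
have lebN : leb3 N = (\int[leb]_l
    (sphere [set om | N (scale3 (Num.sqrt l) om)] * (polar_weight l)%:E))%E.
  rewrite -[leb3 N](_ : \int[leb3]_x F x = _)%E; last by rewrite integral_indic// setIT.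
  by rewrite polar_integral//; apply: eq_integral => l _; rewrite FS.
have mI : measurable_fun setT (fun l : mR =>
    sphere [set om | N (scale3 (Num.sqrt l) om)] * (polar_weight l)%:E)%E.
  apply: emeasurable_funM; last by apply/measurable_EFinP; exact: measurable_polar_weight.
  have := polar_measurable_fiber mF F0.
  by under eq_fun do rewrite FS.
have absE : (\int[leb]_l `|sphere [set om | N (scale3 (Num.sqrt l) om)] * (polar_weight l)%:E|
    = leb3 N)%E.
  rewrite lebN; apply: eq_integral => l _; rewrite gee0_abs//.
  by rewrite mule_ge0// lee_fin polar_weight_ge0.
have ne0 : \forall l \ae leb, l != 0.
  exists [set 0]; split; [exact: measurable_set1|exact: lebesgue_measure_set1|].
  by move=> l /= /negP; rewrite negbK => /eqP.
have := @ae_eq_integral_abs _ _ _ leb setT measurableT _ mI; rewrite absE => -[H1 H2].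
split => [/H1|]; last first.
  move=> H; apply: H2; apply: filterS2 H ne0 => l /= Hl l0 _.
  have [lp|ln] := leP 0 l; first by rewrite Hl// mul0e.
  by rewrite /polar_weight ler0_sqrtr ?(ltW ln)// mul0r mule0.
move=> H; apply: filterS2 H ne0 => l /(_ Logic.I)/= Hl l0 lp.
move: Hl => /eqP; rewrite mule_eq0 => /orP[/eqP//|].
rewrite eqe /polar_weight mulf_eq0 invr_eq0 pnatr_eq0 orbF sqrtr_eq0.
by rewrite leNgt lt_neqAle eq_sym l0 lp.
Qed.

(** A statement holding almost everywhere in space holds, on almost every
    sphere, almost everywhere. *)
Lemma ae_polar (P : mR3 -> Prop) : (\forall x \ae leb3, P x) ->
  \forall l \ae leb, 0 <= l -> \forall om \ae sphere, P (scale3 (Num.sqrt l) om).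
Proof.
move=> [N [mN N0 PN]]; have /(polar_null mN) H := N0.
apply: filterS H => l Hl l0.
exists [set om | N (scale3 (Num.sqrt l) om)]; split.
- by rewrite -[X in measurable X]setTI; apply: measurable_scale3.
- exact: Hl.
- by move=> om /= nP; apply: PN.
Qed.

Lemma polar_ae (N : set mR3) : measurable N ->
  (\forall l \ae leb, 0 <= l -> \forall om \ae sphere, ~ N (scale3 (Num.sqrt l) om)) ->
  \forall x \ae leb3, ~ N x.
Proof.
move=> mN H; exists N; split => //; last by move=> x /= /contrapT.
apply/polar_null => //; apply: filterS H => l Hl /Hl.
move=> [M [mM M0 NM]].
apply/eqP; rewrite eq_le measure_ge0 andbT -M0; apply: le_measure; rewrite ?inE//.
  by rewrite -[X in measurable X]setTI; apply: measurable_scale3.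
by move=> om /= Nom; apply: NM => /=; apply.
Qed.

End polar_integral.

(** * The spectral representation of $-\Delta$ *)

Lemma ae_imply2 d (T : measurableType d) (R : realType)
    (mu : {measure set T -> \bar R}) (P Q W : T -> Prop) :
  (forall x, P x -> Q x -> W x) -> (\forall x \ae mu, P x) ->
  (\forall x \ae mu, Q x) -> \forall x \ae mu, W x.
Proof. by move=> PQW; exact: filterS2. Qed.

Lemma ae_imply3 d (T : measurableType d) (R : realType)
    (mu : {measure set T -> \bar R}) (P Q S W : T -> Prop) :
  (forall x, P x -> Q x -> S x -> W x) -> (\forall x \ae mu, P x) ->
  (\forall x \ae mu, Q x) -> (\forall x \ae mu, S x) -> \forall x \ae mu, W x.
Proof. by move=> PQSW; exact: filterS3. Qed.

Lemma ae_and d (T : measurableType d) (R : realType)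
    (mu : {measure set T -> \bar R}) (P Q : T -> Prop) :
  (\forall x \ae mu, P x) -> (\forall x \ae mu, Q x) ->
  \forall x \ae mu, P x /\ Q x.
Proof. exact: filterI. Qed.

Section fibers.
Variable R : realType.
Local Notation leb := (@lebesgue_measure R).
Local Notation mR := (measurableTypeR R).
Local Notation hl := (`[0%R, +oo[%classic : set mR).
Variable Fr : L2R3 R -> L2R3 R.
Hypothesis hFr : is_fourier Fr.
Implicit Types (f g h : L2R3 R) (c e : R -> L2S2 R) (m : R -> R).

Lemma fourier_lin a f g : Fr (a *: f + g) = a *: Fr f + Fr g.
Proof. by case: hFr => /(_ a f g) ->. Qed.

Lemma fourierD f g : Fr (f + g) = Fr f + Fr g.
Proof. by have := fourier_lin 1 f g; rewrite !scale1r. Qed.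

Lemma fourier0 : Fr 0 = 0.
Proof.
have := fourierD 0 0; rewrite addr0 => /eqP.
by rewrite -[X in X == _]addr0 (inj_eq (addrI _)) => /eqP.
Qed.

Lemma fourierZ a f : Fr (a *: f) = a *: Fr f.
Proof. by have := fourier_lin a f 0; rewrite !addr0 fourier0 addr0. Qed.

Lemma fourier_inner f g : innerL2 (Fr f) (Fr g) = innerL2 f g.
Proof. by case: hFr. Qed.

Lemma fourier_surj g : exists f, Fr f = g.
Proof. by case: hFr. Qed.

Lemma sphere_unit : \forall om \ae (@sphere R), dot3 om om = 1.
Proof.
have mN : measurable [set om : R3 R | dot3 om om != 1].
  rewrite (_ : [set _ | _] = ~` ((fun om : R3 R => dot3 om om) @^-1` [set 1])); last first.
    by apply/seteqP; split=> x /=; [move/eqP|move=> ?; apply/eqP].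
  apply: measurableC; rewrite -[X in measurable X]setTI.
  by apply: measurable_dot3 => //; exact: measurable_set1.
exists [set om | dot3 om om != 1]; split => //; last by move=> om /= /eqP.
rewrite -[LHS]/(3%:E * leb3 (@radial3 R @^-1` [set om | dot3 om om != 1]%R `&` @ball3 R))%E.
rewrite (_ : _ `&` _ = @polar R @^-1` (`]-oo, 0]%classic `*` (@radial3 R @^-1` [set om | dot3 om om != 1]))).
  rewrite polar_ray; last exact: measurable_radial_preimage.
  by rewrite sqrtr0 expr0n mul0e mule0.
have rad0 (x : R3 R) : dot3 x x = 0 -> radial3 x = x.
  by move=> x0; rewrite (dot3_eq0 x0) /radial3 /scale3/= !mulr0.
apply/seteqP; split => x; rewrite /polar/= in_itv/=.
  move=> [rx _]; have [x0|x0] := eqVneq (dot3 x x) 0; first by rewrite (rad0 _ x0) (rad0 _ x0) x0 eq_sym oner_neq0.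
  have xp : 0 < dot3 x x by rewrite lt_neqAle eq_sym x0 dot3_ge0.
  move: rx; rewrite /radial3 dot3_scale powRN12// exprVn sqr_sqrtr ?(ltW xp)// mulVf//.
  by rewrite eqxx.
move=> [x0 _]; have {}x0 : dot3 x x = 0 by apply/eqP; rewrite eq_le x0 dot3_ge0.
by rewrite /ball3/= (rad0 _ x0) x0 eq_sym oner_neq0 ler01.
Qed.

Definition sqnormc (z : R[i]) : R := complex.Re z ^+ 2 + complex.Im z ^+ 2.

Lemma normL2_sqr_integral d (T : measurableType d) (mu : {measure set T -> \bar R})
    (f : L2 mu) :
  ((normL2 f ^+ 2)%:E = \int[mu]_x (sqnormc (f x))%:E)%E.
Proof.
have [ir _] := L2_integrableM f f.
have e x : complex.Re (f x * conjc (f x)) = sqnormc (f x).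
  by rewrite ReM Re_conj Im_conj mulrN opprK.
rewrite normL2_sqr -[complex.Re _]/(fine _) fineK; last exact: integrable_fin_num.
by apply: eq_integral => x _; rewrite e.
Qed.

Lemma measurable_sqnormc (f : L2R3 R) :
  measurable_fun setT (fun x => (sqnormc (f x))%:E).
Proof.
apply/measurable_EFinP; apply: measurable_funD; apply: measurable_funX.
  exact: measurable_L2_Re.
exact: measurable_L2_Im.
Qed.

Lemma spec_fiber_sqnorm f l om : 0 <= l ->
  sqnormc (spec_fiber Fr f l om) =
  polar_weight l * sqnormc (Fr f (scale3 (Num.sqrt l) om)).
Proof.
move=> l0; rewrite /spec_fiber; set z := Fr f _.
rewrite /sqnormc ReM ImM /= !mul0r subr0 addr0 !exprMn -mulrDr; congr (_ * _).
rewrite -!powR_mulrn ?powR_ge0// -!powRrM /polar_weight -powR12_sqrt// mulrC.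
congr (l `^ _ * _); first by field.
by rewrite (_ : - 2^-1 * 2%:R = - 1) ?powRN ?powRr1//; field.
Qed.

Lemma represents_norm f c : represents Fr f c ->
  measurable_fun hl ((fun l => normL2 (c l) ^+ 2) : mR -> R) ->
  ((normL2 f ^+ 2)%:E = \int[leb]_(l in hl) (normL2 (c l) ^+ 2)%:E)%E.
Proof.
move=> fc mc.
have -> : normL2 f = normL2 (Fr f) by rewrite /normL2 fourier_inner.
rewrite normL2_sqr_integral polar_integral; [|exact: measurable_sqnormc|]; last first.
  by move=> x; rewrite lee_fin addr_ge0// sqr_ge0.
have mF := @measurable_sqnormc (Fr f).
have F0 x : (0 <= (sqnormc (Fr f x))%:E)%E by rewrite lee_fin addr_ge0// sqr_ge0.
have m1 : measurable_fun setT (fun l : mR =>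
  (\int[sphere]_om (sqnormc (Fr f (scale3 (Num.sqrt l) om)))%:E * (polar_weight l)%:E)%E).
  apply: emeasurable_funM; last by apply/measurable_EFinP; exact: measurable_polar_weight.
  exact: (polar_measurable_fiber mF F0).
rewrite -(setUv hl) ge0_integral_setU//=; last 4 first.
- exact: measurableC.
- by rewrite setUv.
- by move=> l _; rewrite mule_ge0 ?integral_ge0// lee_fin polar_weight_ge0.
- exact/disj_setPCl.
rewrite [X in (_ + X)%E]integral0_eq ?adde0; last first.
  move=> l /=; rewrite in_itv/= andbT => /negP; rewrite -ltNge => l0.
  by rewrite /polar_weight ler0_sqrtr ?(ltW l0)// mul0r mule0.
apply: ge0_ae_eq_integral => //.
- exact: measurable_funTS.
- exact/measurable_EFinP.
- by move=> l _; rewrite mule_ge0 ?integral_ge0// lee_fin polar_weight_ge0.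
- by move=> l _; rewrite lee_fin sqr_ge0.
apply: filterS fc => l Hl; rewrite /= in_itv/= andbT => l0.
rewrite normL2_sqr_integral muleC -ge0_integralZl//; last 2 first.
- exact: (measurable_scale3_fun (Num.sqrt l) mF).
- by rewrite lee_fin polar_weight_ge0.
apply: ge0_ae_eq_integral => //.
- apply/measurable_EFinP; apply: measurable_funM => //.
  by apply/measurable_EFinP; exact: (measurable_scale3_fun (Num.sqrt l) mF).
- by apply/measurable_EFinP; apply: measurable_funD; apply: measurable_funX;
    [exact: measurable_L2_Re|exact: measurable_L2_Im].
- by move=> om _; rewrite -EFinM lee_fin mulr_ge0 ?polar_weight_ge0// addr_ge0// sqr_ge0.
- by move=> om _; rewrite lee_fin addr_ge0// sqr_ge0.
by apply: filterS (Hl l0) => om -> _; rewrite spec_fiber_sqnorm.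
Qed.

(** $g = m(H_0) f$ for a real function $m$. *)
Definition is_mul m f g :=
  \forall xi \ae leb3, Fr g xi = (m (dot3 xi xi))%:C * Fr f xi.

Lemma represents_mul m f g c : represents Fr f c -> is_mul m f g ->
  represents Fr g (fun l => (m l)%:C *: c l).
Proof.
move=> fc /ae_polar; apply: ae_imply2 fc => l Hf Hg l0.
apply: ae_imply3 (L2_scaleE (m l)%:C (c l)) (Hf l0) (ae_and (Hg l0) sphere_unit).
move=> om -> -> [Hgo o1]; rewrite /spec_fiber Hgo dot3_scale o1 mulr1 sqr_sqrtr//.
by rewrite mulrCA.
Qed.

Lemma represents_lin a f g c e : represents Fr f c -> represents Fr g e ->
  represents Fr (a *: f + g) (fun l => a *: c l + e l).
Proof.
move=> fc ge; have := L2_addE (a *: Fr f) (Fr g); have := L2_scaleE a (Fr f).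
move=> /ae_polar H1 /ae_polar H2.
apply: ae_imply3 (ae_and fc ge) H1 H2 => l [Hf Hg] {}H1 {}H2 l0.
have K1 := ae_and (Hf l0) (Hg l0).
have K2 := ae_and (H1 l0) (H2 l0).
have K3 := ae_and (L2_addE (a *: c l) (e l)) (L2_scaleE a (c l)).
apply: ae_imply3 K1 K2 K3 => om [h1 h2] [h3 h4] [h5 h6].
by rewrite h5 h6 h1 h2 /spec_fiber fourier_lin h4 h3 mulrDr mulrCA.
Qed.

Lemma represents_scale a f c : represents Fr f c ->
  represents Fr (a *: f) (fun l => a *: c l).
Proof.
move=> fc; have := L2_scaleE a (Fr f) => /ae_polar.
apply: filterS2 fc => l Hf H l0.
apply: ae_imply3 (Hf l0) (H l0) (L2_scaleE a (c l)) => om h1 h2 h3.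
by rewrite h3 h1 /spec_fiber fourierZ h2 mulrCA.
Qed.

Lemma measurable_neqC (F G : R3 R -> R[i]) :
  measurable_fun setT (fun x => complex.Re (F x)) ->
  measurable_fun setT (fun x => complex.Im (F x)) ->
  measurable_fun setT (fun x => complex.Re (G x)) ->
  measurable_fun setT (fun x => complex.Im (G x)) ->
  measurable [set x : R3 R | F x <> G x].
Proof.
move=> rF iF rG iG.
pose D (x : R3 R) : mR := sqnormc (F x - G x).
have mD : measurable_fun setT D.
  apply: measurable_funD; apply: measurable_funX.
    by under eq_fun do rewrite ReD ReN; exact: measurable_funB.
  by under eq_fun do rewrite ImD ImN; exact: measurable_funB.
rewrite (_ : [set _ | _] = ~` (D @^-1` [set 0])); last first.
  apply/seteqP; split=> x /=; [apply: contra_not => D0|apply: contra_not => FG]; last first.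
    by rewrite /D FG subrr /sqnormc/= expr0n addr0.
  move: D0; rewrite /D /sqnormc => /eqP; rewrite paddr_eq0 ?sqr_ge0// !sqrf_eq0.
  move=> /andP[/eqP a /eqP b]; apply/eqP; rewrite -subr_eq0; apply/eqP.
  exact: complex_ReIm.
apply: measurableC; rewrite -[X in measurable X]setTI.
by apply: mD => //; exact: measurable_set1.
Qed.

(** The converse of [represents_mul]: the weight in the fibres vanishes only
    at the origin, so a relation between fibres is one between transforms. *)
Lemma represents_is_mul m f g c : measurable_fun setT (m : mR -> mR) ->
  represents Fr f c -> represents Fr g (fun l => (m l)%:C *: c l) ->
  is_mul m f g.
Proof.
move=> mm fc gc.
pose G (x : R3 R) := (m (dot3 x x))%:C * Fr f x.
have md : measurable_fun setT (fun x : R3 R => m (dot3 x x) : mR).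
  by apply: (measurableT_comp mm); exact: measurable_dot3.
have mN : measurable [set x : R3 R | Fr g x <> G x].
  apply: measurable_neqC.
  - exact: measurable_L2_Re.
  - exact: measurable_L2_Im.
  - under eq_fun do rewrite ReM /= mul0r subr0.
    by apply: measurable_funM => //; exact: measurable_L2_Re.
  - under eq_fun do rewrite ImM /= mul0r addr0.
    by apply: measurable_funM => //; exact: measurable_L2_Im.
suff : \forall x \ae leb3, ~ [set x : R3 R | Fr g x <> G x] x.
  by apply: filterS => x /= /contrapT.
apply: polar_ae => //.
have ne0 : \forall l \ae leb, l != 0.
  exists [set 0]; split; [exact: measurable_set1|exact: lebesgue_measure_set1|].
  by move=> l /= /negP; rewrite negbK => /eqP.
apply: ae_imply3 fc gc ne0 => l Hf Hg l0 l0'.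
apply: ae_imply3 (L2_scaleE (m l)%:C (c l)) (ae_and (Hg l0') (Hf l0')) sphere_unit.
move=> om h1 [h2 h3] o1 /=; apply.
move: h2; rewrite h1 h3 /spec_fiber /G dot3_scale o1 mulr1 sqr_sqrtr//.
rewrite mulrCA => /mulfI <- //.
have lp : 0 < l by rewrite lt_neqAle eq_sym l0.
by apply/eqP => -[/eqP]; rewrite mulf_eq0 !gt_eqF// powR_gt0.
Qed.

End fibers.

Section multipliers.
Variable R : realType.
Local Notation leb := (@lebesgue_measure R).
Local Notation mR := (measurableTypeR R).
Local Notation hl := (`[0%R, +oo[%classic : set mR).
Variable Fr : L2R3 R -> L2R3 R.
Hypothesis hFr : is_fourier Fr.
Implicit Types (f g h : L2R3 R) (c e : R -> L2S2 R) (m : R -> R).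

Lemma Lfun2_dominated d (T : measurableType d) (mu : {measure set T -> \bar R})
    (h k : T -> R) (b : R) : measurable_fun setT h -> k \in Lfun mu 2%:E ->
  (forall x, `|h x| <= b * `|k x|) -> h \in Lfun mu 2%:E.
Proof.
move=> mh k2 hk; rewrite inE; apply/andP; split; rewrite inE//=.
rewrite /finite_norm unlock poweR_lty//.
have ik := Lfun2_integrable_sqr k2.
have mk : measurable_fun setT k by move: k2 => /sub_Lfun_mfun; rewrite inE.
apply: (@le_lt_trans _ _ (\int[mu]_x ((b ^+ 2)%:E * (k x ^+ 2)%:E))%E).
  apply: ge0_le_integral => //.
  - by move=> x _; rewrite lee_fin powR_ge0.
  - apply/measurable_EFinP.
    by apply: (measurableT_comp (measurable_powR _)); exact: measurableT_comp.
  - by apply/measurable_EFinP; apply: measurable_funM => //; exact: measurable_funX.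
  - move=> x _; rewrite -EFinM lee_fin powR_mulrn//.
    rewrite -[k x ^+ 2]real_normK ?num_real// -exprMn ler_sqr ?nnegrE//.
    exact: le_trans (hk x).
rewrite ge0_integralZl//; last 3 first.
- by apply/measurable_EFinP; exact: measurable_funX.
- by move=> x _; rewrite lee_fin sqr_ge0.
- by rewrite lee_fin sqr_ge0.
rewrite lte_mul_pinfty ?lee_fin ?sqr_ge0//.
move/integrableP : ik => [_]; apply: le_lt_trans.
by apply: ge0_le_integral => //=; [move=> x _; rewrite lee_fin sqr_ge0|
  apply/measurable_EFinP; exact: measurable_funX|
  apply/measurable_EFinP; apply: measurableT_comp => //; exact: measurable_funX|
  move=> x _; rewrite lee_fin ler_norm].
Qed.

Lemma is_mul_exists m f (b : R) : measurable_fun setT (m : mR -> mR) ->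
  (forall x, `|m x| <= b) -> exists g, is_mul Fr m f g.
Proof.
move=> mm mb; pose G (x : R3 R) := (m (dot3 x x))%:C * Fr f x.
have md : measurable_fun setT (fun x : R3 R => m (dot3 x x) : R).
  by apply: (measurableT_comp mm); exact: measurable_dot3.
have GP : G \in L2pred leb3.
  have /andP[fr fi] := L2_val_pred (Fr f).
  apply/andP; split.
    rewrite (_ : (fun x => _) = (fun x => m (dot3 x x) * complex.Re (Fr f x))); last first.
      by apply/funext => x; rewrite /G ReM/= mul0r subr0.
    apply: (Lfun2_dominated _ fr); last by move=> x; rewrite normrM ler_wpM2r.
    by apply: measurable_funM => //; exact: measurable_L2_Re.
  rewrite (_ : (fun x => _) = (fun x => m (dot3 x x) * complex.Im (Fr f x))); last first.
    by apply/funext => x; rewrite /G ImM/= mul0r addr0.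
  apply: (Lfun2_dominated _ fi); last by move=> x; rewrite normrM ler_wpM2r.
  by apply: measurable_funM => //; exact: measurable_L2_Im.
have [g Gg] := L2_exists GP; have [f' ff'] := fourier_surj hFr g.
by exists f'; rewrite /is_mul ff'.
Qed.

Lemma is_mul1 f : is_mul Fr (fun=> 1) f f.
Proof. by apply: aeW => x; rewrite mul1r. Qed.

Lemma ae_dot3_neq (a : R) : \forall x \ae (@leb3 R), dot3 x x != a.
Proof.
have mN : measurable [set x : R3 R | dot3 x x = a].
  rewrite (_ : [set _ | _] = (fun x : R3 R => dot3 x x) @^-1` [set a])//.
  rewrite -[X in measurable X]setTI.
  by apply: measurable_dot3 => //; exact: measurable_set1.
have nea : \forall l \ae leb, l != a.
  exists [set a]; split; [exact: measurable_set1|exact: lebesgue_measure_set1|].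
  by move=> l /= /negP; rewrite negbK => /eqP.
have := polar_ae mN _ => H.
have {H} : \forall x \ae leb3, ~ [set x : R3 R | dot3 x x = a] x.
  apply: H; apply: filterS nea => l la l0; apply: (ae_imply2 _ (sphere_unit R) (sphere_unit R)).
  move=> om o1 _ /=; rewrite dot3_scale o1 mulr1 sqr_sqrtr// => /eqP.
  by rewrite (negbTE la).
by apply: filterS => x /= /eqP.
Qed.

Lemma is_mul_inner m m' m1 m1' f f' g g' h h' (a : R) :
  is_mul Fr m f g -> is_mul Fr m' f' g' -> is_mul Fr m1 f h -> is_mul Fr m1' f' h' ->
  (forall x, 0 <= x -> x != a -> m x * m' x = m1 x * m1' x) ->
  innerL2 g g' = innerL2 h h'.
Proof.
move=> fg fg' fh fh' mm; rewrite -(fourier_inner hFr) -[RHS](fourier_inner hFr).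
apply: innerL2_ae.
apply: ae_imply3 (ae_and fg fg') (ae_and fh fh') (ae_dot3_neq a).
move=> x [-> ->] [-> ->] xa; rewrite !conjM !conjc_real.
have := mm _ (dot3_ge0 x) xa => H.
have HC : (m (dot3 x x))%:C * (m' (dot3 x x))%:C = (m1 (dot3 x x))%:C * (m1' (dot3 x x))%:C :> R[i].
  by rewrite -!rmorphM/= H.
by rewrite mulrACA HC mulrACA.
Qed.

Lemma is_mul_ext m m' f g (a : R) :
  (forall x, 0 <= x -> x != a -> m x = m' x) -> is_mul Fr m f g -> is_mul Fr m' f g.
Proof.
move=> mm; apply: ae_imply2 (ae_dot3_neq a) => x xa ->.
by rewrite mm// dot3_ge0.
Qed.

Lemma is_mul_lin a m f f' g g' : is_mul Fr m f g -> is_mul Fr m f' g' ->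
  is_mul Fr m (a *: f + f') (a *: g + g').
Proof.
move=> fg fg'; rewrite /is_mul !(fourier_lin hFr).
have K1 := ae_and (L2_addE (a *: Fr f) (Fr f')) (L2_scaleE a (Fr f)).
have K2 := ae_and (L2_addE (a *: Fr g) (Fr g')) (L2_scaleE a (Fr g)).
apply: ae_imply3 (ae_and fg fg') K1 K2 => x [h1 h2] [h3 h4] [h5 h6].
by rewrite h5 h6 h1 h2 h3 h4 mulrDr mulrCA.
Qed.

Lemma is_mul_comp m m' f g h : is_mul Fr m f g -> is_mul Fr m' g h ->
  is_mul Fr (fun x => m' x * m x) f h.
Proof.
by apply: ae_imply2 => x h1 h2; rewrite h2 h1 rmorphM/= mulrA.
Qed.

Lemma is_mul_subm m m' f g g' : is_mul Fr m f g -> is_mul Fr m' f g' ->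
  is_mul Fr (fun x => m x - m' x) f (g - g').
Proof.
move=> fg fg'; have -> : g - g' = (-1) *: g' + g by rewrite scaleN1r addrC.
rewrite /is_mul (fourier_lin hFr).
apply: ae_imply3 (ae_and fg fg') (L2_addE (-1 *: Fr g') (Fr g)) (L2_scaleE (-1) (Fr g')).
by move=> x [-> ->] -> ->; rewrite rmorphB/= mulrBl mulN1r addrC.
Qed.

(** ** Continuous curves of fibres *)

Definition curve_continuous c :=
  forall l, 0 <= l -> normL2 (c x - c l) @[x --> within [set x | 0 <= x] (nbhs l)] --> 0.

Lemma curve_inner_continuous c e l : curve_continuous c -> curve_continuous e ->
  0 <= l ->
  Normc.normc (innerL2 (c x) (e x) - innerL2 (c l) (e l))
    @[x --> within [set x | 0 <= x] (nbhs l)] --> 0.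
Proof.
move=> cc ce l0.
have H : (normL2 (c x - c l) * (normL2 (e l) + normL2 (e x - e l)) +
   normL2 (c l) * normL2 (e x - e l)) @[x --> within [set x | 0 <= x] (nbhs l)] --> (0 : R).
  rewrite [X in _ --> X](_ : _ = 0 * (normL2 (e l) + 0) + normL2 (c l) * 0);
    last by rewrite mul0r mulr0 addr0.
  apply: cvgD; apply: cvgM.
  - exact: (cc l l0).
  - by apply: cvgD; [exact: cvg_cst|exact: (ce l l0)].
  - exact: cvg_cst.
  - exact: (ce l l0).
apply: (squeeze_cvgr _ _ H) => //; last first.
  exact: (@cvg_cst _ (0 : R)).
apply: nearW => x; apply/andP; split; first exact: normc_ge0.
have -> : innerL2 (c x) (e x) - innerL2 (c l) (e l) =
    innerL2 (c x - c l) (e x) + innerL2 (c l) (e x - e l).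
  by rewrite innerBl innerBr; ring.
rewrite (le_trans (le_normcD _ _))// lerD//.
  rewrite (le_trans (inner_CauchySchwarz _ _))// ler_wpM2l ?normL2_ge0//.
  by rewrite -{1}(subrK (e l) (e x)) addrC ler_normL2D.
exact: inner_CauchySchwarz.
Qed.

Lemma curve_inner_measurable c e : curve_continuous c -> curve_continuous e ->
  measurable_fun hl ((fun l => complex.Re (innerL2 (c l) (e l))) : mR -> mR) /\
  measurable_fun hl ((fun l => complex.Im (innerL2 (c l) (e l))) : mR -> mR).
Proof.
move=> cc ce.
suff H (p : R[i] -> R) : (forall z w, `|p z - p w| <= Normc.normc (z - w)) ->
    measurable_fun hl ((fun l => p (innerL2 (c l) (e l))) : mR -> mR).
  split; apply: H => z w.
    by rewrite -ReN -ReD normc_Re.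
  rewrite -ImN -ImD -normcN.
  case: (z - w) => a b /=; rewrite -sqrtr_sqr ler_wsqrtr// !sqrrN lerDr sqr_ge0//.
move=> pz; apply: subspace_continuous_measurable_fun; first exact: measurable_itv.
apply/subspace_continuousP => l; rewrite /= in_itv/= andbT => l0.
apply/cvgrPdist_lt => eps eps0.
have := curve_inner_continuous cc ce l0 => /cvgrPdist_lt/(_ _ eps0).
rewrite !near_withinE; apply: filterS => x xl /=.
rewrite in_itv/= andbT => x0; rewrite distrC (le_lt_trans (pz _ _))//.
by move: (xl x0); rewrite sub0r normrN ger0_norm// normc_ge0.
Qed.

End multipliers.

Section parseval.
Variable R : realType.
Local Notation leb := (@lebesgue_measure R).
Local Notation mR := (measurableTypeR R).
Local Notation hl := (`[0%R, +oo[%classic : set mR).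
Variable Fr : L2R3 R -> L2R3 R.
Hypothesis hFr : is_fourier Fr.
Implicit Types (f g h u w : L2R3 R) (c e U W : R -> L2S2 R) (m : R -> R).

Lemma represents_norm_Rintegral f c : represents Fr f c ->
  measurable_fun hl ((fun l => normL2 (c l) ^+ 2) : mR -> R) ->
  leb.-integrable hl (EFin \o (fun l => normL2 (c l) ^+ 2)) /\
  normL2 f ^+ 2 = \int[leb]_(l in hl) (normL2 (c l) ^+ 2).
Proof.
move=> fc mc; have E := represents_norm hFr fc mc; split; last first.
  by rewrite -[RHS]/(fine _) -E.
apply/integrableP; split; first exact/measurable_EFinP.
under eq_integral do rewrite /= ger0_norm ?sqr_ge0//.
by rewrite -E ltry.
Qed.

(** Polarization of the norm formula. *)
Lemma represents_inner_Re f g c e : represents Fr f c -> represents Fr g e ->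
  measurable_fun hl ((fun l => normL2 (c l) ^+ 2) : mR -> R) ->
  measurable_fun hl ((fun l => normL2 (e l) ^+ 2) : mR -> R) ->
  measurable_fun hl ((fun l => complex.Re (innerL2 (c l) (e l))) : mR -> R) ->
  leb.-integrable hl (EFin \o (fun l => complex.Re (innerL2 (c l) (e l)))) /\
  complex.Re (innerL2 f g) = \int[leb]_(l in hl) complex.Re (innerL2 (c l) (e l)).
Proof.
move=> fc ge mc me mce.
have sqD d (T : measurableType d) (mu : {measure set T -> \bar R}) (x y : L2 mu) :
    normL2 (1 *: x + y) ^+ 2 = normL2 x ^+ 2 + normL2 y ^+ 2 + 2 * complex.Re (innerL2 x y).
  rewrite scale1r !normL2_sqr innerDl !innerDr !ReD (innerC x y) Re_conj; ring.
have rs := represents_lin hFr 1 fc ge.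
have ms : measurable_fun hl ((fun l => normL2 (1 *: c l + e l) ^+ 2) : mR -> R).
  rewrite (_ : (fun l => _) = (fun l => normL2 (c l) ^+ 2 + normL2 (e l) ^+ 2 +
      2 * complex.Re (innerL2 (c l) (e l)))); last by apply/funext => l; exact: sqD.
  apply: measurable_funD.
    exact: measurable_funD.
  by apply: measurable_funM.
have [is_ Es] := represents_norm_Rintegral rs ms.
have [ic Ec] := represents_norm_Rintegral fc mc.
have [ie Ee] := represents_norm_Rintegral ge me.
pose S l := normL2 (1 *: c l + e l) ^+ 2.
pose N1 l := normL2 (c l) ^+ 2; pose N2 l := normL2 (e l) ^+ 2.
have mhl : measurable hl by exact: measurable_itv.
have iN : leb.-integrable hl (EFin \o (fun l => N1 l + N2 l)).
  rewrite (_ : _ \o _ = (EFin \o N1) \+ (EFin \o N2))%E//.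
  exact: integrableD.
have iSN : leb.-integrable hl (EFin \o (fun l => S l - (N1 l + N2 l))).
  rewrite (_ : _ \o _ = (EFin \o S) \- (EFin \o (fun l => N1 l + N2 l)%R))%E//.
  exact: integrableB.
have RE l : complex.Re (innerL2 (c l) (e l)) = 2^-1 * (S l - (N1 l + N2 l)).
  by rewrite /S sqD /N1 /N2; field.
have -> : (fun l => complex.Re (innerL2 (c l) (e l))) =
    (fun l => 2^-1 * (S l - (N1 l + N2 l))) by apply/funext => l; exact: RE.
split; first exact: integrableZ_EFin.
rewrite RintegralZl// RintegralB// RintegralD// -Es -Ec -Ee sqD.
by field.
Qed.

Lemma mul_curve_measurable m U : measurable_fun setT (m : mR -> mR) ->
  curve_continuous U ->
  measurable_fun hl ((fun l => normL2 ((m l)%:C *: U l) ^+ 2) : mR -> R).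
Proof.
move=> mm cU; have [mU _] := curve_inner_measurable cU cU.
rewrite (_ : (fun l => _) = (fun l => m l ^+ 2 * complex.Re (innerL2 (U l) (U l)))).
  by apply: measurable_funM => //; apply: measurable_funTS; exact: measurable_funX.
apply/funext => l; rewrite normL2_sqr innerZl innerZr conjc_real mulrA.
by rewrite ReM /= !mul0r !mulr0 !subr0 add0r mul0r subr0 expr2.
Qed.

Lemma mul_norm m u U g : measurable_fun setT (m : mR -> mR) ->
  curve_continuous U -> represents Fr u U -> is_mul Fr m u g ->
  ((normL2 g ^+ 2)%:E = \int[leb]_(l in hl) (m l ^+ 2 * normL2 (U l) ^+ 2)%:E)%E.
Proof.
move=> mm cU uU ug.
rewrite (represents_norm hFr (represents_mul uU ug)); last exact: mul_curve_measurable.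
by apply: eq_integral => l _; rewrite normL2Z exprMn normc_sqr/= expr0n addr0.
Qed.

Lemma mul_inner m m' u U w W g g' :
  measurable_fun setT (m : mR -> mR) -> measurable_fun setT (m' : mR -> mR) ->
  curve_continuous U -> curve_continuous W ->
  represents Fr u U -> represents Fr w W ->
  is_mul Fr m u g -> is_mul Fr m' w g' ->
  cintegrable leb hl (fun l => (m l * m' l)%:C * innerL2 (U l) (W l)) /\
  innerL2 g g' = cintegral leb hl (fun l => (m l * m' l)%:C * innerL2 (U l) (W l)).
Proof.
move=> mm mm' cU cW uU wW ug wg.
have [mr mi] := curve_inner_measurable cU cW.
have rg := represents_mul uU ug; have rg' := represents_mul wW wg.
have m1 := mul_curve_measurable mm cU; have m2 := mul_curve_measurable mm' cW.
have mmm : measurable_fun hl ((fun l => m l * m' l) : mR -> R).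
  by apply: measurable_funTS; exact: measurable_funM.
have riE l : innerL2 ((m l)%:C *: U l) ((m' l)%:C *: W l) =
    (m l * m' l)%:C * innerL2 (U l) (W l).
  by rewrite innerZl innerZr conjc_real mulrA rmorphM.
have mR1 : measurable_fun hl ((fun l => complex.Re
    (innerL2 ((m l)%:C *: U l) ((m' l)%:C *: W l))) : mR -> R).
  rewrite (_ : (fun l => _) = (fun l => (m l * m' l) * complex.Re (innerL2 (U l) (W l)))).
    exact: measurable_funM.
  by apply/funext => l; rewrite riE ReM /= mul0r subr0.
have [i1 E1] := represents_inner_Re rg rg' m1 m2 mR1.
have rg'' := represents_scale hFr 'i%C rg'.
have iE l : complex.Re (innerL2 ((m l)%:C *: U l) ('i%C *: ((m' l)%:C *: W l))) =
    complex.Im ((m l * m' l)%:C * innerL2 (U l) (W l)).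
  by rewrite innerZr riE ReM /= mul0r mulN1r sub0r opprK.
have mR2 : measurable_fun hl ((fun l => complex.Re
    (innerL2 ((m l)%:C *: U l) ('i%C *: ((m' l)%:C *: W l)))) : mR -> R).
  rewrite (_ : (fun l => _) = (fun l => (m l * m' l) * complex.Im (innerL2 (U l) (W l)))).
    exact: measurable_funM.
  by apply/funext => l; rewrite iE ImM /= mul0r addr0.
have m3 : measurable_fun hl ((fun l => normL2 ('i%C *: ((m' l)%:C *: W l)) ^+ 2) : mR -> R).
  rewrite (_ : (fun l => _) = (fun l => normL2 ((m' l)%:C *: W l) ^+ 2))//.
  by apply/funext => l; rewrite normL2Z /= expr0n add0r expr1n sqrtr1 mul1r.
have [i2 E2] := represents_inner_Re rg rg'' m1 m3 mR2.
have eR : (fun l => complex.Re (innerL2 ((m l)%:C *: U l) ((m' l)%:C *: W l))) =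
    (fun l => complex.Re ((m l * m' l)%:C * innerL2 (U l) (W l))).
  by apply/funext => l; rewrite riE.
have eI : (fun l => complex.Re (innerL2 ((m l)%:C *: U l) ('i%C *: ((m' l)%:C *: W l)))) =
    (fun l => complex.Im ((m l * m' l)%:C * innerL2 (U l) (W l))).
  by apply/funext => l; rewrite iE.
rewrite eR in i1 E1; rewrite eI in i2 E2.
split; first by split.
apply: complex_ReIm; first exact: E1.
rewrite -[RHS]E2 innerZr ReM /= mul0r mulN1r sub0r opprK//.
Qed.

End parseval.

(** * Smooth curves in a Hilbert space *)

Section smooth_curve.
Context d (T : measurableType d) (R : realType).
Variable mu : {measure set T -> \bar R}.
Variable V : nat -> R -> L2 mu.
Hypothesis hV : forall k lam, 0 <= lam ->
    normL2 ((h^-1)%:C *: (V k (lam + h) - V k lam) - V k.+1 lam)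
      @[h --> within [set h | 0 <= lam + h] 0^'] --> 0.

Lemma curve_diff_quotient k l (eps : R) : 0 <= l -> 0 < eps ->
  exists2 dl : R, 0 < dl & forall x, 0 <= x -> x != l -> `|x - l| < dl ->
    normL2 (((x - l)^-1)%:C *: (V k x - V k l) - V k.+1 l) < eps.
Proof.
move=> l0 eps0; have /cvgrPdist_lt/(_ _ eps0) := hV k l0.
rewrite near_withinE near_withinE => -[dl /= dl0 H]; exists dl => // x x0 xl xd.
have := H (x - l); rewrite /= sub0r normrN subr_eq0 => /(_ xd xl).
rewrite addrC subrK => /(_ x0).
by rewrite sub0r normrN ger0_norm// normL2_ge0.
Qed.

Lemma curve_locally_lipschitz k l : 0 <= l ->
  exists dl K : R, [/\ 0 < dl, 0 <= K & forall x, 0 <= x -> `|x - l| < dl ->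
    normL2 (V k x - V k l) <= K * `|x - l|].
Proof.
move=> l0; have [dl dl0 H] := @curve_diff_quotient k l 1 l0 ltr01.
exists dl, (1 + normL2 (V k.+1 l)); split => //; first by rewrite addr_ge0// normL2_ge0.
move=> x x0 xd; have [->|xl] := eqVneq x l.
  by rewrite subrr normL20 subrr normr0 mulr0.
have xl0 : x - l != 0 by rewrite subr_eq0.
have -> : V k x - V k l = (x - l)%:C *: (((x - l)^-1)%:C *: (V k x - V k l)).
  by rewrite scalerA -rmorphM/= mulfV// scale1r.
rewrite normL2Z/= expr0n/= addr0 sqrtr_sqr mulrC ler_wpM2r//.
have := H x x0 xl xd => /ltW h1.
rewrite -[X in normL2 X](subrK (V k.+1 l)) (le_trans (ler_normL2D _ _))//.
by rewrite lerD2r.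
Qed.

Lemma curve_locally_bounded k l : 0 <= l ->
  exists dl K : R, [/\ 0 < dl, 0 <= K & forall x, 0 <= x -> `|x - l| < dl ->
    normL2 (V k x) <= K].
Proof.
move=> l0; have [dl [K [dl0 K0 H]]] := @curve_locally_lipschitz k l l0.
exists dl, (K * dl + normL2 (V k l)); split => //.
  by rewrite addr_ge0 ?normL2_ge0// mulr_ge0// ltW.
move=> x x0 xd; rewrite -[V k x](subrK (V k l)) (le_trans (ler_normL2D _ _))//.
by rewrite lerD2r (le_trans (H x x0 xd))// ler_wpM2l// ltW.
Qed.

Lemma curve_is_continuous k l : 0 <= l ->
  normL2 (V k x - V k l) @[x --> within [set x | 0 <= x] (nbhs l)] --> 0.
Proof.
move=> l0; have [dl [K [dl0 K0 H]]] := @curve_locally_lipschitz k l l0.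
apply/cvgrPdist_lt => eps eps0; rewrite near_withinE.
have K1 : 0 < K + 1 by rewrite ltr_wpDl.
near=> x => /= x0; rewrite sub0r normrN ger0_norm ?normL2_ge0//.
have xd : `|x - l| < dl.
  by near: x; exists dl => //= y; rewrite /= distrC.
rewrite (le_lt_trans (H x x0 xd))// (@le_lt_trans _ _ ((K + 1) * `|x - l|))//.
  by rewrite ler_wpM2r// lerDl.
rewrite mulrC -ltr_pdivlMr//.
near: x; exists (eps / (K + 1)); first by rewrite /= divr_gt0.
by move=> y; rewrite /= distrC.
Unshelve. all: by end_near. Qed.

Lemma curve_scalar_derive (k : nat) (l : R) (w : L2 mu) : 0 < l ->
  is_derive l 1 (fun t => complex.Re (innerL2 (V k t) w))
    (complex.Re (innerL2 (V k.+1 l) w)).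
Proof.
move=> l0.
have H : (h^-1 *: ((fun t => complex.Re (innerL2 (V k t) w)) (h *: 1 + l) -
    complex.Re (innerL2 (V k l) w))) @[h --> 0^'] --> complex.Re (innerL2 (V k.+1 l) w).
  apply/cvgrPdist_lt => eps eps0.
  have w1 : 0 < normL2 w + 1 by rewrite ltr_wpDl// normL2_ge0.
  have e1 : 0 < eps / (normL2 w + 1) by rewrite divr_gt0.
  have [dl dl0 Hd] := @curve_diff_quotient k l _ (ltW l0) e1.
  near=> h.
  have h0 : h != 0 by near: h; exact: nbhs_dnbhs_neq.
  have hd : `|h| < dl.
    near: h; apply: dnbhs0_lt => //.
  have hl : `|h| < l by near: h; apply: dnbhs0_lt.
  have := Hd (h + l); rewrite addrK -subr_eq0 addrK => Hh.
  have hl0 : 0 <= h + l.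
    by move: hl; rewrite ltr_norml => /andP[+ _]; lra.
  have {}Hh := Hh hl0 h0 hd.
  rewrite distrC /GRing.scale/= mulr1.
  have -> : h^-1 * (complex.Re (innerL2 (V k (h + l)) w) -
      complex.Re (innerL2 (V k l) w)) - complex.Re (innerL2 (V k.+1 l) w) =
      complex.Re (innerL2 ((h^-1)%:C *: (V k (h + l) - V k l) - V k.+1 l) w).
    by rewrite innerBl innerZl innerBl !(ReD, ReN, ReM)/= mul0r subr0.
  rewrite (le_lt_trans (normc_Re _))// (le_lt_trans (inner_CauchySchwarz _ _))//.
  rewrite (@le_lt_trans _ _ (normL2 ((h^-1)%:C *: (V k (h + l) - V k l) - V k.+1 l) * (normL2 w + 1)))//.
    by rewrite ler_wpM2l ?normL2_ge0// lerDl.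
  by rewrite -ltr_pdivlMr.
have df : derivable (fun t => complex.Re (innerL2 (V k t) w)) l 1.
  by apply/cvg_ex; eexists; exact: H.
by apply: DeriveDef => //; apply/cvg_lim => //; exact: H.
Unshelve. all: by end_near. Qed.

(** The mean value inequality, from the scalar theorem applied to the pairing
    with the increment itself. *)
Lemma curve_mean_value (k : nat) (a b K : R) : 0 < a -> a <= b ->
  (forall t, a <= t <= b -> normL2 (V k.+1 t) <= K) ->
  normL2 (V k b - V k a) <= K * (b - a).
Proof.
move=> a0; rewrite le_eqVlt => /predU1P[<- _|ab HK].
  by rewrite !subrr normL20 mulr0.
set w := V k b - V k a.
pose f t := complex.Re (innerL2 (V k t) w).
have df t : t \in `]a, b[ -> is_derive t 1 f (complex.Re (innerL2 (V k.+1 t) w)).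
  by rewrite in_itv/= => /andP[at_ _]; apply: curve_scalar_derive; exact: lt_trans at_.
have cf : {within `[a, b], continuous f}.
  apply: derivable_within_continuous => t; rewrite in_itv/= => /andP[at_ _].
  by have [] := @curve_scalar_derive k t w (lt_le_trans a0 at_).
have [t tab] := MVT ab df cf.
rewrite /f -ReN -ReD -innerBl -/w -normL2_sqr => E.
have [w0|w0] := eqVneq (normL2 w) 0.
  by rewrite w0 mulr_ge0 ?subr_ge0 ?(ltW ab)// (le_trans (normL2_ge0 _) (HK a _))// lexx ltW.
have wp : 0 < normL2 w by rewrite lt_neqAle eq_sym w0 normL2_ge0.
rewrite -(ler_pM2r wp) -expr2 E mulrAC ler_wpM2r ?subr_ge0 ?(ltW ab)//.
rewrite (le_trans (ler_norm _))// (le_trans (normc_Re _))//.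
rewrite (le_trans (inner_CauchySchwarz _ _))// ler_wpM2r ?normL2_ge0//.
by apply: HK; move: tab; rewrite in_itv/= => /andP[/ltW-> /ltW->].
Qed.

Lemma curve_mean_value_sym k x y (K : R) : 0 < x -> 0 < y ->
  (forall t, Num.min x y <= t <= Num.max x y -> normL2 (V k.+1 t) <= K) ->
  normL2 (V k x - V k y) <= K * `|x - y|.
Proof.
move=> x0 y0 H; have [xy|/ltW yx] := leP x y.
  rewrite -normL2N opprB distrC ger0_norm ?subr_ge0//.
  by apply: curve_mean_value => // t txy; apply: H; rewrite min_l ?max_r.
rewrite ger0_norm ?subr_ge0//.
by apply: curve_mean_value => // t txy; apply: H; rewrite min_r ?max_l.
Qed.

Lemma curve_vanish k j s : 0 < s -> (forall i, (i < j)%N -> V (k + i)%N s = 0) ->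
  exists rho K : R, [/\ 0 < rho, 0 <= K & forall x, `|x - s| < rho ->
    normL2 (V k x) <= K * `|x - s| ^+ j].
Proof.
move=> s0; elim: j k => [|j IH] k Vk.
  have [dl [K [dl0 K0 H]]] := @curve_locally_bounded k s (ltW s0).
  exists (Num.min dl s), K; split => //; first by rewrite lt_min dl0.
  move=> x; rewrite lt_min => /andP[xd xs]; rewrite expr0 mulr1 H//.
  by move: xs; rewrite ltr_norml => /andP[+ _]; lra.
have [|rho [K [rho0 K0 H]]] := IH k.+1.
  by move=> i ij; rewrite addSnnS; exact: Vk.
exists (Num.min rho s), K; split => //; first by rewrite lt_min rho0.
move=> x; rewrite lt_min => /andP[xd xs].
have Vks : V k s = 0 by have := Vk 0%N isT; rewrite addn0.
have x0 : 0 < x by move: xs; rewrite ltr_norml => /andP[+ _]; lra.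
rewrite -[V k x]subr0 -Vks exprSr mulrA; apply: curve_mean_value_sym => // t tx.
have ts : `|t - s| <= `|x - s|.
  move: tx; have [xs'|/ltW sx] := leP x s.
    by move=> /andP[t1 t2]; rewrite ler0_norm ?subr_le0// ler0_norm ?subr_le0//; lra.
  by move=> /andP[t1 t2]; rewrite ger0_norm ?subr_ge0// ger0_norm ?subr_ge0//; lra.
rewrite (le_trans (H t (le_lt_trans ts xd)))// ler_wpM2l//.
by rewrite lerXn2r// nnegrE.
Qed.

Lemma curve_lipschitz_near k s : 0 < s ->
  exists rho K : R, [/\ 0 < rho, 0 <= K & forall x y, `|x - s| < rho -> `|y - s| < rho ->
    normL2 (V k x - V k y) <= K * `|x - y|].
Proof.
move=> s0; have [dl [K [dl0 K0 H]]] := @curve_locally_bounded k.+1 s (ltW s0).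
exists (Num.min dl s), K; split => //; first by rewrite lt_min dl0.
move=> x y; rewrite !lt_min => /andP[xd xs] /andP[yd ys].
move: xd xs yd ys; rewrite !ltr_norml => /andP[x1 x2] /andP[x3 x4] /andP[y1 y2] /andP[y3 y4].
apply: curve_mean_value_sym; [lra|lra|].
move=> t; rewrite ge_min le_max => /andP[/orP t1 /orP t2].
by apply: H; [case: t1 => ?; lra|rewrite ltr_norml; case: t1; case: t2 => *; lra].
Qed.

End smooth_curve.

(** * Principal values *)

Section principal_value.
Variable R : realType.
Local Notation leb := (@lebesgue_measure R).
Local Notation mR := (measurableTypeR R).

Lemma integral_derivative (F f : R -> R) (a b : R) : a < b ->
  (forall x, a <= x <= b -> is_derive x 1 F (f x)) ->
  (forall x, a <= x <= b -> {for x, continuous f}) ->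
  (\int[leb]_(x in `[a, b]) (f x)%:E = (F b - F a)%:E)%E.
Proof.
move=> ab dF cf.
have cF x : a <= x <= b -> {for x, continuous F}.
  by move=> /dF[dFx _]; apply: differentiable_continuous; apply/derivable1_diffP.
rewrite (@continuous_FTC2 _ f F a b ab)//.
- apply: continuous_in_subspaceT => x; rewrite inE/= in_itv/=; exact: cf.
- split.
  + by move=> x; rewrite in_itv/= => /andP[ax xb]; case: (dF x); rewrite ?(ltW ax) ?(ltW xb).
  + by apply: cvg_at_right_filter; apply: cF; rewrite lexx ltW.
  + by apply: cvg_at_left_filter; apply: cF; rewrite lexx ltW.
- move=> x; rewrite in_itv/= => /andP[ax xb].
  by rewrite derive1E; have [] := dF x _; rewrite ?(ltW ax) ?(ltW xb).
Qed.

Lemma continuous_inv_sub (m x : R) : x != m ->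
  {for x, continuous (fun x => (x - m)^-1)}.
Proof.
move=> xm; apply: cvgV; first by rewrite subr_eq0.
by apply: cvgB; [exact: cvg_id|exact: cvg_cst].
Qed.

Lemma is_derive_sub_cst (m x : R) : is_derive x 1 (fun x => x - m) 1.
Proof.
have : is_derive x 1 (fun x => x - m) (1 - 0) by exact: is_deriveB.
by rewrite subr0.
Qed.

Lemma is_derive_cst_sub (m x : R) : is_derive x 1 (fun x => m - x) (- 1).
Proof.
have : is_derive x 1 (fun x => m - x) (0 - 1) by exact: is_deriveB.
by rewrite sub0r.
Qed.

Lemma integral_inv_right (m e' e : R) : 0 < e' -> e' < e ->
  (\int[leb]_(x in `[(m + e')%R, (m + e)%R]) ((x - m)^-1)%:E = (ln e - ln e')%:E)%E.
Proof.
move=> e'0 e'e.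
apply: (etrans (@integral_derivative (fun x => ln (x - m)) (fun x => (x - m)^-1) _ _ _ _ _)).
- by rewrite ltrD2l.
- move=> x /andP[x1 _]; have xm : 0 < x - m by lra.
  have D := is_derive_sub_cst m x.
  have := @is_derive1_comp _ (@ln R) (fun x => x - m) x _ _ (is_derive1_ln xm) D.
  by rewrite mulr1.
- by move=> x /andP[x1 _]; apply: continuous_inv_sub; apply/eqP; lra.
- by rewrite ![m + _]addrC !addrK.
Qed.

Lemma integral_inv_left (m e' e : R) : 0 < e' -> e' < e ->
  (\int[leb]_(x in `[(m - e)%R, (m - e')%R]) ((x - m)^-1)%:E = (ln e' - ln e)%:E)%E.
Proof.
move=> e'0 e'e.
apply: (etrans (@integral_derivative (fun x => ln (m - x)) (fun x => (x - m)^-1) _ _ _ _ _)).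
- by rewrite ltrD2l ltrN2.
- move=> x /andP[_ x1]; have xm : 0 < m - x by lra.
  have D := is_derive_cst_sub m x.
  have := @is_derive1_comp _ (@ln R) (fun x => m - x) x _ _ (is_derive1_ln xm) D.
  by rewrite mulrN1 -invrN opprB.
- by move=> x /andP[_ x1]; apply: continuous_inv_sub; apply/eqP; lra.
- by congr (_%:E); congr (ln _ - ln _); ring.
Qed.

Lemma integral_invsq_right (m e' e : R) : 0 < e' -> e' < e ->
  (\int[leb]_(x in `[(m + e')%R, (m + e)%R]) ((x - m) ^- 2)%:E = (e'^-1 - e^-1)%:E)%E.
Proof.
move=> e'0 e'e.
apply: (etrans (@integral_derivative (fun x => - (x - m)^-1) (fun x => (x - m) ^- 2) _ _ _ _ _)).
- by rewrite ltrD2l.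
- move=> x /andP[x1 _]; have xm : x - m != 0 by apply/eqP; lra.
  have D := is_derive_sub_cst m x.
  have := @is_deriveN _ _ _ _ _ _ _ (@is_deriveV R (fun x => x - m) x 1 1 xm D).
  by rewrite /GRing.scale/= mulr1 opprK.
- move=> x /andP[x1 _]; apply: cvgV; first by rewrite expf_neq0//; apply/eqP; lra.
  apply: (@continuous_comp _ _ _ (fun x => x - m) (fun x => x ^+ 2)).
    by apply: cvgB; [exact: cvg_id|exact: cvg_cst].
  exact: exprn_continuous.
- by rewrite ![m + _]addrC !addrK opprK addrC.
Qed.

Lemma integral_invsq_left (m e' e : R) : 0 < e' -> e' < e ->
  (\int[leb]_(x in `[(m - e)%R, (m - e')%R]) ((x - m) ^- 2)%:E = (e'^-1 - e^-1)%:E)%E.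
Proof.
move=> e'0 e'e.
apply: (etrans (@integral_derivative (fun x => - (x - m)^-1) (fun x => (x - m) ^- 2) _ _ _ _ _)).
- by rewrite ltrD2l ltrN2.
- move=> x /andP[_ x1]; have xm : x - m != 0 by apply/eqP; lra.
  have D := is_derive_sub_cst m x.
  have := @is_deriveN _ _ _ _ _ _ _ (@is_deriveV R (fun x => x - m) x 1 1 xm D).
  by rewrite /GRing.scale/= mulr1 opprK.
- move=> x /andP[_ x1]; apply: cvgV; first by rewrite expf_neq0//; apply/eqP; lra.
  apply: (@continuous_comp _ _ _ (fun x => x - m) (fun x => x ^+ 2)).
    by apply: cvgB; [exact: cvg_id|exact: cvg_cst].
  exact: exprn_continuous.
- have -> : m - e' - m = - e' by ring.
  have -> : m - e - m = - e by ring.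
  by rewrite !invrN !opprK.
Qed.

End principal_value.

Section pv_limit.
Variable R : realType.
Local Notation leb := (@lebesgue_measure R).
Local Notation mR := (measurableTypeR R).

Definition pv_cut (m e : R) : set mR := ~` `]m - e, m + e[%classic.

Lemma measurable_pv_cut m e : measurable (pv_cut m e).
Proof. by apply: measurableC; exact: measurable_itv. Qed.

Lemma pv_cutE m e x : pv_cut m e x <-> e <= `|x - m|.
Proof.
rewrite /pv_cut /= in_itv/= -ltr_distlC distrC leNgt.
by split => /negP.
Qed.

Definition pv_right (m e' e : R) : set mR := `[m + e', m + e[%classic.
Definition pv_left (m e' e : R) : set mR := `]m - e, m - e']%classic.

Lemma pv_cut_split m e' e : 0 < e' -> e' < e ->
  pv_cut m e' = pv_cut m e `|` (pv_right m e' e `|` pv_left m e' e).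
Proof.
move=> e0 ee; apply/seteqP; split => x.
  move=> /pv_cutE H; have [H1|H1] := leP e `|x - m|; first by left; apply/pv_cutE.
  right; rewrite /pv_right /pv_left /= !in_itv/=.
  move: H H1; have [x0|x0] := leP 0 (x - m).
    by rewrite ger0_norm// => h1 h2; left; apply/andP; split; lra.
  by rewrite ltr0_norm// => h1 h2; right; apply/andP; split; lra.
move=> [/pv_cutE H|[|]]; first by apply/pv_cutE; exact: le_trans (ltW ee) H.
  rewrite /pv_right /= in_itv/= => /andP[h1 h2]; apply/pv_cutE.
  by rewrite ger0_norm; lra.
rewrite /pv_left /= in_itv/= => /andP[h1 h2]; apply/pv_cutE.
by rewrite ler0_norm; lra.
Qed.

Section limit.
Variables (f : mR -> R) (m e0 L : R).
Hypotheses (e00 : 0 < e0) (L0 : 0 <= L).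
Hypothesis fi : forall e, 0 < e ->
  leb.-integrable (pv_cut m e) (EFin \o (fun x => f x / (x - m))).
Hypothesis fL : forall x, `|x - m| <= e0 -> `|f x - f m| <= L * `|x - m|.

Let A e := \int[leb]_(x in pv_cut m e) (f x / (x - m)).

Let piece (S : set mR) (e : R) (l : R) : measurable S -> 0 <= e -> e <= e0 -> 0 <= l ->
  (forall x, S x -> x != m) ->
  (forall x, S x -> `|x - m| <= e) -> (leb S <= l%:E)%E ->
  leb.-integrable S (EFin \o (fun x => f x / (x - m))) ->
  leb.-integrable S (EFin \o (fun x => (x - m)^-1)) ->
  `|\int[leb]_(x in S) (f x / (x - m)) - f m * \int[leb]_(x in S) (x - m)^-1| <= L * l.
Proof.
move=> mS e_ge0 ee l0 Sm Se Sl i1 i2.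
have i3 : leb.-integrable S (EFin \o (fun x => f m * (x - m)^-1)).
  exact: integrableZ_EFin.
rewrite -RintegralZl// -RintegralB//.
have i4 : leb.-integrable S (EFin \o (fun x => f x / (x - m) - f m * (x - m)^-1)).
  rewrite (_ : _ \o _ = (EFin \o (fun x => (f x / (x - m))%R)) \-
    (EFin \o (fun x => (f m * (x - m)^-1)%R)))%E//.
  exact: integrableB.
have Sfin : (leb S < +oo)%E by rewrite (le_lt_trans Sl)// ltry.
have iL : leb.-integrable S (EFin \o (fun=> L)).
  apply/integrableP; split; first exact: measurable_cst.
  by rewrite /= integral_cst// lte_mul_pinfty// lee_fin.
rewrite (le_trans (le_normr_Rintegral mS i4))//.
apply: (@le_trans _ _ (\int[leb]_(x in S) L)).
  apply: le_Rintegral => //.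
    rewrite (_ : _ \o _ = (abse \o (EFin \o (fun x => (f x / (x - m) - f m * (x - m)^-1)%R)))%E)//.
    exact: integrable_abse.
  move=> x Sx; rewrite -mulrBl normrM normfV ler_pdivrMr ?normr_gt0 ?subr_eq0 ?Sm//.
  by rewrite fL// (le_trans (Se x Sx)).
rewrite Rintegral_cst// ler_wpM2l//.
by rewrite -lee_fin fineK// ge0_fin_numE.
Qed.

Let A_cauchy e' e : 0 < e' -> e' < e -> e <= e0 -> `|A e' - A e| <= 2 * L * e.
Proof.
move=> e'0 e'e ee0; have e_gt0 : 0 < e := lt_trans e'0 e'e.
have mrt : measurable (pv_right m e' e) by exact: measurable_itv.
have mlt : measurable (pv_left m e' e) by exact: measurable_itv.
have sub1 : pv_right m e' e `|` pv_left m e' e `<=` pv_cut m e'.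
  by rewrite (@pv_cut_split m e' e)//; exact: subsetUr.
have iN : leb.-integrable (pv_right m e' e `|` pv_left m e' e) (EFin \o (fun x => f x / (x - m))).
  apply: integrableS sub1 (fi e'0) => //; first exact: measurable_pv_cut.
  exact: measurableU.
have ir : leb.-integrable (pv_right m e' e) (EFin \o (fun x => f x / (x - m))).
  by apply: integrableS (@subsetUl _ _ _) iN => //; exact: measurableU.
have il : leb.-integrable (pv_left m e' e) (EFin \o (fun x => f x / (x - m))).
  by apply: integrableS (@subsetUr _ _ _) iN => //; exact: measurableU.
have dis : [disjoint pv_right m e' e & pv_left m e' e].
  by apply/disj_setPS => x [/=]; rewrite /pv_right /pv_left /= !in_itv/= => /andP[? ?] /andP[? ?]; lra.
have dis2 : [disjoint pv_cut m e & (pv_right m e' e `|` pv_left m e' e)].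
  apply/disj_setPS => x [/pv_cutE xe]; rewrite /pv_right /pv_left /= !in_itv/=.
  move: xe; have [x0|x0] := leP 0 (x - m).
    by rewrite ger0_norm// => ? [|] /andP[? ?]; lra.
  by rewrite ltr0_norm// => ? [|] /andP[? ?]; lra.
have -> : A e' - A e = \int[leb]_(x in pv_right m e' e) (f x / (x - m)) +
    \int[leb]_(x in pv_left m e' e) (f x / (x - m)).
  rewrite /A (@pv_cut_split m e' e)// Rintegral_setU//.
  - by rewrite Rintegral_setU// addrAC subrr add0r.
  - exact: measurable_pv_cut.
  - exact: measurableU.
  - by rewrite -(@pv_cut_split m e' e)//; exact: fi.
have invR : (\int[leb]_(x in pv_right m e' e) ((x - m)^-1)%:E = (ln e - ln e')%:E)%E.
  rewrite -(integral_inv_right m e'0 e'e) /pv_right integral_itv_bndo_bndc//.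
  apply/measurable_EFinP; apply: subspace_continuous_measurable_fun; first exact: measurable_itv.
  apply: continuous_in_subspaceT => x; rewrite inE /= in_itv/= => /andP[h1 h2].
  by apply: continuous_inv_sub; apply/eqP; lra.
have invL : (\int[leb]_(x in pv_left m e' e) ((x - m)^-1)%:E = (ln e' - ln e)%:E)%E.
  rewrite -(integral_inv_left m e'0 e'e) /pv_left integral_itv_obnd_cbnd//.
  apply/measurable_EFinP; apply: subspace_continuous_measurable_fun; first exact: measurable_itv.
  apply: continuous_in_subspaceT => x; rewrite inE /= in_itv/= => /andP[h1 h2].
  by apply: continuous_inv_sub; apply/eqP; lra.
have iiR : leb.-integrable (pv_right m e' e) (EFin \o (fun x => (x - m)^-1)).
  have ic : leb.-integrable (`[m + e', m + e]%classic : set mR) (EFin \o (fun x => (x - m)^-1)).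
    apply: continuous_compact_integrable; first exact: segment_compact.
    apply: continuous_in_subspaceT => x; rewrite inE /= in_itv/= => /andP[h1 h2].
    by apply: continuous_inv_sub; apply/eqP; lra.
  by apply: integrableS ic => //; apply: subset_itvl; rewrite bnd_simp.
have iiL : leb.-integrable (pv_left m e' e) (EFin \o (fun x => (x - m)^-1)).
  have ic : leb.-integrable (`[m - e, m - e']%classic : set mR) (EFin \o (fun x => (x - m)^-1)).
    apply: continuous_compact_integrable; first exact: segment_compact.
    apply: continuous_in_subspaceT => x; rewrite inE /= in_itv/= => /andP[h1 h2].
    by apply: continuous_inv_sub; apply/eqP; lra.
  by apply: integrableS ic => //; apply: subset_itvr; rewrite bnd_simp.
have bR : `|\int[leb]_(x in pv_right m e' e) (f x / (x - m)) -
    f m * \int[leb]_(x in pv_right m e' e) (x - m)^-1| <= L * e.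
  apply: (@piece (pv_right m e' e) e) => //; first exact: ltW.
  - exact: ltW.
  - by move=> x; rewrite /pv_right /= in_itv/= => /andP[h1 h2]; apply/eqP; lra.
  - move=> x; rewrite /pv_right /= in_itv/= => /andP[h1 h2].
    by rewrite ger0_norm; lra.
  - rewrite /pv_right lebesgue_measure_itv/= lte_fin; case: ifPn => _; rewrite ?lee_fin; lra.
have bL : `|\int[leb]_(x in pv_left m e' e) (f x / (x - m)) -
    f m * \int[leb]_(x in pv_left m e' e) (x - m)^-1| <= L * e.
  apply: (@piece (pv_left m e' e) e) => //; first exact: ltW.
  - exact: ltW.
  - by move=> x; rewrite /pv_left /= in_itv/= => /andP[h1 h2]; apply/eqP; lra.
  - move=> x; rewrite /pv_left /= in_itv/= => /andP[h1 h2].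
    by rewrite ler0_norm; lra.
  - rewrite /pv_left lebesgue_measure_itv/= lte_fin; case: ifPn => _; rewrite ?lee_fin; lra.
rewrite /Rintegral invR /= in bR; rewrite /Rintegral invL /= in bL.
move: bR bL; rewrite -!/(Rintegral _ _ _) !ler_norml => /andP[r1 r2] /andP[l1 l2].
have z : f m * (ln e - ln e') + f m * (ln e' - ln e) = 0 by ring.
apply/andP; split; lra.
Qed.

Let A_cvg : cvg (A e @[e --> 0^'+]).
Proof.
apply: cauchy_cvg; apply: cauchy_exP => eps eps0.
have L1 : 0 < 2 * L + 1 by rewrite ltr_wpDl// mulr_ge0.
pose dl := Num.min e0 (eps / (2 * L + 1)).
have dl0 : 0 < dl by rewrite lt_min e00 divr_gt0.
have key e1 e2 : 0 < e1 < dl -> 0 < e2 < dl -> e1 < e2 -> `|A e1 - A e2| < eps.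
  move=> /andP[e10 _] /andP[e20]; rewrite lt_min => /andP[e2e e2d] e12.
  rewrite (le_lt_trans (A_cauchy e10 e12 (ltW e2e)))//.
  rewrite (@le_lt_trans _ _ ((2 * L + 1) * e2))//.
    by rewrite ler_wpM2r ?(ltW e20)// lerDl.
  by rewrite mulrC -ltr_pdivlMr.
have h2 : 0 < dl / 2 < dl by apply/andP; split; lra.
exists (A (dl / 2)).
change (\forall e1 \near 0^'+, ball (A (dl / 2)) eps (A e1)).
near=> e1.
have h1 : 0 < e1 < dl.
  by apply/andP; split; near: e1; [exact: nbhs_right_gt|exact: nbhs_right_lt].
rewrite /= /ball/=.
have [e12|e21|->] := ltgtP e1 (dl / 2).
- by rewrite distrC; exact: key.
- exact: key.
- by rewrite subrr normr0.
Unshelve. all: by end_near. Qed.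

Lemma pv_cvg : A e @[e --> 0^'+] --> pv_gammaR f m.
Proof. exact: A_cvg. Qed.

(** The part of the integral cut out is controlled by the Lipschitz constant,
    since the odd kernel integrates to zero over symmetric annuli. *)
Lemma pv_error e : 0 < e -> e <= e0 ->
  `|pv_gammaR f m - \int[leb]_(x in pv_cut m e) (f x / (x - m))| <= 2 * L * e.
Proof.
move=> e_gt0 ee0.
have H : `|A e' - A e| @[e' --> 0^'+] --> `|pv_gammaR f m - A e|.
  by apply: cvg_norm; apply: cvgB; [exact: pv_cvg|exact: cvg_cst].
apply: (@closed_cvg _ _ _ _ (fun e' => `|A e' - A e|) (fun x => x <= 2 * L * e) _ _ _ H).
  exact: closed_le.
near=> e'.
have h1 : 0 < e' by near: e'; exact: nbhs_right_gt.
have h2 : e' < e by near: e'; exact: nbhs_right_lt.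
exact: A_cauchy.
Unshelve. all: by end_near. Qed.

End limit.

End pv_limit.

(** * Truncated resolvents near the vanishing point *)

Section truncation.
Variable R : realType.
Local Notation leb := (@lebesgue_measure R).
Local Notation mR := (measurableTypeR R).
Local Notation hl := (`[0%R, +oo[%classic : set mR).
Variable Fr : L2R3 R -> L2R3 R.
Hypothesis hFr : is_fourier Fr.
Implicit Types (f g h u w : L2R3 R) (c : R -> L2S2 R) (m e : R).

Definition cut_inv (m e x : R) : R := if e <= `|x - m| then (x - m)^-1 else 0.
Definition cut_out (m e x : R) : R := if e <= `|x - m| then 0 else 1.

Lemma measurable_dist (m : R) : measurable_fun setT ((fun x => `|x - m|) : mR -> mR).
Proof.
by apply: measurableT_comp => //; apply: measurable_funB.
Qed.

Lemma measurable_inv_sub (m : R) : measurable_fun setT ((fun x => (x - m)^-1) : mR -> mR).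
Proof.
have mm : measurable [set m : mR] by exact: measurable_set1.
have -> : [set: mR] = ~` [set m] `|` [set m] by rewrite setvU.
apply/measurable_funU => //; first exact: measurableC.
split; last first.
  move=> _ Y mY; have [Y0|Y0] := pselect (Y (m - m)^-1).
    rewrite (_ : _ `&` _ = [set m])//.
    by apply/seteqP; split => [x []//|x /= ->]; split.
  rewrite (_ : _ `&` _ = set0)//.
  by apply/seteqP; split => // x [/= ->].
apply: open_continuous_measurable_fun.
  apply: closed_openC; apply: accessible_closed_set1; apply: hausdorff_accessible.
  exact: Rhausdorff.
by move=> x; rewrite inE /= => /eqP xm; exact: continuous_inv_sub.
Qed.

Lemma measurable_cut_inv m e : measurable_fun setT (cut_inv m e : mR -> mR).
Proof.
apply: measurable_fun_ifT => //.
- by apply: measurable_fun_ler => //; exact: measurable_dist.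
- exact: measurable_inv_sub.
Qed.

Lemma measurable_cut_out m e : measurable_fun setT (cut_out m e : mR -> mR).
Proof.
apply: measurable_fun_ifT => //.
by apply: measurable_fun_ler => //; exact: measurable_dist.
Qed.

Lemma cut_inv_bound m e x : 0 < e -> `|cut_inv m e x| <= e^-1.
Proof.
rewrite /cut_inv => e0; case: ifPn => [h|_]; last by rewrite normr0 invr_ge0 ltW.
by rewrite normfV lef_pV2// posrE// (lt_le_trans e0).
Qed.

Lemma cut_out_bound m e x : `|cut_out m e x| <= 1.
Proof. by rewrite /cut_out; case: ifPn; rewrite ?normr0 ?normr1. Qed.

(** Functions of $H_0$ as operators; the value is arbitrary when the
    multiplier does not preserve square integrability. *)
Definition mulop (m : R -> R) f : L2R3 R := xget 0 [set g | is_mul Fr m f g].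

Lemma mulopP (m : R -> R) f (b : R) : measurable_fun setT (m : mR -> mR) ->
  (forall x, `|m x| <= b) -> is_mul Fr m f (mulop m f).
Proof.
move=> mm mb; rewrite /mulop; case: xgetP => [g -> //|nog].
by have [g /nog] := is_mul_exists hFr f mm mb.
Qed.

Lemma mul_local_norm (m : R -> R) u c g (mu e B : R) : 0 < e -> 0 <= B ->
  measurable_fun setT (m : mR -> mR) ->
  curve_continuous c -> represents Fr u c -> is_mul Fr m u g ->
  (forall x, e <= `|x - mu| -> m x = 0) ->
  (forall x, 0 <= x -> `|x - mu| < e -> m x ^+ 2 * normL2 (c x) ^+ 2 <= B) ->
  normL2 g ^+ 2 <= 2 * e * B.
Proof.
move=> e0 B0 mm cc uc ug m0 mB.
rewrite -lee_fin (mul_norm hFr mm cc uc ug).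
pose S : set mR := `]mu - e, mu + e[%classic.
have mS : measurable S by exact: measurable_itv.
have mhl : measurable hl by exact: measurable_itv.
have SE x : S x <-> `|x - mu| < e.
  by rewrite /S /= in_itv/= -ltr_distlC distrC.
apply: (@le_trans _ _ (\int[leb]_(x in hl) (B%:E * (\1_S x)%:E))%E).
  apply: ge0_le_integral => //.
  - by move=> x _; rewrite lee_fin mulr_ge0 ?sqr_ge0.
  - apply/measurable_EFinP; apply: measurable_funM.
      by apply: measurable_funTS; exact: measurable_funX.
    have [mr _] := curve_inner_measurable cc cc.
    by rewrite (_ : (fun x => _) = (fun x => complex.Re (innerL2 (c x) (c x))))//;
      apply/funext => x; rewrite normL2_sqr.
  - by apply/measurable_EFinP; apply: measurable_funM => //; exact: measurable_funTS.
  - move=> x; rewrite /= in_itv/= andbT => x0; rewrite -EFinM lee_fin indicE.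
    have [xS|xS] := boolP (x \in S); first by rewrite mulr1 mB//; apply/SE; rewrite -inE.
    rewrite mulr0 m0 ?expr0n ?mul0r//= leNgt; apply/negP => /SE.
    by rewrite -in_setE (negbTE xS).
rewrite ge0_integralZl//; last first.
  by apply/measurable_EFinP; exact: measurable_funTS.
rewrite integral_indic// mulrC EFinM lee_wpmul2l ?lee_fin//.
rewrite (@le_trans _ _ (leb S))//.
  by apply: le_measure; rewrite ?inE//; exact: measurableI.
rewrite /S lebesgue_measure_itv/= lte_fin.
case: ifPn => _; rewrite ?lee_fin; lra.
Qed.

Lemma integral_invsq_annulus (m e b : R) : 0 < e -> e < b ->
  (\int[leb]_(x in hl) (if (e <= `|x - m|) && (`|x - m| <= b) then (x - m) ^- 2 else 0)%:E
    <= (2 / e)%:E)%E.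
Proof.
move=> e0 eb.
pose A : set mR := `[m + e, m + b]%classic.
pose B : set mR := `[m - b, m - e]%classic.
have mA : measurable A by exact: measurable_itv.
have mB : measurable B by exact: measurable_itv.
have mhl : measurable hl by exact: measurable_itv.
pose F (x : mR) := if (e <= `|x - m|) && (`|x - m| <= b) then (x - m) ^- 2 else 0.
have mF : measurable_fun setT F.
  apply: measurable_fun_ifT => //.
  - apply: measurable_and.
      by apply: measurable_fun_ler => //; exact: measurable_dist.
    by apply: measurable_fun_ler => //; exact: measurable_dist.
  - rewrite (_ : (fun x => _) = (fun x => ((x - m)^-1) ^+ 2)); last first.
      by apply/funext => x; rewrite exprVn.
    by apply: measurable_funX; exact: measurable_inv_sub.
have F0 x : 0 <= F x by rewrite /F; case: ifP => // _; rewrite invr_ge0 sqr_ge0.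
apply: (@le_trans _ _ (\int[leb]_(x in A `|` B) (F x)%:E)%E).
  have mFE : measurable_fun setT (EFin \o F) by exact/measurable_EFinP.
  have mAB : measurable (A `|` B) by exact: measurableU.
  apply: (@le_trans _ _ (\int[leb]_x (F x)%:E)%E).
    by apply: ge0_subset_integral => // x _; rewrite lee_fin F0.
  rewrite -(setUv (A `|` B)) ge0_integral_setU//=; last 4 first.
  - exact: measurableC.
  - by rewrite setUv.
  - by move=> x _; rewrite lee_fin F0.
  - exact/disj_setPCl.
  rewrite [X in (_ + X)%E]integral0_eq ?adde0// => x nAB.
  rewrite /F; case: ifP => // /andP[h1 h2]; exfalso; apply: nAB.
  rewrite /A /B; move: h1 h2; have [x0|x0] := leP 0 (x - m).
    by rewrite ger0_norm// => *; left; rewrite /= in_itv/=; apply/andP; split; lra.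
  by rewrite ltr0_norm// => *; right; rewrite /= in_itv/=; apply/andP; split; lra.
rewrite ge0_integral_setU//=; last 3 first.
- by apply/measurable_EFinP; exact: measurable_funTS.
- by move=> x _; rewrite lee_fin F0.
- by apply/disj_setPS => x []; rewrite /A /B /= !in_itv/= => /andP[? ?] /andP[? ?]; lra.
have eA : (\int[leb]_(x in A) (F x)%:E = (e^-1 - b^-1)%:E)%E.
  rewrite -(integral_invsq_right m e0 eb); apply: eq_integral => x.
  rewrite inE /A /= in_itv/= => /andP[h1 h2]; rewrite /F ger0_norm; last lra.
  by rewrite ifT//; apply/andP; split; lra.
have eB : (\int[leb]_(x in B) (F x)%:E = (e^-1 - b^-1)%:E)%E.
  rewrite -(integral_invsq_left m e0 eb); apply: eq_integral => x.
  rewrite inE /B /= in_itv/= => /andP[h1 h2]; rewrite /F ler0_norm; last lra.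
  by rewrite ifT//; apply/andP; split; lra.
rewrite eA eB -EFinD lee_fin; have : 0 < b^-1 by rewrite invr_gt0 (lt_trans e0).
have -> : 2 / e = e^-1 + e^-1 by field; rewrite gt_eqF.
by move=> ?; lra.
Qed.

End truncation.

Section local_estimates.
Variable R : realType.
Local Notation leb := (@lebesgue_measure R).
Local Notation mR := (measurableTypeR R).
Local Notation hl := (`[0%R, +oo[%classic : set mR).
Variable Fr : L2R3 R -> L2R3 R.
Hypothesis hFr : is_fourier Fr.

(** The size and the modulus of continuity, near a zero of order [n], of a
    curve of fibres. *)
Definition vanishing_bounds (c : R -> L2S2 R) (s : R) (n : nat) (rho K : R) :=
  (forall x, `|x - s| < rho -> normL2 (c x) <= K * `|x - s| ^+ n) /\
  (forall x y, `|x - s| < rho -> `|y - s| < rho ->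
     normL2 (c x - c y) <= K * `|x - y|).

Variables (s : R) (n : nat) (rho K : R).
Hypotheses (rho0 : 0 < rho) (rho1 : rho <= 1) (rhos : rho <= s) (K0 : 0 <= K).
Hypothesis n1 : (1 <= n)%N.

Section one_vector.
Variables (u : L2R3 R) (c : R -> L2S2 R).
Hypotheses (cc : curve_continuous c) (uc : represents Fr u c).
Hypothesis cb : vanishing_bounds c s n rho K.

Lemma vanishing_sqr x : `|x - s| < rho ->
  normL2 (c x) ^+ 2 <= K ^+ 2 * (`|x - s| ^+ n) ^+ 2.
Proof.
move=> xs; rewrite -exprMn ler_sqr ?nnegrE ?normL2_ge0 ?mulr_ge0 ?exprn_ge0//.
exact: cb.1.
Qed.

Lemma vanishing_div_sqr x : `|x - s| < rho ->
  ((x - s)^-1) ^+ 2 * normL2 (c x) ^+ 2 <= K ^+ 2.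
Proof.
move=> xs; have [x0|x0] := eqVneq (x - s) 0.
  by rewrite x0 invr0 expr0n mul0r sqr_ge0.
rewrite exprVn mulrC ler_pdivrMr ?exprn_even_gt0//.
rewrite (le_trans (vanishing_sqr xs))// ler_wpM2l ?sqr_ge0//.
rewrite -[(x - s) ^+ 2]real_normK ?num_real// ler_sqr ?nnegrE ?exprn_ge0//.
rewrite -[leRHS]expr1; apply: ler_wiXn2l => //.
by rewrite (le_trans (ltW xs)).
Qed.

Lemma cut_out_norm (m e : R) g : 0 < e -> `|m - s| + e < rho ->
  is_mul Fr (cut_out m e) u g ->
  normL2 g ^+ 2 <= 2 * e * (K ^+ 2 * ((`|m - s| + e) ^+ n) ^+ 2).
Proof.
move=> e0 me ug; apply: (@mul_local_norm _ Fr hFr (cut_out m e) u c g m e) => //.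
- by rewrite mulr_ge0 ?sqr_ge0.
- exact: measurable_cut_out.
- by move=> x xe; rewrite /cut_out xe.
move=> x x0 xe; rewrite /cut_out (lt_geF xe) expr1n mul1r.
have xs : `|x - s| <= `|m - s| + e.
  by have := ler_distD m x s; lra.
rewrite (le_trans (vanishing_sqr (le_lt_trans xs me)))// ler_wpM2l ?sqr_ge0//.
rewrite ler_sqr ?nnegrE ?exprn_ge0 ?addr_ge0 ?(ltW e0)//.
by apply: lerXn2r => //; rewrite nnegrE addr_ge0 ?(ltW e0).
Qed.

Lemma cut_out_phi_norm (m e : R) g : 0 < e -> `|m - s| + e < rho ->
  is_mul Fr (fun x => cut_out m e x * (x - s)^-1) u g ->
  normL2 g ^+ 2 <= 2 * e * K ^+ 2.
Proof.
move=> e0 me ug.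
apply: (@mul_local_norm _ Fr hFr (fun x => cut_out m e x * (x - s)^-1) u c g m e) => //.
- by rewrite sqr_ge0.
- by apply: measurable_funM; [exact: measurable_cut_out|exact: measurable_inv_sub].
- by move=> x xe; rewrite /cut_out xe mul0r.
move=> x x0 xe; rewrite /cut_out (lt_geF xe) mul1r.
have xs : `|x - s| <= `|m - s| + e.
  by have := ler_distD m x s; lra.
exact: vanishing_div_sqr (le_lt_trans xs me).
Qed.

(** The truncated resolvent vector approaches the limiting one. Within
    distance $2|m-s|$ of [m] both terms are bounded separately, farther away
    the resolvent identity supplies a factor $|m-s|/|x-m|$. *)
Lemma cut_inv_phi_norm (m e t : R) phi g :
  0 < e -> e < `|m - s| -> 2 * `|m - s| < t -> t + `|m - s| < rho ->
  is_mul Fr (fun x => (x - s)^-1) u phi ->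
  is_mul Fr (fun x => cut_inv m e x - (x - s)^-1) u g ->
  normL2 g ^+ 2 <= 4 * K ^+ 2 * ((3 * `|m - s|) ^+ n) ^+ 2 / e + 4 * K ^+ 2 * t +
    (`|m - s| / t) ^+ 2 * normL2 phi ^+ 2.
Proof.
set r := `|m - s| => e0 er rt trho uphi ug.
have r0 : 0 < r by exact: lt_trans er.
have t0 : 0 < t by lra.
have mhl : measurable hl by exact: measurable_itv.
have mi := measurable_inv_sub s.
have mm : measurable_fun setT ((fun x => cut_inv m e x - (x - s)^-1) : mR -> mR).
  by apply: measurable_funB => //; exact: measurable_cut_inv.
have mcS : measurable_fun hl ((fun x => normL2 (c x) ^+ 2) : mR -> R).
  have [mr _] := curve_inner_measurable cc cc.
  by rewrite (_ : (fun x => _) = (fun x => complex.Re (innerL2 (c x) (c x))))//;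
    apply/funext => x; rewrite normL2_sqr.
pose a := 2 * K ^+ 2 * ((3 * r) ^+ n) ^+ 2.
have a0 : 0 <= a by apply: mulr_ge0; rewrite ?sqr_ge0 ?mulr_ge0 ?sqr_ge0.
pose F1 (x : mR) : R := if (e <= `|x - m|) && (`|x - m| <= 2 * r) then (x - m) ^- 2 else 0.
pose S : set mR := `]m - t, m + t[%classic.
have mS : measurable S by exact: measurable_itv.
have SE x : S x <-> `|x - m| < t by rewrite /S /= in_itv/= -ltr_distlC distrC.
pose F3 (x : mR) : R := ((x - s)^-1) ^+ 2 * normL2 (c x) ^+ 2.
have F10 x : 0 <= F1 x by rewrite /F1; case: ifP => // _; rewrite invr_ge0 sqr_ge0.
have F30 x : 0 <= F3 x by rewrite mulr_ge0 ?sqr_ge0.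
have mF1 : measurable_fun setT F1.
  apply: measurable_fun_ifT => //.
  - apply: measurable_and.
      by apply: measurable_fun_ler => //; exact: measurable_dist.
    by apply: measurable_fun_ler => //; exact: measurable_dist.
  - rewrite (_ : (fun x => _) = (fun x => ((x - m)^-1) ^+ 2)); last first.
      by apply/funext => x; rewrite exprVn.
    by apply: measurable_funX; exact: measurable_inv_sub.
have mF3 : measurable_fun hl F3.
  by apply: measurable_funM => //; apply: measurable_funTS; exact: measurable_funX.
have K20 : 0 <= 2 * K ^+ 2 by rewrite mulr_ge0// sqr_ge0.
have rt0 : 0 <= (r / t) ^+ 2 by exact: sqr_ge0.
rewrite -lee_fin (mul_norm hFr mm cc uc ug).
apply: (@le_trans _ _ (\int[leb]_(x in hl) (a%:E * (F1 x)%:E +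
   ((2 * K ^+ 2)%:E * (\1_S x)%:E + ((r / t) ^+ 2)%:E * (F3 x)%:E)))%E).
  apply: ge0_le_integral => //.
  - by move=> x _; rewrite lee_fin mulr_ge0 ?sqr_ge0.
  - by apply/measurable_EFinP; apply: measurable_funM => //; apply: measurable_funTS; exact: measurable_funX.
  - apply: emeasurable_funD; last apply: emeasurable_funD.
    + by apply: emeasurable_funM => //; apply/measurable_EFinP => //; exact: measurable_funTS.
    + by apply: emeasurable_funM => //; apply/measurable_EFinP => //; exact: measurable_funTS.
    + by apply: emeasurable_funM => //; apply/measurable_EFinP.
  move=> x; rewrite /= in_itv/= andbT => x0.
  rewrite -!EFinM -!EFinD lee_fin.
  have [x2r|x2r] := leP `|x - m| (2 * r).
    have xs3 : `|x - s| <= 3 * r.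
      by have := ler_distD m x s; rewrite -/r; lra.
    have xsr : `|x - s| < rho by apply: le_lt_trans xs3 _; lra.
    have xS : S x by apply/SE; lra.
    rewrite indicE mem_set// mulr1.
    have h1 := vanishing_div_sqr xsr.
    have h2 : cut_inv m e x ^+ 2 * normL2 (c x) ^+ 2 <= K ^+ 2 * ((3 * r) ^+ n) ^+ 2 * F1 x.
      rewrite /cut_inv /F1 x2r andbT; case: ifPn => xe; last by rewrite expr0n mul0r mulr0.
      rewrite exprVn mulrC ler_wpM2r ?invr_ge0 ?sqr_ge0//.
      rewrite (le_trans (vanishing_sqr xsr))// ler_wpM2l ?sqr_ge0//.
      rewrite ler_sqr ?nnegrE ?exprn_ge0 ?mulr_ge0 ?(ltW r0)//.
      by apply: lerXn2r => //; rewrite nnegrE mulr_ge0// ltW.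
    have h3 : (cut_inv m e x - (x - s)^-1) ^+ 2 <= 2 * cut_inv m e x ^+ 2 + 2 * (x - s)^-1 ^+ 2.
      by have := sqr_ge0 (cut_inv m e x + (x - s)^-1); rewrite !expr2; lra.
    have h4 := ler_wpM2r (sqr_ge0 (normL2 (c x))) h3.
    rewrite mulrDl -!(mulrA 2) in h4.
    have h5 : 0 <= (r / t) ^+ 2 * F3 x by rewrite mulr_ge0.
    rewrite /a; have -> : 2 * K ^+ 2 * ((3 * r) ^+ n) ^+ 2 * F1 x =
      2 * (K ^+ 2 * ((3 * r) ^+ n) ^+ 2 * F1 x) by ring.
    by lra.
  have xm0 : x - m != 0 by rewrite -normr_gt0; lra.
  have cE : cut_inv m e x = (x - m)^-1 by rewrite /cut_inv ifT//; lra.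
  have aF1 : 0 <= a * F1 x by rewrite mulr_ge0.
  have [xs0|xs0] := eqVneq x s.
    have -> : normL2 (c x) = 0.
      apply/eqP; rewrite eq_le normL2_ge0 andbT xs0.
      by have := cb.1 s; rewrite subrr normr0 expr0n (gtn_eqF n1) mulr0; apply.
    rewrite expr0n mulr0 !addr_ge0//; last by rewrite mulr_ge0.
    by rewrite mulr_ge0// indicE ler0n.
  have xs1 : x - s != 0 by rewrite subr_eq0.
  have E : (cut_inv m e x - (x - s)^-1) ^+ 2 * normL2 (c x) ^+ 2 =
      (r / `|x - m|) ^+ 2 * F3 x.
    rewrite cE /F3 [RHS]mulrA; congr (_ * _).
    have -> : (r / `|x - m|) ^+ 2 = ((m - s) / (x - m)) ^+ 2.
      by rewrite !expr_div_n /r !real_normK ?num_real.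
    rewrite -exprMn; congr (_ ^+ 2).
    by field; rewrite xs1 xm0.
  rewrite E.
  have [xt|xt] := ltP `|x - m| t.
    have xsr : `|x - s| < rho.
      by have := ler_distD m x s; rewrite -/r; lra.
    have xS : S x by apply/SE.
    rewrite indicE mem_set// mulr1.
    have h1 : F3 x <= K ^+ 2 := vanishing_div_sqr xsr.
    have h2 : (r / `|x - m|) ^+ 2 <= 1.
      rewrite -(expr1n _ 2) ler_sqr ?nnegrE ?divr_ge0 ?(ltW r0)//.
      by rewrite ler_pdivrMr ?normr_gt0// mul1r; lra.
    have h3 : (r / `|x - m|) ^+ 2 * F3 x <= 1 * K ^+ 2 by apply: ler_pM => //; rewrite sqr_ge0.
    have h5 : 0 <= (r / t) ^+ 2 * F3 x by rewrite mulr_ge0.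
    have := sqr_ge0 K; lra.
  have h1 : (r / `|x - m|) ^+ 2 <= (r / t) ^+ 2.
    rewrite ler_sqr ?nnegrE ?divr_ge0 ?(ltW r0) ?(ltW t0)//.
    by rewrite ler_wpM2l ?(ltW r0)// lef_pV2 ?posrE// (lt_le_trans t0).
  have h2 := ler_wpM2r (F30 x) h1.
  have h3 : 0 <= 2 * K ^+ 2 * \1_S x by rewrite mulr_ge0// indicE ler0n.
  by lra.
have mF1E : measurable_fun hl (EFin \o F1) by apply/measurable_EFinP; exact: measurable_funTS.
have m1SE : measurable_fun hl (fun x : mR => (\1_S x)%:E : \bar R).
  by apply/measurable_EFinP; exact: measurable_funTS.
have mF3E : measurable_fun hl (EFin \o F3) by apply/measurable_EFinP.
rewrite ge0_integralD//; last 4 first.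
- by move=> x _; rewrite -EFinM lee_fin mulr_ge0.
- by apply: emeasurable_funM.
- by move=> x _; rewrite -!EFinM -EFinD lee_fin addr_ge0// mulr_ge0// indicE ler0n.
- by apply: emeasurable_funD; apply: emeasurable_funM.
rewrite ge0_integralD//; last 4 first.
- by move=> x _; rewrite -EFinM lee_fin mulr_ge0// indicE ler0n.
- by apply: emeasurable_funM.
- by move=> x _; rewrite -EFinM lee_fin mulr_ge0.
- by apply: emeasurable_funM.
rewrite !ge0_integralZl//; last 2 first.
- by move=> x _; rewrite lee_fin.
- by move=> x _; rewrite lee_fin.
have r2r : r < 2 * r by lra.
have I1 := integral_invsq_annulus m e0 (lt_trans er r2r).
have I3 : (\int[leb]_(x in hl) (F3 x)%:E = (normL2 phi ^+ 2)%:E)%E.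
  by rewrite (mul_norm hFr mi cc uc uphi).
rewrite I3 integral_indic//.
have I2 : (leb (S `&` hl) <= (2 * t)%:E)%E.
  rewrite (@le_trans _ _ (leb S))//.
    by apply: le_measure; rewrite ?inE//; exact: measurableI.
  by rewrite /S lebesgue_measure_itv/= lte_fin; case: ifPn => _; rewrite ?lee_fin; lra.
have -> : (4 * K ^+ 2 * ((3 * r) ^+ n) ^+ 2 / e + 4 * K ^+ 2 * t + (r / t) ^+ 2 * normL2 phi ^+ 2)%:E =
  (a%:E * (2 / e)%:E + ((2 * K ^+ 2)%:E * (2 * t)%:E + ((r / t) ^+ 2)%:E * (normL2 phi ^+ 2)%:E))%E.
  rewrite -!EFinM -!EFinD /a; congr (_%:E).
  have -> : 4 * K ^+ 2 * ((3 * r) ^+ n) ^+ 2 / e = 2 * K ^+ 2 * ((3 * r) ^+ n) ^+ 2 * (2 / e).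
    by field; rewrite gt_eqF.
  by ring.
rewrite leeD//; first by rewrite lee_wpmul2l// lee_fin.
by rewrite leeD2r// lee_wpmul2l// lee_fin.
Qed.

End one_vector.

End local_estimates.

Section pair_estimates.
Variable R : realType.
Local Notation leb := (@lebesgue_measure R).
Local Notation mR := (measurableTypeR R).
Local Notation hl := (`[0%R, +oo[%classic : set mR).
Variable Fr : L2R3 R -> L2R3 R.
Hypothesis hFr : is_fourier Fr.

Lemma is_mul_scale (a : R) (m : R -> R) f g : is_mul Fr m f g ->
  is_mul Fr (fun x => a * m x) f (a%:C *: g).
Proof.
rewrite /is_mul (fourierZ hFr).
by apply: ae_imply2 (L2_scaleE a%:C (Fr g)) => x -> ->; rewrite rmorphM/= mulrA.
Qed.

Lemma pv_cut_integral (F : mR -> R) (m e : R) : 0 < e ->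
  leb.-integrable hl (EFin \o (fun x => cut_inv m e x * F x)) ->
  leb.-integrable (pv_cut m e) (EFin \o (fun x => (if 0 <= x then F x else 0) / (x - m))) /\
  \int[leb]_(x in pv_cut m e) ((if 0 <= x then F x else 0) / (x - m)) =
  \int[leb]_(x in hl) (cut_inv m e x * F x).
Proof.
move=> e0 iF.
have mhl : measurable hl by exact: measurable_itv.
have E : (fun x => (if 0 <= x then F x else 0) / (x - m)) \_ (pv_cut m e) =
    (fun x => cut_inv m e x * F x) \_ hl.
  apply/funext => x; rewrite !patchE.
  have -> : (x \in pv_cut m e) = (e <= `|x - m|).
    by apply/idP/idP => [/set_mem/pv_cutE|/pv_cutE/mem_set].
  have -> : (x \in hl) = (0 <= x) by rewrite mem_setE in_itv/= andbT.
  by rewrite /cut_inv; case: ifPn => xe; case: ifPn => x0; rewrite ?mul0r// mulrC.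
split.
  apply/(integrable_mkcond _ (measurable_pv_cut m e)).
  move/(integrable_mkcond _ mhl) : iF.
  by rewrite !restrict_EFin E.
by rewrite Rintegral_mkcond E -Rintegral_mkcond.
Qed.

Variables (s : R) (n : nat) (rho K : R).
Hypotheses (rho0 : 0 < rho) (rho1 : rho <= 1) (rhos : rho <= s) (K0 : 0 <= K).
Hypothesis n1 : (1 <= n)%N.
Variables (u w : L2R3 R) (U W : nat -> R -> L2S2 R).
Hypotheses (cU : curve_continuous (U 0%N)) (cW : curve_continuous (W 0%N)).
Hypotheses (uU : represents Fr u (U 0%N)) (wW : represents Fr w (W 0%N)).
Hypothesis bU : vanishing_bounds (U 0%N) s n rho K.
Hypothesis bW : vanishing_bounds (W 0%N) s n rho K.

Local Notation eta x := (innerL2 (U 0%N x) (W 0%N x)).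

Lemma vanishing_le (c : R -> L2S2 R) x : vanishing_bounds c s n rho K ->
  `|x - s| < rho -> normL2 (c x) <= K * `|x - s|.
Proof.
move=> bc xs; rewrite (le_trans (bc.1 x xs))// ler_wpM2l//.
by rewrite -[leRHS]expr1; apply: ler_wiXn2l => //; rewrite (le_trans (ltW xs)).
Qed.

Lemma pairing_lipschitz (m e x : R) : 0 < e -> `|m - s| + e < rho -> `|x - m| <= e ->
  Normc.normc (eta x - eta m) <= 2 * K ^+ 2 * (`|m - s| + e) * `|x - m|.
Proof.
move=> e0 me xe.
have ms : `|m - s| < rho by lra.
have xs' : `|x - s| <= `|m - s| + e by have := ler_distD m x s; lra.
have xs : `|x - s| < rho by lra.
have -> : eta x - eta m = innerL2 (U 0%N x - U 0%N m) (W 0%N x) +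
    innerL2 (U 0%N m) (W 0%N x - W 0%N m) by rewrite innerBl innerBr; ring.
rewrite (le_trans (le_normcD _ _))//.
have h1 := inner_CauchySchwarz (U 0%N x - U 0%N m) (W 0%N x).
have h2 := inner_CauchySchwarz (U 0%N m) (W 0%N x - W 0%N m).
have h3 : normL2 (U 0%N x - U 0%N m) * normL2 (W 0%N x) <=
    (K * `|x - m|) * (K * (`|m - s| + e)).
  apply: ler_pM; rewrite ?normL2_ge0//; first exact: bU.2.
  by rewrite (le_trans (vanishing_le bW xs))// ler_wpM2l.
have h4 : normL2 (U 0%N m) * normL2 (W 0%N x - W 0%N m) <=
    (K * (`|m - s| + e)) * (K * `|x - m|).
  apply: ler_pM; rewrite ?normL2_ge0//; last exact: bW.2.
  by rewrite (le_trans (vanishing_le bU ms))// ler_wpM2l//; lra.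
have -> : 2 * K ^+ 2 * (`|m - s| + e) * `|x - m| = (K * `|x - m|) * (K * (`|m - s| + e)) +
   (K * (`|m - s| + e)) * (K * `|x - m|) by ring.
by lra.
Qed.

Lemma normc_le_ReIm (z : R[i]) :
  Normc.normc z <= `|complex.Re z| + `|complex.Im z|.
Proof.
rewrite -ler_sqr ?nnegrE ?normc_ge0 ?addr_ge0// normc_sqr sqrrD !real_normK ?num_real//.
by have := mulr_ge0 (normr_ge0 (complex.Re z)) (normr_ge0 (complex.Im z)); lra.
Qed.

Lemma normc_Im (z : R[i]) : `|complex.Im z| <= Normc.normc z.
Proof. by case: z => a b /=; rewrite -sqrtr_sqr ler_wsqrtr// lerDr sqr_ge0. Qed.

(** The principal value differs little from the form of the truncated
    resolvent. *)
Lemma pv_gamma_cut (m e : R) th : 0 < e -> `|m - s| + e < rho ->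
  is_mul Fr (cut_inv m e) u th ->
  Normc.normc (pv_gamma (spec_pairing U W) m - innerL2 th w) <=
    8 * K ^+ 2 * (`|m - s| + e) * e.
Proof.
move=> e0 me uth.
have sm : s - m < rho.
  by apply: le_lt_trans (ler_norm _) _; rewrite distrC; apply: lt_trans me; rewrite ltrDl.
have m0 : 0 < m.
  by rewrite -[ltLHS](subrr s) ltrBlDl -ltrBlDr; exact: lt_le_trans sm rhos.
have L0 : 0 <= 2 * K ^+ 2 * (`|m - s| + e) by rewrite !mulr_ge0 ?sqr_ge0 ?addr_ge0 ?(ltW e0).
have Icut e' : 0 < e' -> exists th', is_mul Fr (cut_inv m e') u th'.
  move=> e'0; exists (mulop Fr (cut_inv m e') u).
  apply: (mulopP hFr); first exact: measurable_cut_inv.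
  by move=> x; exact: cut_inv_bound.
have key e' th' : 0 < e' -> is_mul Fr (cut_inv m e') u th' ->
    cintegrable leb hl (fun l => (cut_inv m e' l)%:C * eta l) /\
    innerL2 th' w = cintegral leb hl (fun l => (cut_inv m e' l)%:C * eta l).
  move=> e'0 uth'.
  have mc : measurable_fun setT ((fun=> 1) : mR -> mR) by exact: measurable_cst.
  have [] := mul_inner hFr (measurable_cut_inv m e') mc cU cW uU wW uth' (is_mul1 Fr w).
  have -> : (fun l => (cut_inv m e' l * 1)%:C * eta l) = (fun l => (cut_inv m e' l)%:C * eta l).
    by apply/funext => l; rewrite mulr1.
  by split.
have part (p : R[i] -> R) (f : mR -> R) :
    (forall x, f x = if 0 <= x then p (eta x) else 0) ->
    (forall z z', `|p z - p z'| <= Normc.normc (z - z')) ->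
    (forall (a : R) z, p (a%:C * z) = a * p z) ->
    (forall e', 0 < e' -> leb.-integrable hl (EFin \o (fun l => p ((cut_inv m e' l)%:C * eta l)))) ->
    `|pv_gammaR f m - \int[leb]_(x in hl) p ((cut_inv m e x)%:C * eta x)| <=
    2 * (2 * K ^+ 2 * (`|m - s| + e)) * e.
  move=> fE pz pM pi.
  have pi' e' : 0 < e' -> leb.-integrable hl (EFin \o (fun l => cut_inv m e' l * p (eta l))).
    move=> /pi; rewrite (_ : (fun l => p ((cut_inv m e' l)%:C * eta l)) = (fun l => cut_inv m e' l * p (eta l)))//.
    by apply/funext => l; rewrite pM.
  have -> : f = (fun x : mR => if 0 <= x then p (eta x) else 0) by apply/funext.
  have -> : \int[leb]_(x in hl) p ((cut_inv m e x)%:C * eta x) =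
      \int[leb]_(x in pv_cut m e) ((if 0 <= x then p (eta x) else 0) / (x - m)).
    rewrite (pv_cut_integral e0 (pi' e e0)).2.
    by apply: eq_Rintegral => x _; rewrite pM.
  apply: (@pv_error _ (fun x : mR => if 0 <= x then p (eta x) else 0) m e) => //.
    by move=> e' e'0; exact: (pv_cut_integral e'0 (pi' e' e'0)).1.
  move=> x xe.
  have x0 : 0 <= x.
    have h1 : m - x <= e by rewrite (le_trans _ xe)// distrC ler_norm.
    have h2 : s - m + e < rho by rewrite (le_lt_trans _ me)// lerD2r distrC ler_norm.
    have h3 : 0 <= s - rho by rewrite subr_ge0.
    by lra.
  by rewrite x0 (ltW m0) (le_trans (pz _ _))// pairing_lipschitz.
have [ic ->] := key e th e0 uth.
have pR : `|pv_gammaR (fun x => complex.Re (spec_pairing U W x)) m -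
    \int[leb]_(x in hl) complex.Re ((cut_inv m e x)%:C * eta x)| <=
    2 * (2 * K ^+ 2 * (`|m - s| + e)) * e.
  apply: (part (@complex.Re R)).
  - by move=> x; rewrite /spec_pairing; case: ifP.
  - by move=> z z'; rewrite -ReN -ReD normc_Re.
  - by move=> a z; rewrite ReM/= mul0r subr0.
  - move=> e' e'0; have [th' uth'] := Icut e' e'0.
    by have [[]] := key e' th' e'0 uth'.
have pI : `|pv_gammaR (fun x => complex.Im (spec_pairing U W x)) m -
    \int[leb]_(x in hl) complex.Im ((cut_inv m e x)%:C * eta x)| <=
    2 * (2 * K ^+ 2 * (`|m - s| + e)) * e.
  apply: (part (@complex.Im R)).
  - by move=> x; rewrite /spec_pairing; case: ifP.
  - by move=> z z'; rewrite -ImN -ImD normc_Im.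
  - by move=> a z; rewrite ImM/= mul0r addr0.
  - move=> e' e'0; have [th' uth'] := Icut e' e'0.
    by have [[]] := key e' th' e'0 uth'.
rewrite (le_trans (normc_le_ReIm _))// ReD ReN ImD ImN.
move: pR pI => /=; set A := pv_gammaR _ _; set B := pv_gammaR _ _ => pR pI.
by move: pR pI; rewrite /cintegral/=; lra.
Qed.

Variables (phiu phiw : L2R3 R).
Hypothesis uphi : is_mul Fr (fun x => (x - s)^-1) u phiu.
Hypothesis wphi : is_mul Fr (fun x => (x - s)^-1) w phiw.

(** First-order expansion at the zero, by the resolvent identity. *)
Lemma cut_inv_expansion (m e : R) th : 0 < e -> `|m - s| + e < rho ->
  is_mul Fr (cut_inv m e) u th ->
  Normc.normc (innerL2 th w - innerL2 phiu w - (m - s)%:C * innerL2 th phiw) <=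
    2 * K ^+ 2 * (`|m - s| + e) * e.
Proof.
move=> e0 me uth.
have mo := measurable_cut_out m e.
pose b := mulop Fr (cut_out m e) phiu.
have phib : is_mul Fr (cut_out m e) phiu b.
  by apply: (mulopP hFr) => // x; exact: cut_out_bound.
have ub : is_mul Fr (fun x => cut_out m e x * (x - s)^-1) u b.
  exact: is_mul_comp uphi phib.
pose bw := mulop Fr (cut_out m e) w.
have wb : is_mul Fr (cut_out m e) w bw.
  by apply: (mulopP hFr) => // x; exact: cut_out_bound.
have E1 : innerL2 b w = innerL2 b bw.
  apply: (@is_mul_inner _ Fr hFr _ _ _ _ _ _ _ _ _ _ s ub (is_mul1 Fr w) ub wb).
  by move=> x _ _; rewrite /cut_out; case: ifP; rewrite ?(mul0r, mulr0, mulr1, mul1r).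
have ug := is_mul_subm hFr uth (is_mul_subm hFr uphi ub).
have uth' := is_mul_scale (m - s) uth.
have E2 : innerL2 (th - (phiu - b)) w = innerL2 ((m - s)%:C *: th) phiw.
  apply: (@is_mul_inner _ Fr hFr _ _ _ _ _ _ _ _ _ _ s ug (is_mul1 Fr w) uth' wphi).
  move=> x _ xs; rewrite mulr1 /cut_inv /cut_out.
  have xs0 : x - s != 0 by rewrite subr_eq0.
  case: ifPn => xe; last by rewrite mul1r mulr0 mul0r !subrr.
  have xm : x - m != 0 by rewrite -normr_gt0 (lt_le_trans e0).
  by field; rewrite xs0 xm.
have -> : innerL2 th w - innerL2 phiu w - (m - s)%:C * innerL2 th phiw = - innerL2 b bw.
  by rewrite -innerZl -E2 !innerBl E1; ring.
rewrite normcN (le_trans (inner_CauchySchwarz _ _))//.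
rewrite -ler_sqr ?nnegrE ?mulr_ge0 ?normL2_ge0 ?sqr_ge0 ?addr_ge0 ?(ltW e0)//.
rewrite exprMn.
have h1 := cut_out_phi_norm hFr rho1 K0 n1 cU uU bU e0 me ub.
have h2 := cut_out_norm hFr K0 cW wW bW e0 me wb.
have h3 : ((`|m - s| + e) ^+ n) ^+ 2 <= (`|m - s| + e) ^+ 2.
  have r0 : 0 <= `|m - s| + e by rewrite addr_ge0// ltW.
  rewrite ler_sqr ?nnegrE ?exprn_ge0// -[leRHS]expr1; apply: ler_wiXn2l => //.
  exact: (le_trans (ltW me) rho1).
have h4 := ler_pM (sqr_ge0 _) (sqr_ge0 _) h1 h2.
rewrite (le_trans h4)//.
have -> : (2 * K ^+ 2 * (`|m - s| + e) * e) ^+ 2 = 2 * e * K ^+ 2 * (2 * e * (K ^+ 2 * (`|m - s| + e) ^+ 2)).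
  by ring.
have eK : 0 <= 2 * e * K ^+ 2 by rewrite mulr_ge0 ?sqr_ge0// mulr_ge0// ltW.
rewrite ler_wpM2l//; rewrite ler_wpM2l//; first by rewrite mulr_ge0// ltW.
by rewrite ler_wpM2l ?sqr_ge0.
Qed.

Lemma pv_gamma_expansion (m e : R) th : 0 < e -> `|m - s| + e < rho ->
  is_mul Fr (cut_inv m e) u th ->
  Normc.normc (pv_gamma (spec_pairing U W) m - innerL2 phiu w -
    (m - s)%:C * innerL2 th phiw) <= 10 * K ^+ 2 * (`|m - s| + e) * e.
Proof.
move=> e0 me uth; have h1 := pv_gamma_cut e0 me uth.
have h2 := cut_inv_expansion e0 me uth.
have -> : pv_gamma (spec_pairing U W) m - innerL2 phiu w - (m - s)%:C * innerL2 th phiw =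
  (pv_gamma (spec_pairing U W) m - innerL2 th w) +
  (innerL2 th w - innerL2 phiu w - (m - s)%:C * innerL2 th phiw) by ring.
rewrite (le_trans (le_normcD _ _))//.
have -> : 10 * K ^+ 2 * (`|m - s| + e) * e = 8 * K ^+ 2 * (`|m - s| + e) * e +
  2 * K ^+ 2 * (`|m - s| + e) * e by ring.
exact: lerD.
Qed.

Lemma pv_gamma_zero : pv_gamma (spec_pairing U W) s = innerL2 phiu w.
Proof.
apply/eqP; rewrite -subr_eq0; apply/eqP/Normc.eq0_normc.
apply/eqP; rewrite eq_le normc_ge0 andbT; apply/ler_addgt0Pr => eps eps0.
rewrite add0r.
have K1 : 0 < 10 * K ^+ 2 + 1 by rewrite ltr_wpDl// mulr_ge0// sqr_ge0.
pose e := Num.min (rho / 2) (eps / (10 * K ^+ 2 + 1)).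
have e0 : 0 < e by rewrite lt_min !divr_gt0.
have er : e <= rho / 2 by rewrite ge_min lexx.
have ee : e <= eps / (10 * K ^+ 2 + 1) by rewrite ge_min lexx orbT.
have := @pv_gamma_expansion s e (mulop Fr (cut_inv s e) u) e0.
rewrite subrr normr0 add0r mul0r subr0 => H.
have {}H := H _ (mulopP hFr u (measurable_cut_inv s e) (fun x => cut_inv_bound s x e0)).
apply: (le_trans (H _)); first lra.
move: ee; rewrite ler_pdivlMr// => ee.
have : 10 * K ^+ 2 * e * e <= 10 * K ^+ 2 * e * 1.
  rewrite ler_wpM2l//; first by rewrite mulr_ge0 ?(ltW e0)// mulr_ge0// sqr_ge0.
  by rewrite (le_trans er)// ler_pdivrMr// mul1r (le_trans rho1)// ler1n.
by lra.
Qed.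

End pair_estimates.

(** * Limits of scalars and of vectors *)

Section limits.
Variables (R : realType) (X : Type) (F : set_system X).
Context {FF : ProperFilter F}.
Context d (T : measurableType d) (nu : {measure set T -> \bar R}).
Local Notation L2 := (L2 nu).
Implicit Types (z w : X -> R[i]) (f g : X -> L2) (x y : X -> R).

Definition ctends z (l : R[i]) := Normc.normc (z a - l) @[a --> F] --> 0.
Definition vtends f (h : L2) := normL2 (f a - h) @[a --> F] --> 0.

Lemma cvg0_le x y : (\forall a \near F, 0 <= x a <= y a) ->
  y a @[a --> F] --> 0 -> x a @[a --> F] --> 0.
Proof. by move=> xy y0; apply: (squeeze_cvgr xy) y0; exact: cvg_cst. Qed.

Lemma cvg0_leT x y : (forall a, 0 <= x a <= y a) ->
  y a @[a --> F] --> 0 -> x a @[a --> F] --> 0.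
Proof. by move=> xy; apply: cvg0_le; exact: nearW. Qed.

Lemma cvg0D x y : x a @[a --> F] --> 0 -> y a @[a --> F] --> 0 ->
  (x a + y a) @[a --> F] --> 0.
Proof. by move=> x0 y0; rewrite -[0](addr0 0); exact: cvgD. Qed.

Lemma cvg0Ml x y (l : R) : x a @[a --> F] --> l -> y a @[a --> F] --> 0 ->
  (x a * y a) @[a --> F] --> 0.
Proof. by move=> x0 y0; rewrite -(mulr0 l); exact: cvgM. Qed.

Lemma normc_real (r : R) : Normc.normc (r%:C) = `|r|.
Proof. by rewrite /= expr0n/= addr0 sqrtr_sqr. Qed.

Lemma ctends_cst (l : R[i]) : ctends (fun=> l) l.
Proof. by rewrite /ctends subrr Normc.normc0; exact: cvg_cst. Qed.

Lemma ctends_real x (l : R) : x a @[a --> F] --> l -> ctends (fun a => (x a)%:C) l%:C.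
Proof.
move=> xl; rewrite /ctends.
rewrite (_ : (fun a => _) = (fun a => `|x a - l|)); last first.
  by apply/funext => a; rewrite -rmorphB normc_real.
by rewrite -(normr0 R) -(subrr l); apply: cvg_norm; apply: cvgB => //; exact: cvg_cst.
Qed.

Lemma ctends_norm z l : ctends z l -> Normc.normc (z a) @[a --> F] --> Normc.normc l.
Proof.
move=> zl; apply/subr_cvg0; apply/norm_cvg0P; apply: cvg0_leT zl => a.
have h1 := le_normcD (z a - l) l; have h2 := le_normcD (l - z a) (z a).
rewrite subrK in h1; rewrite subrK -opprB normcN in h2.
by rewrite normr_ge0/= ler_norml; apply/andP; split; lra.
Qed.

Lemma ctendsD z w l k : ctends z l -> ctends w k -> ctends (fun a => z a + w a) (l + k).
Proof.
move=> zl wk; apply: cvg0_leT (cvg0D zl wk) => a; rewrite normc_ge0/=.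
by rewrite opprD addrACA le_normcD.
Qed.

Lemma ctendsM z w l k : ctends z l -> ctends w k -> ctends (fun a => z a * w a) (l * k).
Proof.
move=> zl wk.
have h1 := cvg0Ml (ctends_norm wk) zl.
have h2 : (Normc.normc l * Normc.normc (w a - k)) @[a --> F] --> 0.
  by apply: cvg0Ml wk; exact: cvg_cst.
apply: cvg0_leT (cvg0D h1 h2) => a; rewrite normc_ge0/= -!Normc.normcM.
rewrite (_ : z a * w a - l * k = w a * (z a - l) + l * (w a - k)); last by ring.
exact: le_normcD.
Qed.

Lemma ctendsZ (c : R[i]) z l : ctends z l -> ctends (fun a => c * z a) (c * l).
Proof. by apply: ctendsM; exact: ctends_cst. Qed.

Lemma vtendsD f g h k : vtends f h -> vtends g k -> vtends (fun a => f a + g a) (h + k).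
Proof.
move=> fh gk; apply: cvg0_leT (cvg0D fh gk) => a; rewrite normL2_ge0/=.
by rewrite opprD addrACA ler_normL2D.
Qed.

Lemma vtends_cst h : vtends (fun=> h) h.
Proof. by rewrite /vtends subrr normL20; exact: cvg_cst. Qed.

Lemma vtends_norm f h : vtends f h -> normL2 (f a) @[a --> F] --> normL2 h.
Proof.
move=> fh; apply/subr_cvg0; apply/norm_cvg0P; apply: cvg0_leT fh => a.
by rewrite normr_ge0/= normL2_dist.
Qed.

Lemma vtendsZ z f l h : ctends z l -> vtends f h -> vtends (fun a => z a *: f a) (l *: h).
Proof.
move=> zl fh.
have h1 := cvg0Ml (vtends_norm fh) zl.
have h2 : (Normc.normc l * normL2 (f a - h)) @[a --> F] --> 0.
  by apply: cvg0Ml fh; exact: cvg_cst.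
apply: cvg0_leT (cvg0D h1 h2) => a; rewrite normL2_ge0/= (mulrC (normL2 _)) -!normL2Z.
rewrite (_ : z a *: f a - l *: h = (z a - l) *: f a + l *: (f a - h)).
  exact: ler_normL2D.
by rewrite scalerBl scalerBr addrA subrK.
Qed.

Lemma vtends_sum (I : finType) (f : I -> X -> L2) (h : I -> L2) :
  (forall i, vtends (f i) (h i)) -> vtends (fun a => \sum_i f i a) (\sum_i h i).
Proof.
move=> fh; rewrite (_ : (fun a => _) = \sum_i f i); last first.
  by apply/funext => a; rewrite fct_sumE.
elim/big_ind2 : _ => [|f1 h1 f2 h2 fh1 fh2|i _]; last exact: fh.
  exact: vtends_cst.
exact: vtendsD.
Qed.

Lemma ctends_inner f h k : vtends f h -> ctends (fun a => innerL2 (f a) k) (innerL2 h k).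
Proof.
move=> fh; have H : (normL2 k * normL2 (f a - h)) @[a --> F] --> 0.
  by apply: cvg0Ml fh; exact: cvg_cst.
apply: cvg0_leT H => a.
by apply/andP; split; [exact: normc_ge0|rewrite -innerBl mulrC; exact: inner_CauchySchwarz].
Qed.

End limits.

(** * Truncated resolvents along a family of points *)

Section truncated_limits.
Variable R : realType.
Variable Fr : L2R3 R -> L2R3 R.
Hypothesis hFr : is_fourier Fr.
Variables (s : R) (n : nat) (rho K : R).
Hypotheses (rho0 : 0 < rho) (rho1 : rho <= 1) (rhos : rho <= s) (K0 : 0 <= K).
Hypothesis n1 : (1 <= n)%N.
Variables (X : Type) (F : set_system X).
Context {FF : ProperFilter F}.
Variables (m e : X -> R).
Hypothesis ms : (m a - s) @[a --> F] --> 0.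
Hypothesis e0 : forall a, 0 < e a.
Hypothesis er : \forall a \near F, e a < `|m a - s|.
Hypothesis re : ((`|m a - s| ^+ n) ^+ 2 / e a) @[a --> F] --> 0.

Lemma cvg0_sqr (x : X -> R) : (forall a, 0 <= x a) ->
  x a ^+ 2 @[a --> F] --> 0 -> x a @[a --> F] --> 0.
Proof.
move=> x0 x2; rewrite (_ : (fun a => x a) = (fun a => Num.sqrt (x a ^+ 2))).
  rewrite -(sqrtr0 R); apply: (cvg_comp _ _ x2); exact: sqrt_continuous.
by apply/funext => a; rewrite sqrtr_sqr ger0_norm.
Qed.

Lemma cvg0_near_lt (x : X -> R) (c : R) : 0 < c -> x a @[a --> F] --> 0 ->
  \forall a \near F, `|x a| < c.
Proof. by move=> c0 /cvgr0Pnorm_lt/(_ c c0). Qed.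

Let rs : `|m a - s| @[a --> F] --> 0.
Proof. by apply/norm_cvg0P. Qed.

Lemma truncation_width : e a @[a --> F] --> 0.
Proof.
apply: cvg0_le rs; apply: filterS er => a ea.
by rewrite (ltW (e0 a)) (ltW ea).
Qed.

Let near_rho : \forall a \near F, `|m a - s| + e a < rho.
Proof.
have r2 : 0 < rho / 2 by rewrite divr_gt0.
have [H1 H2] := (cvg0_near_lt r2 ms, er).
by apply: filterS2 H1 H2 => a h1 h2; lra.
Qed.

Section one.
Variables (u : L2R3 R) (U : R -> L2S2 R).
Hypotheses (cU : curve_continuous U) (uU : represents Fr u U).
Hypothesis bU : vanishing_bounds U s n rho K.

Lemma cut_out_small (b : X -> L2R3 R) :
  (forall a, is_mul Fr (cut_out (m a) (e a)) u (b a)) ->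
  (normL2 (b a) / e a) @[a --> F] --> 0.
Proof.
move=> ub; apply: cvg0_sqr => [a|].
  by rewrite divr_ge0 ?normL2_ge0// ltW.
have H : (2 * K ^+ 2 * (2 ^+ n) ^+ 2 * ((`|m a - s| ^+ n) ^+ 2 / e a)) @[a --> F] --> 0.
  by apply: cvg0Ml re; exact: cvg_cst.
apply: cvg0_le H; apply: filterS2 near_rho er => a h1 h2.
rewrite sqr_ge0 expr_div_n ler_pdivrMr ?exprn_gt0//=.
apply: (le_trans (cut_out_norm hFr K0 cU uU bU (e0 a) h1 (ub a))).
have -> : 2 * K ^+ 2 * (2 ^+ n) ^+ 2 * ((`|m a - s| ^+ n) ^+ 2 / e a) * e a ^+ 2 =
    2 * e a * (K ^+ 2 * ((2 * `|m a - s|) ^+ n) ^+ 2).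
  by rewrite !exprMn; field; rewrite gt_eqF.
rewrite ler_wpM2l ?mulr_ge0 ?(ltW (e0 a))// ler_wpM2l ?sqr_ge0//.
have r0 : 0 <= `|m a - s| + e a by rewrite addr_ge0// ltW.
rewrite ler_sqr ?nnegrE ?exprn_ge0 ?mulr_ge0//.
by apply: lerXn2r; rewrite ?nnegrE ?mulr_ge0//; lra.
Qed.

(** The squared distance splits into three regions: $O(r^{2n}/\epsilon)$ within
    $2r$ of the centre $m$, where $r = |m - s|$; $O(t)$ up to distance $t$; and
    $O((r/t)^2)$ beyond. The choice $t = \sqrt r$ makes all three small. *)
Lemma cut_inv_tends (phi : L2R3 R) (th : X -> L2R3 R) :
  is_mul Fr (fun x => (x - s)^-1) u phi ->
  (forall a, is_mul Fr (cut_inv (m a) (e a)) u (th a)) -> vtends F th phi.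
Proof.
move=> uphi uth; apply: cvg0_sqr => [a|]; first exact: normL2_ge0.
have sr : Num.sqrt `|m a - s| @[a --> F] --> 0.
  by rewrite -(sqrtr0 R); apply: (cvg_comp _ _ rs); exact: sqrt_continuous.
have H1 : (4 * K ^+ 2 * (3 ^+ n) ^+ 2 * ((`|m a - s| ^+ n) ^+ 2 / e a)) @[a --> F] --> 0.
  by apply: cvg0Ml re; exact: cvg_cst.
have H2 : (4 * K ^+ 2 * Num.sqrt `|m a - s|) @[a --> F] --> 0.
  by apply: cvg0Ml sr; exact: cvg_cst.
have H3 : (normL2 phi ^+ 2 * `|m a - s|) @[a --> F] --> 0.
  by apply: cvg0Ml rs; exact: cvg_cst.
apply: cvg0_le (cvg0D (cvg0D H1 H2) H3).
have q0 : 0 < (4^-1 : R) by rewrite invr_gt0.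
have r2 : 0 < rho / 2 by rewrite divr_gt0.
have N1 := cvg0_near_lt q0 ms.
have N2 := cvg0_near_lt r2 ms.
have N3 := cvg0_near_lt r2 sr.
apply: filterS2 (filterI er N1) (filterI N2 N3) => a [h1 h2] [h3 h4].
rewrite sqr_ge0/=.
set r := `|m a - s| in h1 h2 h3 h4 *.
have r0 : 0 < r by exact: lt_trans h1.
have s0 : 0 < Num.sqrt r by rewrite sqrtr_gt0.
have ss : r = Num.sqrt r ^+ 2 by rewrite sqr_sqrtr// ltW.
rewrite (ger0_norm (sqrtr_ge0 _)) in h4.
have sh : Num.sqrt r < 2^-1.
  rewrite -ltr_sqr ?nnegrE ?invr_ge0 ?(ltW s0)// -ss (lt_le_trans h2)//.
  by rewrite exprVn lef_pV2 ?posrE ?exprn_gt0//; lra.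
have h5 : 2 * r < Num.sqrt r.
  by rewrite {1}ss expr2 mulrA gtr_pMl// -ltr_pdivlMl// mulr1.
have h6 : Num.sqrt r + r < rho by lra.
have := cut_inv_phi_norm hFr rho0 rho1 K0 n1 cU uU bU (e0 a) h1 h5 h6 uphi
  (is_mul_subm hFr (uth a) uphi).
move/le_trans; apply; rewrite -/r.
have -> : (r / Num.sqrt r) ^+ 2 = r by rewrite {1}ss expr2 mulfK ?gt_eqF.
rewrite !exprMn (mulrC (normL2 _ ^+ 2)).
by rewrite !mulrA.
Qed.

End one.

Section two.
Variables (u w : L2R3 R) (U W : nat -> R -> L2S2 R).
Hypotheses (cU : curve_continuous (U 0%N)) (cW : curve_continuous (W 0%N)).
Hypotheses (uU : represents Fr u (U 0%N)) (wW : represents Fr w (W 0%N)).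
Hypothesis bU : vanishing_bounds (U 0%N) s n rho K.
Hypothesis bW : vanishing_bounds (W 0%N) s n rho K.
Variables (phiu phiw : L2R3 R) (th : X -> L2R3 R).
Hypothesis uphi : is_mul Fr (fun x => (x - s)^-1) u phiu.
Hypothesis wphi : is_mul Fr (fun x => (x - s)^-1) w phiw.
Hypothesis uth : forall a, is_mul Fr (cut_inv (m a) (e a)) u (th a).

Lemma pv_gamma_cut_small :
  (Normc.normc (innerL2 (th a) w - pv_gamma (spec_pairing U W) (m a)) / e a)
    @[a --> F] --> 0.
Proof.
have H : (8 * K ^+ 2 * (`|m a - s| + e a)) @[a --> F] --> 0.
  by apply: cvg0Ml (cvg0D rs truncation_width); exact: cvg_cst.
apply: cvg0_le H; apply: filterS near_rho => a h1.
rewrite divr_ge0 ?normc_ge0 ?(ltW (e0 a))// andTb ler_pdivrMr// -[X in Normc.normc X]opprB normcN.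
exact: (pv_gamma_cut hFr rho1 rhos K0 n1 cU cW uU wW bU bW (e0 a) h1 (uth a)).
Qed.

Lemma pv_gamma_slope :
  ctends F (fun a => ((m a - s)^-1)%:C *
      (pv_gamma (spec_pairing U W) (m a) - innerL2 phiu w)) (innerL2 phiu phiw).
Proof.
have H1 : (20 * K ^+ 2 * e a) @[a --> F] --> 0.
  by apply: cvg0Ml truncation_width; exact: cvg_cst.
have H2 : ctends F (fun a => innerL2 (th a) phiw) (innerL2 phiu phiw).
  exact: ctends_inner (cut_inv_tends cU uU bU uphi uth).
rewrite /ctends in H2 *; apply: cvg0_le (cvg0D H1 H2).
apply: filterS2 near_rho er => a h1 h2.
rewrite normc_ge0 andTb.
have r0 : 0 < `|m a - s| by rewrite (lt_trans (e0 a)).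
have ms0 : (m a - s)%:C != 0.
  by rewrite -(rmorph0 (real_complex R)) (inj_eq (@complexI R)) -normr_gt0.
set g := pv_gamma _ _.
have -> : ((m a - s)^-1)%:C * (g - innerL2 phiu w) - innerL2 phiu phiw =
  ((m a - s)^-1)%:C * (g - innerL2 phiu w - (m a - s)%:C * innerL2 (th a) phiw) +
  (innerL2 (th a) phiw - innerL2 phiu phiw).
  have -> : ((m a - s)^-1)%:C = ((m a - s)%:C)^-1 by rewrite fmorphV.
  by rewrite [in RHS]mulrBr mulrA mulVf// mul1r addrA subrK.
apply: (le_trans (le_normcD _ _)); rewrite lerD2r Normc.normcM normc_real normfV.
rewrite ler_pdivrMl//.
apply: (le_trans (pv_gamma_expansion hFr rho1 rhos K0 n1 cU cW uU wW bU bW uphi wphi (e0 a) h1 (uth a))).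
have -> : `|m a - s| * (20 * K ^+ 2 * e a) = 10 * K ^+ 2 * (2 * `|m a - s|) * e a by ring.
rewrite ler_wpM2r ?(ltW (e0 a))// ler_wpM2l ?mulr_ge0 ?sqr_ge0//.
by rewrite mulr_natl mulr2n lerD2l ltW.
Qed.

End two.
End truncated_limits.

(** * Concentration at a simple branch of zeros *)

Section branch.
Variable R : realType.

Lemma sum_I2 (V : nmodType) (f : 'I_2 -> V) : \sum_(j < 2) f j = f 0 + f 1.
Proof. by rewrite big_ord_recl big_ord1; congr (f _ + f _); exact: val_inj. Qed.

Lemma ord2P (P : 'I_2 -> Prop) : P 0 -> P 1 -> forall j, P j.
Proof.
move=> P0 P1 [[|[|//]] i].
  by rewrite (_ : Ordinal i = 0)//; exact: val_inj.
by rewrite (_ : Ordinal i = 1)//; exact: val_inj.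
Qed.

Lemma det_mx22 (A : 'M[R[i]]_2) : \det A = A 0 0 * A 1 1 - A 0 1 * A 1 0.
Proof.
rewrite (expand_det_row _ 0) sum_I2 /cofactor !det_mx11 !mxE.
rewrite (_ : lift 0 0 = 1); last exact: val_inj.
rewrite (_ : lift 1 0 = 0); last exact: val_inj.
by rewrite /= (_ : (0 + 1 %% 2)%N = 1%N)// addn0 expr0 expr1 mul1r mulN1r mulrN.
Qed.

Lemma ctends_near (X : Type) (F : set_system X) (FF : ProperFilter F)
    (z w : X -> R[i]) l :
  (\forall a \near F, z a = w a) -> ctends F z l -> ctends F w l.
Proof.
move=> zw; rewrite /ctends; apply: cvg0_le; apply: filterS zw => a ->.
by rewrite normc_ge0 lexx.
Qed.

Lemma realC_neq0 (x : R) : x != 0 -> x%:C != 0 :> R[i].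
Proof. by move=> x0; rewrite -(rmorph0 (real_complex R)) (inj_eq (@complexI R)). Qed.

Variable Fr : L2R3 R -> L2R3 R.
Hypothesis hFr : is_fourier Fr.
Variable u : 'I_2 -> L2R3 R.
Variable U : 'I_2 -> nat -> R -> L2S2 R.
Hypothesis cU : forall j, curve_continuous (U j 0%N).
Hypothesis uU : forall j, represents Fr (u j) (U j 0%N).
Variables (s : R) (n : nat) (rho K : R).
Hypotheses (rho0 : 0 < rho) (rho1 : rho <= 1) (rhos : rho <= s) (K0 : 0 <= K).
Hypothesis n1 : (1 <= n)%N.
Hypothesis bU : forall j, vanishing_bounds (U j 0%N) s n rho K.
Variable phi : 'I_2 -> L2R3 R.
Hypothesis uphi : forall j, is_mul Fr (fun x => (x - s)^-1) (u j) (phi j).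
Variable alpha0 : R.
Hypothesis alpha0_neq0 : alpha0 != 0.
Hypothesis phiu : forall j k, innerL2 (phi j) (u k) = - ((j == k)%:R / alpha0%:C).

Lemma is_mul_quot (m m1 m' : R -> R) f g h : is_mul Fr m f g -> is_mul Fr m1 f h ->
  (forall x, 0 <= x -> m1 x = m' x * m x) -> is_mul Fr m' g h.
Proof.
move=> fg fh mm; apply: ae_imply2 fg fh => x -> ->.
by rewrite mm ?dot3_ge0// rmorphM/= mulrA.
Qed.

Lemma free_H_truncated (m e : R) v b th : 0 < e -> is_mul Fr (cut_out m e) v b ->
  is_mul Fr (cut_inv m e) v th -> free_H Fr th (v - b - (- m)%:C *: th).
Proof.
move=> e0 vb vth; have vb' := is_mul_subm hFr (is_mul1 Fr v) vb.
apply: (@is_mul_quot _ _ (fun x => x) _ _ _ vth (is_mul_subm hFr vb' (is_mul_scale hFr (- m) vth))) => x x0.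
rewrite /cut_out /cut_inv; case: ifPn => xe; last by rewrite !mulr0 !subrr.
by have xm : x - m != 0; [rewrite -normr_gt0 (lt_le_trans e0)|field].
Qed.

Section family.
Variables (m e : R -> R) (L : R).
Local Notation F := (alpha0^').
Hypothesis ms : (m a - s) @[a --> F] --> 0.
Hypothesis e0 : forall a, 0 < e a.
Hypothesis er : \forall a \near F, e a < `|m a - s|.
Hypothesis re : ((`|m a - s| ^+ n) ^+ 2 / e a) @[a --> F] --> 0.
Hypothesis mL : ((m a - s) / (a - alpha0)) @[a --> F] --> L.

Let th j a := mulop Fr (cut_inv (m a) (e a)) (u j).
Let uth j a : is_mul Fr (cut_inv (m a) (e a)) (u j) (th j a).
Proof.
apply: (mulopP hFr); first exact: measurable_cut_inv.
by move=> x; exact: cut_inv_bound.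
Qed.
Let bb j a := mulop Fr (cut_out (m a) (e a)) (u j).
Let ub j a : is_mul Fr (cut_out (m a) (e a)) (u j) (bb j a).
Proof.
apply: (mulopP hFr); first exact: measurable_cut_out.
by move=> x; exact: cut_out_bound.
Qed.

Let near_neq : \forall a \near F, a != alpha0.
Proof. exact: nbhs_dnbhs_neq. Qed.

Let acvg : a @[a --> F] --> alpha0.
Proof. exact: nbhs_dnbhs. Qed.

Let msneq : \forall a \near F, m a - s != 0.
Proof. by apply: filterS er => a ea; rewrite -normr_gt0 (lt_trans (e0 a)). Qed.

Let M (k j : 'I_2) : R[i] := - ((k == j)%:R / alpha0%:C) + (alpha0 * L)%:C * innerL2 (phi j) (phi k).

Lemma Cmx_slope k j :
  ctends F (fun a => Cmx U a (m a) k j * ((a - alpha0)^-1)%:C) (M k j).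
Proof.
have G : ctends F (fun a => ((m a - s)^-1)%:C *
    (pv_gamma (spec_pairing (U j) (U k)) (m a) - innerL2 (phi j) (u k)))
    (innerL2 (phi j) (phi k)).
  exact: (pv_gamma_slope hFr rho0 rho1 rhos K0 n1 ms e0 er re (cU j) (cU k) (uU j)
    (uU k) (bU j) (bU k) (uphi j) (uphi k) (uth j)).
have H1 : ctends F (fun a => (a * ((m a - s) / (a - alpha0)))%:C) (alpha0 * L)%:C.
  by apply: ctends_real; apply: cvgM.
have H2 : ctends F (fun=> - ((k == j)%:R / alpha0%:C)) (- ((k == j)%:R / alpha0%:C) : R[i]).
  exact: ctends_cst.
apply: ctends_near (ctendsD H2 (ctendsM H1 G)).
apply: filterS2 near_neq msneq => a a1 a2.
rewrite mxE phiu (eq_sym j k) !rmorphM/= !fmorphV/=.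
have A1 : a%:C - alpha0%:C != 0 :> R[i] by rewrite -rmorphB/= realC_neq0// subr_eq0.
have A2 := realC_neq0 a2; have A3 := realC_neq0 alpha0_neq0.
rewrite (rmorphB _ a alpha0)/=.
by move: ((m a - s)%:C) A2 => t t0; field; rewrite A1 A3 t0.
Qed.

Variables (al : 'I_2 -> R[i]) (kappa : R).
Hypothesis eig : forall k,
  \sum_(j < 2) al j * innerL2 (phi j) (phi k) = kappa%:C * al k.
Hypothesis kL : alpha0 ^+ 2 * L * kappa = 1.

Let tau : R[i] := M 0 0 + M 1 1.

(** The adjugate matrix applied to the eigenvector. *)
Let c (j : 'I_2) (a : R) : R[i] :=
  if j == 0 then (Cmx U a (m a) 1 1 * al 0 - Cmx U a (m a) 0 1 * al 1) * ((a - alpha0)^-1)%:C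
  else (Cmx U a (m a) 0 0 * al 1 - Cmx U a (m a) 1 0 * al 0) * ((a - alpha0)^-1)%:C.

Lemma slope_kernel k : M k 0 * al 0 + M k 1 * al 1 = 0.
Proof.
have := eig k; rewrite sum_I2 => E.
have A3 := realC_neq0 alpha0_neq0.
have kLc : alpha0%:C * (alpha0 * L * kappa)%:C = 1 :> R[i].
  by rewrite -rmorphM/= -(rmorph1 (real_complex R)) -kL; congr (_%:C); ring.
have -> : M k 0 * al 0 + M k 1 * al 1 =
    - ((k == 0)%:R * al 0 + (k == 1)%:R * al 1) / alpha0%:C +
    (alpha0 * L)%:C * (al 0 * innerL2 (phi 0) (phi k) + al 1 * innerL2 (phi 1) (phi k)).
  by rewrite /M; ring.
rewrite E mulrA -rmorphM/=.
have -> : (k == 0)%:R * al 0 + (k == 1)%:R * al 1 = al k.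
  by elim/ord2P: k {E} => /=; rewrite ?mul1r ?mul0r ?addr0 ?add0r.
have -> : (alpha0 * L * kappa)%:C = (alpha0%:C)^-1 :> R[i].
  by apply: (mulfI A3); rewrite kLc mulfV.
by rewrite mulNr mulrC addNr.
Qed.

Lemma coef_tends j : ctends F (c j) (tau * al j).
Proof.
have S k l : ctends F (fun a => al l * (Cmx U a (m a) k k * ((a - alpha0)^-1)%:C)) (al l * M k k).
  by apply: ctendsZ; exact: Cmx_slope.
have O k l : ctends F (fun a => - al l * (Cmx U a (m a) k l * ((a - alpha0)^-1)%:C)) (- al l * M k l).
  by apply: ctendsZ; exact: Cmx_slope.
have K0' := slope_kernel 0; have K1 := slope_kernel 1.
elim/ord2P: j.
  have -> : tau * al 0 = al 0 * M 1 1 + - al 1 * M 0 1.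
    rewrite /tau mulrDl; have -> : M 0 0 * al 0 = - (M 0 1 * al 1).
      by apply/eqP; rewrite -subr_eq0 opprK K0'.
    by ring.
  apply: ctends_near (ctendsD (S 1 0) (O 0 1)).
  by apply: nearW => a; rewrite /c eqxx; ring.
have -> : tau * al 1 = al 1 * M 0 0 + - al 0 * M 1 0.
  rewrite /tau mulrDl; have -> : M 1 1 * al 1 = - (M 1 0 * al 0).
    by apply/eqP; rewrite -subr_eq0 opprK addrC K1.
  by ring.
apply: ctends_near (ctendsD (S 0 1) (O 1 0)).
by apply: nearW => a; rewrite /c/=; ring.
Qed.

Lemma adjugate_eq k a :
  Cmx U a (m a) k 0 * c 0 a + Cmx U a (m a) k 1 * c 1 a =
  \det (Cmx U a (m a)) * ((a - alpha0)^-1)%:C * al k.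
Proof.
rewrite det_mx22.
by elim/ord2P: k; rewrite /c/=; ring.
Qed.

Hypothesis det_small :
  (Normc.normc (\det (Cmx U a (m a))) * `|a - alpha0|^-1 / e a) @[a --> F] --> 0.

Let psia a := \sum_(j < 2) c j a *: th j a.
Let psi := \sum_(j < 2) al j *: phi j.

Lemma quasimode_tends : vtends F psia (tau *: psi).
Proof.
rewrite scaler_sumr; apply: vtends_sum => j; rewrite scalerA.
apply: vtendsZ; first exact: coef_tends.
exact: (cut_inv_tends hFr rho0 rho1 K0 n1 ms e0 er re (cU j) (uU j) (bU j) (uphi j) (uth j)).
Qed.

Let D (k : 'I_2) (a : R) : R[i] := Cmx U a (m a) k 0 * c 0 a + Cmx U a (m a) k 1 * c 1 a +
  \sum_(j < 2) a%:C * c j a * (innerL2 (th j a) (u k) - pv_gamma (spec_pairing (U j) (U k)) (m a)).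

Let res a := \sum_(k < 2) D k a *: u k - \sum_(j < 2) c j a *: bb j a.

Lemma quasimode_op a : exists2 g, perturbed_H Fr u a (psia a) g & g - (m a)%:C *: psia a = res a.
Proof.
have HT j : is_mul Fr (fun x => x) (th j a) (u j - bb j a - (- m a)%:C *: th j a).
  exact: (free_H_truncated (e0 a) (ub j a) (uth j a)).
pose h := \sum_(j < 2) c j a *: (u j - bb j a - (- m a)%:C *: th j a).
have Hh : free_H Fr (psia a) h.
  have H0 : is_mul Fr (fun x => x) 0 0.
    by have := is_mul_lin hFr (-1) (HT 0) (HT 0); rewrite !scaleN1r !addNr.
  have := is_mul_lin hFr (c 0 a) (HT 0) (is_mul_lin hFr (c 1 a) (HT 1) H0).
  by rewrite !addr0 /psia /h !sum_I2.
eexists; first by exists h => //.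
have -> : h = \sum_(j < 2) c j a *: u j - \sum_(j < 2) c j a *: bb j a + (m a)%:C *: psia a.
  rewrite /psia scaler_sumr -sumrB -big_split; apply: eq_bigr => j _ /=.
  by rewrite rmorphN/= scaleNr opprK !scalerDr scalerN !scalerA (mulrC (c j a)).
rewrite addrAC addrK /res addrAC; congr (_ - _).
rewrite scaler_sumr -big_split; apply: eq_bigr => k _ /=.
rewrite scalerA -scalerDl; congr (_ *: _).
rewrite /D /psia inner_suml !sum_I2 !innerZl !mxE.
have -> : c k a = (k == 0)%:R * c 0 a + (k == 1)%:R * c 1 a.
  by elim/ord2P: k; rewrite ?eqxx/= ?mul1r ?mul0r ?addr0 ?add0r.
move: (c 0 a) (c 1 a) (innerL2 (th 0 a) (u k)) (innerL2 (th 1 a) (u k)) => c0 c1 t0 t1.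
move: (pv_gamma (spec_pairing (U 0) (U k)) (m a)) => g0.
by move: (pv_gamma (spec_pairing (U 1) (U k)) (m a)) => g1; ring.
Qed.

Lemma quasimode_residual : (normL2 (res a) / e a) @[a --> F] --> 0.
Proof.
have cn j : Normc.normc (c j a) @[a --> F] --> Normc.normc (tau * al j).
  exact: ctends_norm (coef_tends j).
have B j : (Normc.normc (c j a) * (normL2 (bb j a) / e a)) @[a --> F] --> 0.
  apply: cvg0Ml (cn j) _.
  exact: (cut_out_small hFr rho0 K0 ms e0 er re (cU j) (uU j) (bU j) (ub j)).
have G k j : (normL2 (u k) * (`|a| * Normc.normc (c j a)) * (Normc.normc (innerL2 (th j a) (u k) -
    pv_gamma (spec_pairing (U j) (U k)) (m a)) / e a)) @[a --> F] --> 0.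
  apply: (@cvg0Ml _ _ _ _ _ _ (normL2 (u k) * (`|alpha0| * Normc.normc (tau * al j)))).
    apply: cvgM; first exact: cvg_cst.
    by apply: cvgM => //; exact: cvg_norm.
  exact: (pv_gamma_cut_small hFr rho0 rho1 rhos K0 n1 ms e0 er (cU j) (cU k) (uU j)
    (uU k) (bU j) (bU k) (uth j)).
have H k : (normL2 (u k) * Normc.normc (al k) * (Normc.normc (\det (Cmx U a (m a))) *
    `|a - alpha0|^-1 / e a)) @[a --> F] --> 0.
  by apply: cvg0Ml det_small; exact: cvg_cst.
have distribute (e1 nu A1 A2 A3 q c0 c1 x0 x1 : R) : e1 != 0 ->
    (A1 * A2 * A3 + (q * c0 * x0 + q * c1 * x1)) * nu =
    (nu * A3 * (A1 * A2 / e1) + (nu * (q * c0) * (x0 / e1) + nu * (q * c1) * (x1 / e1))) * e1.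
  by move=> ?; field.
have T k : (normL2 (D k a *: u k) / e a) @[a --> F] --> 0.
  apply: cvg0_leT (cvg0D (H k) (cvg0D (G k 0) (G k 1))) => a.
  rewrite divr_ge0 ?normL2_ge0 ?(ltW (e0 a))// andTb normL2Z.
  rewrite ler_pdivrMr//.
  have Dn : Normc.normc (D k a) <=
      Normc.normc (\det (Cmx U a (m a))) * `|a - alpha0|^-1 * Normc.normc (al k) +
      (`|a| * Normc.normc (c 0 a) * Normc.normc (innerL2 (th 0 a) (u k) -
        pv_gamma (spec_pairing (U 0) (U k)) (m a)) +
       `|a| * Normc.normc (c 1 a) * Normc.normc (innerL2 (th 1 a) (u k) -
        pv_gamma (spec_pairing (U 1) (U k)) (m a))).
    rewrite /D adjugate_eq sum_I2 (le_trans (le_normcD _ _))// lerD//.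
      by rewrite !Normc.normcM normc_real normfV.
    rewrite (le_trans (le_normcD _ _))// lerD// !Normc.normcM normc_real//.
  apply: (le_trans (ler_wpM2r (normL2_ge0 _) Dn)).
  by rewrite (distribute (e a)) ?lexx ?lt0r_neq0.
have common (x0 x1 c0 c1 b0 b1 e1 : R) :
  x0 / e1 + x1 / e1 + (c0 * (b0 / e1) + c1 * (b1 / e1)) = (x0 + x1 + (c0 * b0 + c1 * b1)) / e1.
  by ring.
apply: cvg0_leT (cvg0D (cvg0D (T 0) (T 1)) (cvg0D (B 0) (B 1))) => a; apply/andP; split.
  by apply: divr_ge0; [exact: normL2_ge0|exact: ltW].
rewrite common ler_wpM2r ?invr_ge0 ?(ltW (e0 a))//.
rewrite /res !sum_I2 (le_trans (ler_normL2B _ _))// lerD// (le_trans (ler_normL2D _ _))//.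
by rewrite !normL2Z.
Qed.

(** The approximate eigenvector has an error which is small compared with the
    half-width of the interval, so the spectral projection almost fixes it. *)
Lemma branch_concentration (E : R -> set (measurableTypeR R) -> L2R3 R -> L2R3 R) :
  (forall a, spectral_measure_of (perturbed_H Fr u a) (E a)) -> tau != 0 ->
  vtends F (fun a => E a `[m a - e a, m a + e a]%classic psi) psi.
Proof.
move=> hE tau0.
pose I a : set (measurableTypeR R) := `[m a - e a, m a + e a]%classic.
have mI a : measurable (I a) by exact: measurable_itv.
have H1 : normL2 (psia a - E a (I a) (psia a)) @[a --> F] --> 0.
  apply: cvg0_leT quasimode_residual => a; rewrite normL2_ge0 andTb.
  rewrite ler_pdivlMr// mulrC; have [g Hg <-] := quasimode_op a.
  apply: (spec_gap (hE a)) => //; first exact: ltW.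
  move=> x /= /negP; rewrite in_itv/= negb_and -!ltNge => /orP[|] h.
    by rewrite distrC ler_normr; apply/orP; left; lra.
  by rewrite ler_normr; apply/orP; left; lra.
have H2 := quasimode_tends.
have H3 : (Normc.normc (tau^-1) * (normL2 (psia a - E a (I a) (psia a)) +
   (normL2 (psia a - tau *: psi) + normL2 (psia a - tau *: psi)))) @[a --> F] --> 0.
  by apply: cvg0Ml (cvg0D H1 (cvg0D H2 H2)); exact: cvg_cst.
apply: cvg0_leT H3 => a; rewrite normL2_ge0 andTb.
rewrite -[X in normL2 (E _ _ X - _)](scalerK tau0) -[X in normL2 (_ - X)](scalerK tau0).
rewrite (specZ (hE a) (mI a)) -scalerBr normL2Z ler_wpM2l ?normc_ge0//.
have -> : E a (I a) (tau *: psi) - tau *: psi =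
  - (psia a - E a (I a) (psia a)) + ((psia a - tau *: psi) - E a (I a) (psia a - tau *: psi)).
  rewrite (specB (hE a) (mI a)) !opprB.
  by rewrite [RHS]addrA [X in _ = X + _]addrA subrK [RHS]addrC [RHS]addrA subrK.
rewrite (le_trans (ler_normL2D _ _))// normL2N lerD2l (le_trans (ler_normL2B _ _))//.
by rewrite lerD2l (spec_norm_le (hE a)).
Qed.

End family.
End branch.

(** * The determinant at a zero of its real part *)

Section determinant.
Variable R : realType.
Variable Fr : L2R3 R -> L2R3 R.
Hypothesis hFr : is_fourier Fr.
Variable u : 'I_2 -> L2R3 R.
Variable U : 'I_2 -> nat -> R -> L2S2 R.
Hypothesis cU : forall j, curve_continuous (U j 0%N).
Hypothesis uU : forall j, represents Fr (u j) (U j 0%N).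
Variables (s : R) (n : nat) (rho K : R).
Hypotheses (rho0 : 0 < rho) (rho1 : rho <= 1) (rhos : rho <= s) (K0 : 0 <= K).
Hypothesis n1 : (1 <= n)%N.
Hypothesis bU : forall j, vanishing_bounds (U j 0%N) s n rho K.

Lemma normc_conj (z : R[i]) : Normc.normc (conjc z) = Normc.normc z.
Proof. by case: z => a b /=; rewrite sqrrN. Qed.

Lemma pv_gamma_hermitian (m : R) j k : `|m - s| < rho ->
  pv_gamma (spec_pairing (U k) (U j)) m = conjc (pv_gamma (spec_pairing (U j) (U k)) m).
Proof.
move=> mr; apply/eqP; rewrite -subr_eq0; apply/eqP/Normc.eq0_normc.
apply/eqP; rewrite eq_le normc_ge0 andbT; apply/ler_addgt0Pr => eps eps0.
rewrite add0r.
have K1 : 0 < 16 * K ^+ 2 + 1 by rewrite ltr_wpDl// mulr_ge0// sqr_ge0.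
have d0 : 0 < rho - `|m - s| by rewrite subr_gt0.
have [e [e0 er ee]] : exists e : R,
    [/\ 0 < e, e < rho - `|m - s| & (16 * K ^+ 2 + 1) * e <= eps].
  exists (Num.min ((rho - `|m - s|) / 2) (eps / (16 * K ^+ 2 + 1))); split.
  - by rewrite lt_min !divr_gt0.
  - by rewrite gt_min; apply/orP; left; rewrite ltr_pdivrMr//; lra.
  - by rewrite mulrC -ler_pdivlMr// ge_min lexx orbT.
have me : `|m - s| + e < rho by rewrite -ltrBrDl.
pose th i := mulop Fr (cut_inv m e) (u i).
have uth i : is_mul Fr (cut_inv m e) (u i) (th i).
  apply: (mulopP hFr); first exact: measurable_cut_inv.
  by move=> x; exact: cut_inv_bound.
have B i l := pv_gamma_cut hFr rho1 rhos K0 n1 (cU i) (cU l) (uU i) (uU l) (bU i) (bU l) e0 me (uth i).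
have S : innerL2 (th k) (u j) = conjc (innerL2 (th j) (u k)).
  rewrite -innerC; apply: (@is_mul_inner _ Fr hFr _ _ _ _ _ _ _ _ _ _ s (uth k)
    (is_mul1 Fr (u j)) (is_mul1 Fr (u k)) (uth j)).
  by move=> x _ _; rewrite mulr1 mul1r.
have H1 := B k j; have H2 := B j k.
rewrite S in H1; rewrite -normc_conj conjD conjN in H2.
have -> : pv_gamma (spec_pairing (U k) (U j)) m - conjc (pv_gamma (spec_pairing (U j) (U k)) m) =
  (pv_gamma (spec_pairing (U k) (U j)) m - conjc (innerL2 (th j) (u k))) -
  (conjc (pv_gamma (spec_pairing (U j) (U k)) m) - conjc (innerL2 (th j) (u k))) by ring.
rewrite (le_trans (le_normcD _ _))// normcN (le_trans (lerD H1 H2))// (le_trans _ ee)//.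
have h : 8 * K ^+ 2 * (`|m - s| + e) * e <= 8 * K ^+ 2 * e.
  rewrite ler_wpM2r ?(ltW e0)// ler_piMr ?mulr_ge0 ?sqr_ge0//.
  by rewrite (le_trans (ltW me)).
have e1 := ltW e0.
by rewrite (le_trans (lerD h h))//; lra.
Qed.

Lemma conj_eq_real (z : R[i]) : z = conjc z -> complex.Im z = 0.
Proof. by case: z => a b [] /eqP; rewrite -subr_eq0 opprK -mulr2n mulrn_eq0/= => /eqP. Qed.

Lemma hermitian_det (A : 'M[R[i]]_2) (D : 'M[R[i]]_2) :
  (forall j k, A k j = conjc (A j k)) -> (forall j k, D k j = conjc (D j k)) ->
  \det A = (complex.Re (\det (A + (0 +i* 1) *: D)))%:C + \det D.
Proof.
move=> hA hD; rewrite !det_mx22 !mxE.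
have := conj_eq_real (hA 0 0); have := conj_eq_real (hA 1 1).
have := conj_eq_real (hD 0 0); have := conj_eq_real (hD 1 1).
rewrite (hA 0 1) (hD 0 1).
case: (A 0 0) (A 1 1) (A 0 1) (D 0 0) (D 1 1) (D 0 1) => [a0 a1] [b0 b1] [c0 c1] [e0 e1] [f0 f1] [g0 g1] /=.
by move=> -> -> -> ->; apply/eqP; rewrite eq_complex/=; apply/andP; split; apply/eqP; ring.
Qed.

Lemma det_Cmx (a m : R) : `|m - s| < rho ->
  \det (Cmx U a m) = (ReF U a m)%:C + \det (Dmx U a m).
Proof.
move=> mr; apply: hermitian_det => j k; rewrite !mxE.
  rewrite (pv_gamma_hermitian _ _ mr) conjD conjM conjc_real (eq_sym k j); congr (_ + _).
  by case: (j == k); rewrite ?conjc1 ?conjc0.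
rewrite conjM conjc_real; congr (_ * _).
by rewrite /spec_pairing; case: ifP => _; rewrite -?innerC ?conjc0.
Qed.

Lemma det_Dmx_bound (a m : R) : `|m - s| < rho ->
  Normc.normc (\det (Dmx U a m)) <= 2 * (a * pi * K ^+ 2) ^+ 2 * ((`|m - s| ^+ n) ^+ 2) ^+ 2.
Proof.
move=> mr; have B j k : Normc.normc (Dmx U a m j k) <= `|a * pi| * (K ^+ 2 * (`|m - s| ^+ n) ^+ 2).
  rewrite mxE Normc.normcM normc_real ler_wpM2l//.
  rewrite /spec_pairing; case: ifP => _; last first.
    by rewrite Normc.normc0 mulr_ge0 ?sqr_ge0.
  rewrite (le_trans (inner_CauchySchwarz _ _))// -exprMn expr2.
  by apply: ler_pM; rewrite ?normL2_ge0//; exact: (bU _).1.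
rewrite det_mx22 (le_trans (le_normcD _ _))// normcN !Normc.normcM.
have -> : 2 * (a * pi * K ^+ 2) ^+ 2 * ((`|m - s| ^+ n) ^+ 2) ^+ 2 =
   (`|a * pi| * (K ^+ 2 * (`|m - s| ^+ n) ^+ 2)) * (`|a * pi| * (K ^+ 2 * (`|m - s| ^+ n) ^+ 2)) +
   (`|a * pi| * (K ^+ 2 * (`|m - s| ^+ n) ^+ 2)) * (`|a * pi| * (K ^+ 2 * (`|m - s| ^+ n) ^+ 2)).
  rewrite exprMn -(real_normK (num_real (a * pi))).
  by move: `|_| (K ^+ 2) => x y; ring.
by apply: lerD; apply: ler_pM; rewrite ?normc_ge0.
Qed.

Variables (alpha0 : R) (m e : R -> R) (L : R).
Local Notation F := (alpha0^').
Hypothesis ms : (m a - s) @[a --> F] --> 0.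
Hypothesis e0 : forall a, 0 < e a.
Hypothesis re : ((`|m a - s| ^+ n) ^+ 2 / e a) @[a --> F] --> 0.
Hypothesis mL : ((m a - s) / (a - alpha0)) @[a --> F] --> L.

(** At a zero of $F_1$ the determinant of $C$ equals that of $D$, of order
    $r^{4n}$ with $r = |m - s|$. *)
Lemma det_Cmx_small : (\forall a \near F, ReF U a (m a) = 0) ->
  (Normc.normc (\det (Cmx U a (m a))) * `|a - alpha0|^-1 / e a) @[a --> F] --> 0.
Proof.
move=> F0.
have rs : `|m a - s| @[a --> F] --> 0 by apply/norm_cvg0P.
have H : (2 * (a * pi * K ^+ 2) ^+ 2 * (`|(m a - s) / (a - alpha0)| * (`|m a - s| *
    ((`|m a - s| ^+ n) ^+ 2 / e a)))) @[a --> F] --> 0.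
  apply: (@cvg0Ml _ _ _ _ _ _ (2 * (alpha0 * pi * K ^+ 2) ^+ 2)).
    apply: cvgM; first exact: cvg_cst.
    have c : (a * pi * K ^+ 2) @[a --> F] --> alpha0 * pi * K ^+ 2.
      apply: cvgM; last exact: cvg_cst.
      by apply: cvgM; [exact: nbhs_dnbhs|exact: cvg_cst].
    by rewrite (_ : (fun a => _) = (fun a => (a * pi * K ^+ 2) * (a * pi * K ^+ 2)))//; exact: cvgM.
  by apply: cvg0Ml (cvg_norm mL) _; apply: cvg0Ml rs re.
apply: cvg0_le H; apply: filterS2 F0 (cvg0_near_lt rho0 ms) => a Fa mr.
rewrite !mulr_ge0 ?invr_ge0 ?normc_ge0 ?(ltW (e0 a))// andTb.
rewrite (det_Cmx _ mr) Fa add0r.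
have rn : ((`|m a - s| ^+ n) ^+ 2) ^+ 2 <= `|m a - s| ^+ 2 * (`|m a - s| ^+ n) ^+ 2.
  rewrite [leLHS]expr2 ler_wpM2r ?sqr_ge0// ler_sqr ?nnegrE ?exprn_ge0//.
  rewrite -[leRHS]expr1; apply: ler_wiXn2l => //.
  exact: (le_trans (ltW mr) rho1).
have B := det_Dmx_bound a mr.
rewrite ler_pdivrMr// normrM normfV.
have rearr (q r x y z : R) : y != 0 -> q * (r * z * (r * (x / y))) * y = q * (r ^+ 2 * x) * z.
  by move=> ?; field.
rewrite rearr ?lt0r_neq0// ler_wpM2r ?invr_ge0// (le_trans B)//.
apply: ler_wpM2l rn; by rewrite mulr_ge0 ?sqr_ge0.
Qed.

End determinant.

(** * The complement of the eigenspace *)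

Section complement.
Variable R : realType.
Variable Fr : L2R3 R -> L2R3 R.
Hypothesis hFr : is_fourier Fr.

Lemma mul_norm_integral (m : R -> R) (f b : L2R3 R) : measurable_fun setT (m : measurableTypeR R -> measurableTypeR R) ->
  is_mul Fr m f b ->
  normL2 b ^+ 2 = \int[leb3]_x (m (dot3 x x) ^+ 2 * complex.Re (Fr f x * conjc (Fr f x))).
Proof.
move=> mm fb; rewrite normL2_sqr -(fourier_inner hFr).
have [mb1 mb2] := cintegrable_measurable (L2_integrableM (Fr b) (Fr b)).
have [mf1 mf2] := cintegrable_measurable (L2_integrableM (Fr f) (Fr f)).
change (\int[leb3]_x complex.Re (Fr b x * conjc (Fr b x)) =
  \int[leb3]_x (m (dot3 x x) ^+ 2 * complex.Re (Fr f x * conjc (Fr f x)))).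
apply: eq_Rintegral_ae => //.
  apply: measurable_funM => //; apply: measurable_funX.
  by apply: (measurableT_comp mm); exact: measurable_dot3.
move: fb; apply: filterS => x -> _.
by rewrite conjM conjc_real mulrACA -rmorphM/= ReM/= mul0r subr0 expr2.
Qed.

(** The truncation at $s$ loses little, as $\{|\xi|^2 = s\}$ is a null set. *)
Lemma cut_out_vanish (s : R) (f : L2R3 R) (eta : R) : 0 < eta ->
  exists2 e : R, 0 < e & normL2 (mulop Fr (cut_out s e) f) < eta.
Proof.
move=> eta0.
pose G (x : R3 R) := complex.Re (Fr f x * conjc (Fr f x)).
have [iG _] := L2_integrableM (Fr f) (Fr f).
have [mG _] := cintegrable_measurable (L2_integrableM (Fr f) (Fr f)).
have G0 x : 0 <= G x by rewrite /G ReM Re_conj Im_conj mulrN opprK addr_ge0// -expr2 sqr_ge0.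
pose e k : R := k.+1%:R^-1.
have e0 k : 0 < e k by rewrite invr_gt0.
pose fn k (x : R3 R) := (cut_out s (e k) (dot3 x x) ^+ 2 * G x)%:E.
have [||||_ _] := @dominated_convergence _ _ _ (@leb3 R) setT measurableT fn (cst 0%E) (EFin \o G) _ _ _ iG.
- move=> k; apply/measurable_EFinP; apply: measurable_funM => //; apply: measurable_funX.
  by apply: (measurableT_comp (measurable_cut_out _ _)); exact: measurable_dot3.
- exact: measurable_cst.
- have := ae_dot3_neq s; apply: filterS => x xs _.
  apply: cvg_near_cst.
  have xs0 : 0 < `|dot3 x x - s| by rewrite normr_gt0 subr_eq0.
  have [N _ HN] := near_infty_natSinv_lt (PosNum xs0).
  exists N => // k Nk /=; have := HN k Nk; rewrite /= => kx.
  by rewrite /fn /cut_out ltW// expr0n mul0r.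
- apply: aeW => x k _ /=; rewrite normrM (ger0_norm (G0 x)) lee_fin ler_piMl//.
  by rewrite normrX expr_le1// cut_out_bound.
rewrite integral0 => /fine_cvg/cvgr0Pnorm_lt/(_ (eta ^+ 2)).
move=> /(_ (exprn_gt0 _ eta0)) [N _ /(_ N (leqnn N))] /= HN.
exists (e N) => //.
have fb : is_mul Fr (cut_out s (e N)) f (mulop Fr (cut_out s (e N)) f).
  by apply: (mulopP hFr); [exact: measurable_cut_out|move=> x; exact: cut_out_bound].
rewrite -ltr_sqr ?nnegrE ?normL2_ge0 ?(ltW eta0)//.
rewrite (mul_norm_integral (measurable_cut_out _ _) fb).
by apply: le_lt_trans HN; exact: ler_norm.
Qed.

Variable u : 'I_2 -> L2R3 R.
Variables (s : R) (phi : 'I_2 -> L2R3 R).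
Hypothesis uphi : forall j, is_mul Fr (fun x => (x - s)^-1) (u j) (phi j).

(** On the complement of the $\phi_j$ the truncated free resolvent inverts
    $H_\alpha - s$ up to a small error, whatever $\alpha$. *)
Lemma truncated_resolvent (f : L2R3 R) (a e : R) : 0 < e ->
  (forall j, innerL2 f (phi j) = 0) ->
  let b := mulop Fr (cut_out s e) f in let g := mulop Fr (cut_inv s e) f in
  exists2 h, perturbed_H Fr u a g h &
    h - s%:C *: g = f - (b + a%:C *: \sum_(j < 2) innerL2 b (phi j) *: u j).
Proof.
move=> e0 fphi b g.
have fb : is_mul Fr (cut_out s e) f b.
  by apply: (mulopP hFr); [exact: measurable_cut_out|move=> x; exact: cut_out_bound].
have fg : is_mul Fr (cut_inv s e) f g.
  by apply: (mulopP hFr); [exact: measurable_cut_inv|move=> x; exact: cut_inv_bound].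
have gu j : innerL2 g (u j) = - innerL2 b (phi j).
  rewrite -[RHS]add0r -(fphi j) -innerBl.
  apply: (@is_mul_inner _ Fr hFr _ _ _ _ _ _ _ _ _ _ s fg (is_mul1 Fr (u j))
    (is_mul_subm hFr (is_mul1 Fr f) fb) (uphi j)) => x _ xs.
  by rewrite mulr1 /cut_inv /cut_out; case: ifP; rewrite ?subr0 ?mul1r// subrr mul0r.
have Hg : free_H Fr g (f - b - (- s)%:C *: g) by exact: (free_H_truncated hFr e0 fb fg).
eexists; first by exists (f - b - (- s)%:C *: g).
rewrite rmorphN/= scaleNr opprK.
rewrite (_ : \sum_(j < 2) innerL2 g (u j) *: u j = - \sum_(j < 2) innerL2 b (phi j) *: u j); last first.
  by rewrite -sumrN; apply: eq_bigr => j _; rewrite gu scaleNr.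
by rewrite scalerN addrAC addrK opprD addrA.
Qed.

Lemma complement_vanish (X : Type) (F : set_system X) (FF : ProperFilter F)
    (al : X -> R) (E : X -> set (measurableTypeR R) -> L2R3 R -> L2R3 R)
    (alpha0 : R) (I : X -> set (measurableTypeR R)) (t : X -> R) (f : L2R3 R) :
  (forall a, spectral_measure_of (perturbed_H Fr u (al a)) (E a)) ->
  al a @[a --> F] --> alpha0 ->
  (forall a, measurable (I a)) -> (forall a, 0 < t a) ->
  (\forall a \near F, forall x, I a x -> `|x - s| <= t a) ->
  t a @[a --> F] --> 0 ->
  (forall j, innerL2 f (phi j) = 0) -> vtends F (fun a => E a (I a) f) 0.
Proof.
move=> hE aF mI t0 It tF fphi; apply/cvgr0Pnorm_lt => eta eta0.
pose S : R := \sum_(j < 2) normL2 (phi j) * normL2 (u j).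
have S0 : 0 <= S by apply: sumr_ge0 => j _; rewrite mulr_ge0 ?normL2_ge0.
pose B : R := 1 + (`|alpha0| + 1) * S.
have B0 : 0 < B by rewrite ltr_wpDr// mulr_ge0// addr_ge0.
have eB : 0 < eta / 2 / B by rewrite !divr_gt0.
have [e e0 eb] := @cut_out_vanish s f _ eB.
set b := mulop Fr (cut_out s e) f in eb.
pose g := mulop Fr (cut_inv s e) f.
have tg : (normL2 g * t a) @[a --> F] --> 0 by apply: cvg0Ml tF; exact: cvg_cst.
have e2 : 0 < eta / 2 by rewrite divr_gt0.
have N1 : \forall a \near F, `|normL2 g * t a| < eta / 2 by exact: cvg0_near_lt.
have N2 : \forall a \near F, `|al a| < `|alpha0| + 1.
  by apply: (cvgr_lt _ (cvg_norm aF)); rewrite ltrDl.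
near=> a.
have h1 : `|normL2 g * t a| < eta / 2 by near: a.
have h2 : `|al a| < `|alpha0| + 1 by near: a.
have h3 : forall x, I a x -> `|x - s| <= t a by near: a.
rewrite subr0 ger0_norm ?normL2_ge0//.
have [h Hh E1] := truncated_resolvent (al a) e0 fphi; rewrite -/b -/g in Hh E1.
set w := b + _ in E1.
have -> : f = (h - s%:C *: g) + w by rewrite E1 subrK.
rewrite (specD (hE a) (mI a)) (le_lt_trans (ler_normL2D _ _))//.
have h4 := spec_range_bound (hE a) (mI a) Hh (t0 a) h3.
have h5 := spec_norm_le (hE a) w (mI a).
have h6 : normL2 w <= normL2 b * B.
  rewrite /w (le_trans (ler_normL2D _ _))// normL2Z normc_real /B mulrDr mulr1 lerD2l.
  rewrite mulrCA; apply: ler_pM => //; [exact: normL2_ge0|exact: ltW|].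
  rewrite (le_trans (ler_normL2_sum _))// mulr_sumr; apply: ler_sum => j _.
  by rewrite normL2Z mulrA ler_wpM2r ?normL2_ge0// inner_CauchySchwarz.
have h7 : normL2 b * B < eta / 2 by rewrite -ltr_pdivlMr.
have h8 : t a * normL2 g < eta / 2 by rewrite mulrC (le_lt_trans _ h1)// ler_norm.
rewrite (le_lt_trans (lerD h4 (le_trans h5 h6)))//.
by rewrite [ltRHS]splitr ltrD.
Unshelve. all: by end_near.
Qed.

End complement.

(** * The eigenvectors of the Gram matrix *)

Section eigenbasis.
Context d0 (T : measurableType d0) (R : realType).
Variable nu : {measure set T -> \bar R}.
Local Notation L2 := (L2 nu).

Lemma mulr_conjc (z : R[i]) : z * conjc z = (Normc.normc z ^+ 2)%:C.
Proof.
rewrite normc_sqr; case: z => a b; apply/eqP; rewrite eq_complex/=.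
by apply/andP; split; apply/eqP; ring.
Qed.

Lemma phaseE (z : R[i]) : phase z * (Normc.normc z)%:C = z.
Proof.
rewrite /phase; case: eqVneq => [->|z0]; first by rewrite Normc.normc0 mulr0.
by rewrite -mulrA mulVf ?mulr1// normr_eq0.
Qed.

Lemma phase_conj (z : R[i]) : phase z * conjc (phase z) = 1.
Proof.
rewrite /phase; case: eqVneq => [_|z0]; first by rewrite conjc1 mulr1.
have n0 : Normc.normc z != 0 by apply/eqP => /Normc.eq0_normc/eqP; rewrite (negbTE z0).
have -> : z / `|z| = z * ((Normc.normc z)^-1)%:C by rewrite fmorphV.
rewrite conjM conjc_real mulrACA mulr_conjc -!rmorphM/=.
by rewrite -invfM -expr2 mulfV ?expf_neq0.
Qed.

Variables (phi : 'I_2 -> L2) (u : 'I_2 -> L2) (alpha0 : R).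
Hypothesis alpha0_neq0 : alpha0 != 0.
Hypothesis phiu : forall j k, innerL2 (phi j) (u k) = - ((j == k)%:R / alpha0%:C).
Local Notation N0 := (normL2 (phi 0) ^+ 2).
Local Notation N1 := (normL2 (phi 1) ^+ 2).
Local Notation z := (innerL2 (phi 0) (phi 1)).
Local Notation gram := (N0 * N1 - Normc.normc z ^+ 2).

Let phiu_neq0 j : innerL2 (phi j) (u j) != 0.
Proof. by rewrite phiu eqxx oppr_eq0 mul1r invr_eq0 realC_neq0. Qed.

Let N1_gt0 : 0 < N1.
Proof.
rewrite exprn_gt0// lt_neqAle normL2_ge0 andbT eq_sym; apply/eqP => /normL2_eq0 p0.
by have := phiu_neq0 1; rewrite p0 inner0l eqxx.
Qed.

(** The vector $\|\phi_1\|^2 \phi_0 - \langle\phi_0, \phi_1\rangle \phi_1$ has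
    squared norm $\|\phi_1\|^2$ times the Gram determinant, and it is not zero as
    it pairs with $u_0$. *)
Lemma gram_gt0 : 0 < gram.
Proof.
pose w := N1%:C *: phi 0 - z *: phi 1.
have w1 : innerL2 w (phi 1) = 0.
  by rewrite /w innerBl !innerZl inner_selfE mulrC subrr.
have ww : normL2 w ^+ 2 = N1 * gram.
  rewrite normL2_sqr {2}/w innerBr !innerZr w1 mulr0 subr0 conjc_real.
  rewrite /w innerBl !innerZl inner_selfE (innerC (phi 0) (phi 1)) mulr_conjc.
  move: (Normc.normc _ ^+ 2) => nz.
  by rewrite -!(rmorphM, rmorphB)/=; ring.
rewrite -(pmulr_rgt0 _ N1_gt0) -ww exprn_gt0// lt_neqAle normL2_ge0 andbT eq_sym.
apply/eqP => /normL2_eq0 w0; have : innerL2 w (u 0) = 0 by rewrite w0 inner0l.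
rewrite /w innerBl !innerZl (phiu 1 0)/= mul0r oppr0 mulr0 subr0 => /eqP.
by rewrite mulf_eq0 (negbTE (phiu_neq0 0)) orbF (negbTE (realC_neq0 (lt0r_neq0 N1_gt0))).
Qed.

Variable d : R.
Hypothesis hc : z <> 0 \/ normL2 (phi 0) <> normL2 (phi 1).
Hypothesis hd : d = Num.sqrt ((N0 - N1) ^+ 2 + 4 * Normc.normc z ^+ 2).
Variable lam' : 'I_2 -> R.
Hypothesis hlam' : forall j : 'I_2, lam' j =
  (N0 + N1 + (-1) ^+ j * d) / (2 * alpha0 ^+ 2 * gram).

Let disc_ge0 : 0 <= (N0 - N1) ^+ 2 + 4 * Normc.normc z ^+ 2.
Proof. by rewrite addr_ge0 ?sqr_ge0// mulr_ge0// sqr_ge0. Qed.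

Lemma gap_sqr : d ^+ 2 = (N0 - N1) ^+ 2 + 4 * Normc.normc z ^+ 2.
Proof. by rewrite hd sqr_sqrtr. Qed.

Lemma gap_gt0 : 0 < d.
Proof.
rewrite hd sqrtr_gt0 lt_neqAle disc_ge0 andbT eq_sym paddr_eq0 ?sqr_ge0//; last by rewrite mulr_ge0// sqr_ge0.
rewrite sqrf_eq0 mulf_eq0 pnatr_eq0 orFb sqrf_eq0 subr_eq0 eqrXn2 ?normL2_ge0//.
by apply/negP => /andP[/eqP n01 /eqP/Normc.eq0_normc z0]; case: hc.
Qed.

Let sg (l : 'I_2) : R := (-1) ^+ l.
Let sg2 l : sg l * sg l = 1. Proof. by rewrite /sg -expr2 sqrr_sign. Qed.

(** The eigenvalues of the Gram matrix; the larger one has label $1$. *)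
Definition gram_eigenvalue (l : 'I_2) : R := (N0 + N1 - (-1) ^+ l * d) / 2.
Local Notation kappa := gram_eigenvalue.

Lemma gram_eigenvalue_char l : (N0 + N1 + sg l * d) * kappa l = 2 * gram.
Proof.
have := gap_sqr; have := sg2 l; rewrite /gram_eigenvalue -/(sg l) => s2 d2.
have -> : (N0 + N1 + sg l * d) * ((N0 + N1 - sg l * d) / 2) =
  ((N0 + N1) ^+ 2 - (sg l * sg l) * d ^+ 2) / 2 by field.
by rewrite s2 mul1r d2; field.
Qed.

Lemma gap_lt_trace : d < N0 + N1.
Proof.
rewrite -ltr_sqr ?nnegrE ?addr_ge0 ?sqr_ge0 ?(ltW gap_gt0)// gap_sqr.
have h := gram_gt0.
rewrite -subr_gt0 (_ : _ - _ = 4 * gram); last by ring.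
by rewrite mulr_gt0.
Qed.

Lemma trace_sign_gt0 l : 0 < N0 + N1 + sg l * d.
Proof.
have h := gap_lt_trace; have g := gap_gt0.
by elim/ord2P: l; rewrite /sg/= ?expr0 ?expr1; lra.
Qed.

Lemma gram_eigenvalue_gt0 l : 0 < kappa l.
Proof.
rewrite -(pmulr_rgt0 _ (trace_sign_gt0 l)) gram_eigenvalue_char.
by rewrite mulr_gt0// gram_gt0.
Qed.

Lemma slope_eigenvalue l : alpha0 ^+ 2 * lam' l * kappa l = 1.
Proof.
rewrite hlam' -/(sg l); have := gram_eigenvalue_char l; have g := lt0r_neq0 gram_gt0.
move: g; set G := (X in X != 0); move=> g E.
have -> : alpha0 ^+ 2 * ((N0 + N1 + sg l * d) / (2 * alpha0 ^+ 2 * G)) * kappa l =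
  (N0 + N1 + sg l * d) * kappa l / (2 * G).
  by move: (kappa l) => k; field; rewrite alpha0_neq0 g.
by rewrite E mulfV// mulf_neq0.
Qed.

Lemma slope_gt0 l : 0 < lam' l.
Proof.
rewrite hlam' divr_gt0 ?trace_sign_gt0// mulr_gt0 ?gram_gt0//.
by rewrite mulr_gt0// exprn_even_gt0.
Qed.

Lemma slope_trace l : - (1 / alpha0%:C) + (alpha0 * lam' l)%:C * innerL2 (phi 0) (phi 0) +
  (- (1 / alpha0%:C) + (alpha0 * lam' l)%:C * innerL2 (phi 1) (phi 1)) != 0 :> R[i].
Proof.
have E := slope_eigenvalue l.
rewrite !inner_selfE.
have -> : - (1 / alpha0%:C) + (alpha0 * lam' l)%:C * N0%:C +
    (- (1 / alpha0%:C) + (alpha0 * lam' l)%:C * N1%:C) =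
   (alpha0 * lam' l * (N0 + N1) - 2 / alpha0)%:C :> R[i].
  move: (normL2 (phi 0) ^+ 2) (normL2 (phi 1) ^+ 2) (lam' l) => m0 m1 x.
  by rewrite !(rmorphM, rmorphD, rmorphN, fmorphV, rmorph1, rmorph_nat)/=; ring.
apply: realC_neq0; apply/eqP => H.
have : alpha0 * (alpha0 * lam' l * (N0 + N1) - 2 / alpha0) * kappa l = 0.
  by rewrite H mulr0 mul0r.
have -> : alpha0 * (alpha0 * lam' l * (N0 + N1) - 2 / alpha0) * kappa l =
  alpha0 ^+ 2 * lam' l * kappa l * (N0 + N1) - 2 * kappa l by field.
rewrite E mul1r /gram_eigenvalue -/(sg l) => H2.
have : sg l * d = 0 by rewrite -H2; field.
move/eqP; rewrite mulf_eq0 (gt_eqF gap_gt0) orbF /sg.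
by rewrite signr_eq0.
Qed.

Variable al : 'I_2 -> 'I_2 -> R[i].
Hypothesis hal0 : forall l, al l 0 = (Num.sqrt
  ((- sg l + sg l * alpha0 ^+ 2 * N1 * lam' l) / d))%:C.
Hypothesis hal1 : forall l, al l 1 = (- sg l)%:C * phase z * (Num.sqrt
  ((- sg l + sg l * alpha0 ^+ 2 * N0 * lam' l) / d))%:C.

Section components.
Variable l : 'I_2.
Let X0 := (- sg l + sg l * alpha0 ^+ 2 * N1 * lam' l) / d.
Let X1 := (- sg l + sg l * alpha0 ^+ 2 * N0 * lam' l) / d.
Let k_neq0 : kappa l != 0 := lt0r_neq0 (gram_eigenvalue_gt0 l).
Let d_neq0 : d != 0 := lt0r_neq0 gap_gt0.
Let slopeE : alpha0 ^+ 2 * lam' l = (kappa l)^-1.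
Proof. by apply: (mulIf k_neq0); rewrite mulVf// slope_eigenvalue. Qed.

Let X0E : sg l * kappa l * d * X0 = N1 - kappa l.
Proof.
rewrite /X0 (_ : sg l * alpha0 ^+ 2 * N1 * lam' l = sg l * (alpha0 ^+ 2 * lam' l) * N1); last by ring.
rewrite slopeE.
have -> : sg l * kappa l * d * ((- sg l + sg l * (kappa l)^-1 * N1) / d) =
  sg l * sg l * (N1 - kappa l) by move: (kappa l) k_neq0 => k k0; field; rewrite ?k0 ?d_neq0.
by rewrite sg2 mul1r.
Qed.

Let X1E : sg l * kappa l * d * X1 = N0 - kappa l.
Proof.
rewrite /X1 (_ : sg l * alpha0 ^+ 2 * N0 * lam' l = sg l * (alpha0 ^+ 2 * lam' l) * N0); last by ring.
rewrite slopeE.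
have -> : sg l * kappa l * d * ((- sg l + sg l * (kappa l)^-1 * N0) / d) =
  sg l * sg l * (N0 - kappa l) by move: (kappa l) k_neq0 => k k0; field; rewrite ?k0 ?d_neq0.
by rewrite sg2 mul1r.
Qed.

Let kd_gt0 : 0 < kappa l * d.
Proof. by rewrite mulr_gt0 ?gram_eigenvalue_gt0 ?gap_gt0. Qed.

Let absgap : `|N0 - N1| <= d.
Proof.
rewrite -ler_sqr ?nnegrE ?(ltW gap_gt0)// gap_sqr real_normK ?num_real// lerDl.
by rewrite mulr_ge0// sqr_ge0.
Qed.

Let X_ge0 X N : sg l * kappa l * d * X = N - kappa l ->
  0 <= sg l * (N - kappa l) -> 0 <= X.
Proof.
move=> E; rewrite -E !mulrA sg2 mul1r => h.
by rewrite -(pmulr_rge0 _ kd_gt0).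
Qed.

Let X0_ge0 : 0 <= X0.
Proof.
apply: (X_ge0 X0E); rewrite /gram_eigenvalue -/(sg l).
have -> : sg l * (N1 - (N0 + N1 - sg l * d) / 2) = (sg l * sg l * d - sg l * (N0 - N1)) / 2 by field.
rewrite sg2 mul1r divr_ge0// subr_ge0 (le_trans _ absgap)// (le_trans (ler_norm _))//.
by rewrite normrM /sg normrX normrN1 expr1n mul1r.
Qed.

Let X1_ge0 : 0 <= X1.
Proof.
apply: (X_ge0 X1E); rewrite /gram_eigenvalue -/(sg l).
have -> : sg l * (N0 - (N0 + N1 - sg l * d) / 2) = (sg l * sg l * d - sg l * (N1 - N0)) / 2 by field.
rewrite sg2 mul1r divr_ge0// subr_ge0 (le_trans _ absgap)// distrC (le_trans (ler_norm _))//.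
by rewrite normrM /sg normrX normrN1 expr1n mul1r.
Qed.

Let zE : Normc.normc z = kappa l * d * Num.sqrt X0 * Num.sqrt X1.
Proof.
have p1 : 0 <= Normc.normc z by exact: normc_ge0.
have p2 : 0 <= kappa l * d * Num.sqrt X0 * Num.sqrt X1.
  by rewrite mulr_ge0 ?sqrtr_ge0// mulr_ge0 ?sqrtr_ge0// ltW.
apply/eqP; rewrite -(@eqrXn2 _ 2%N _ _ isT p1 p2); apply/eqP.
rewrite [RHS]exprMn [X in _ = X * _]exprMn (sqr_sqrtr X0_ge0) (sqr_sqrtr X1_ge0).
have -> : (kappa l * d) ^+ 2 * X0 * X1 = (sg l * sg l)^-1 * (sg l * kappa l * d * X0) * (sg l * kappa l * d * X1).
  by move: X0 X1 => x y; rewrite sg2 invr1 mul1r (_ : forall s k, s * k * d * x * (s * k * d * y) = (s * s) * ((k * d) ^+ 2 * x * y)) ?sg2 ?mul1r// => s k; ring.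
rewrite X0E X1E sg2 invr1 mul1r /gram_eigenvalue -/(sg l).
have -> : (N1 - (N0 + N1 - sg l * d) / 2) * (N0 - (N0 + N1 - sg l * d) / 2) =
  (sg l * sg l * d ^+ 2 - (N0 - N1) ^+ 2) / 4 by field.
by rewrite sg2 mul1r gap_sqr; field.
Qed.

Lemma gram_eigenvector k : \sum_(j < 2) al l j * innerL2 (phi j) (phi k) = (kappa l)%:C * al l k.
Proof.
rewrite sum_I2 hal0 hal1 -/X0 -/X1.
have zz := phaseE z; have qq := phase_conj z; rewrite zE in zz.
have zc : conjc z = conjc (phase z) * (kappa l * d * Num.sqrt X0 * Num.sqrt X1)%:C.
  by rewrite -[in LHS]zz conjM conjc_real.
have n0E : N0 = kappa l + sg l * kappa l * d * Num.sqrt X1 ^+ 2 by rewrite sqr_sqrtr// X1E; ring.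
have n1E : N1 = kappa l + sg l * kappa l * d * Num.sqrt X0 ^+ 2 by rewrite sqr_sqrtr// X0E; ring.
elim/ord2P: k.
  rewrite hal0 -/X0 inner_selfE (innerC (phi 0) (phi 1)) n0E zc.
  move: (Num.sqrt X0) (Num.sqrt X1) (kappa l) (phase z) (sg l) qq => x y k q si qq.
  rewrite !(rmorphM, rmorphD, rmorphN, rmorphXn)/=.
  have -> : forall p w : R[i], p * (k%:C + w) + - si%:C * q * y%:C * (conjc q * (k%:C * d%:C * x%:C * y%:C)) =
     p * k%:C + p * w - (q * conjc q) * (si%:C * k%:C * d%:C * x%:C * y%:C ^+ 2) by move=> p w; ring.
  by rewrite qq; ring.
rewrite hal1 -/X1 inner_selfE n1E -[X in _ * X + _]zz.
move: (Num.sqrt X0) (Num.sqrt X1) (kappa l) (phase z) (sg l) (sg2 l) => x y k q si s2.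
rewrite !(rmorphM, rmorphD, rmorphN, rmorphXn)/=.
have {}s2 : si%:C * si%:C = 1 :> R[i] by rewrite -rmorphM/= s2.
have -> : x%:C * (q * (k%:C * d%:C * x%:C * y%:C)) + - si%:C * q * y%:C *
    (k%:C + si%:C * k%:C * d%:C * x%:C ^+ 2) =
  (1 - si%:C * si%:C) * (x%:C ^+ 2 * q * k%:C * d%:C * y%:C) + k%:C * (- si%:C * q * y%:C) by ring.
by rewrite s2 subrr mul0r add0r.
Qed.

Lemma gram_eigenvector_neq0 : al l 0 != 0 \/ al l 1 != 0.
Proof.
have [a0|a0] := eqVneq (al l 0) 0; last by left.
have [a1|a1] := eqVneq (al l 1) 0; last by right.
have q0 : phase z != 0.
  by apply/eqP => q0; have := phase_conj z; rewrite q0 mul0r => /eqP; rewrite eq_sym oner_eq0.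
move: a0; rewrite hal0 -/X0 => -[/eqP]; rewrite sqrtr_eq0 => x0.
move: a1; rewrite hal1 -/X1 => /eqP; rewrite !mulf_eq0 (negbTE q0) orbF => /orP[|].
  by rewrite -(rmorph0 (real_complex R)) (inj_eq (@complexI R)) oppr_eq0 signr_eq0.
rewrite -(rmorph0 (real_complex R)) (inj_eq (@complexI R)) sqrtr_eq0 => x1.
have X00 : X0 = 0 by apply/eqP; rewrite eq_le x0 X0_ge0.
have X10 : X1 = 0 by apply/eqP; rewrite eq_le x1 X1_ge0.
have := X0E; have := X1E; rewrite X00 X10 !mulr0 /gram_eigenvalue -/(sg l) => h1 h2.
have : sg l * d = 0 by lra.
by move/eqP; rewrite mulf_eq0 (negbTE d_neq0) orbF signr_eq0.
Qed.

End components.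

End eigenbasis.

(** * Rates along a branch *)

Section rates.
Variable R : realType.
Variable a0 : R.
Local Notation F := (a0^').

(** The half-width of the intervals; the value at the centre only has to be
    positive. *)
Definition half_width (q a : R) : R := if a == a0 then 1 else `|a - a0| `^ q.

Lemma half_width_gt0 q a : 0 < half_width q a.
Proof.
rewrite /half_width; case: eqVneq => // aa.
by rewrite powR_gt0// normr_gt0 subr_eq0.
Qed.

Lemma near_neq_centre : \forall a \near F, a != a0.
Proof. exact: nbhs_dnbhs_neq. Qed.

Lemma powR_dist_cvg0 (q : R) : 0 < q -> `|a - a0| `^ q @[a --> F] --> 0.
Proof.
move=> q0; apply/cvgr0Pnorm_lt => eps eps0.
have /cvgr0Pnorm_lt/(_ eps eps0) := powR_cvg0 q0.
rewrite /at_right near_withinE => -[dl /= dl0 H].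
have N : \forall a \near F, `|a - a0| < dl.
  by apply: nbhs_dnbhs; exists dl => // x /=; rewrite distrC.
apply: filterS2 near_neq_centre N => a an ad.
have p0 : 0 < `|a - a0| by rewrite normr_gt0 subr_eq0.
by apply: (H `|a - a0|) => //=; rewrite sub0r normrN normr_id.
Qed.

Lemma cvg_pow (y : R -> R) (l : R) k : y a @[a --> F] --> l ->
  (y a ^+ k) @[a --> F] --> l ^+ k.
Proof.
move=> yl; elim: k => [|k IH]; first by rewrite expr0; exact: cvg_cst.
rewrite exprS (_ : (fun a => y a ^+ k.+1) = (fun a => y a * y a ^+ k)); first exact: cvgM.
by apply/funext => a; rewrite exprS.
Qed.

Lemma slope_cvg (f : R -> R) : derivable f a0 1 ->
  ((f a - f a0) / (a - a0)) @[a --> F] --> derive1 f a0.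
Proof.
move=> df; have H : h^-1 *: (f (h + a0) - f a0) @[h --> 0^'] --> derive1 f a0.
  rewrite derive1E /derive.
  have -> : (fun h => h^-1 *: (f (h + a0) - f a0)) = (fun h => h^-1 *: (f (h *: 1 + a0) - f a0)).
    by apply/funext => h; rewrite /GRing.scale/= mulr1.
  exact: df.
apply/cvgrPdist_lt => eps eps0.
move/cvgrPdist_lt : H => /(_ eps eps0) [dl /= dl0 H].
exists dl => //= a ad an.
have := H (a - a0); rewrite /= sub0r normrN subr_eq0 subrK distrC => /(_ ad an).
by rewrite /GRing.scale/= mulrC.
Qed.

Variables (f : R -> R) (s L : R).
Hypothesis fL : ((f a - s) / (a - a0)) @[a --> F] --> L.

Lemma branch_cvg : (f a - s) @[a --> F] --> 0.
Proof.
have d0 : (a - a0) @[a --> F] --> 0.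
  rewrite -(subrr a0); apply: cvgB; last exact: cvg_cst.
  exact: nbhs_dnbhs.
have H : ((f a - s) / (a - a0) * (a - a0)) @[a --> F] --> 0 by exact: cvg0Ml fL d0.
apply: cvg_trans H; apply: near_eq_cvg; apply: filterS near_neq_centre => a an.
by rewrite divfK// subr_eq0.
Qed.

Lemma half_width_lt (q c : R) : 1 < q -> 0 < c -> 0 < L ->
  \forall a \near F, c * half_width q a < `|f a - s|.
Proof.
move=> q1 c0 L0; have q0 : 0 < q - 1 by rewrite subr_gt0.
have L2 : 0 < L / 2 by rewrite divr_gt0.
have N1 : \forall a \near F, L / 2 < (f a - s) / (a - a0).
  by apply: (cvgr_gt _ fL); rewrite ltr_pdivrMr// mulr_natr mulr2n ltrDl.
have N2 : \forall a \near F, `|(`|a - a0| `^ (q - 1))| < L / 2 / c.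
  by apply: (cvg0_near_lt _ (powR_dist_cvg0 q0)); rewrite divr_gt0.
apply: filterS2 near_neq_centre (filterI N1 N2) => a an [h1 h2].
have p0 : 0 < `|a - a0| by rewrite normr_gt0 subr_eq0.
rewrite /half_width (negbTE an).
have -> : `|a - a0| `^ q = `|a - a0| * `|a - a0| `^ (q - 1).
  by rewrite -{2}(powRr1 (ltW p0)) -powRD ?(addrC 1) ?subrK// (gt_eqF p0) implybT.
rewrite ger0_norm ?powR_ge0// ltr_pdivlMr// mulrC in h2.
have h3 : L / 2 < `|f a - s| / `|a - a0|.
  by rewrite -normfV -normrM (lt_le_trans h1)// ler_norm.
rewrite ltr_pdivlMr// in h3; apply: lt_trans h3.
by rewrite mulrCA (mulrC (L / 2)) ltr_pM2l.
Qed.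

Lemma half_width_rate (q : R) n : q < (2 * n)%:R ->
  ((`|f a - s| ^+ n) ^+ 2 / half_width q a) @[a --> F] --> 0.
Proof.
move=> qn; have q0 : 0 < (2 * n)%:R - q by rewrite subr_gt0.
have H1 : ((`|(f a - s) / (a - a0)| ^+ n) ^+ 2) @[a --> F] --> ((`|L| ^+ n) ^+ 2).
  by apply: cvg_pow; apply: cvg_pow; exact: cvg_norm.
have H : ((`|(f a - s) / (a - a0)| ^+ n) ^+ 2 * `|a - a0| `^ ((2 * n)%:R - q)) @[a --> F] --> 0.
  exact: cvg0Ml H1 (powR_dist_cvg0 q0).
apply: cvg_trans H; apply: near_eq_cvg; apply: filterS near_neq_centre => a an.
have p0 : 0 < `|a - a0| by rewrite normr_gt0 subr_eq0.
rewrite /half_width (negbTE an) powRB ?(gt_eqF p0) ?implybT// powR_mulrn// normrM normfV.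
rewrite mulrA; congr (_ / _).
by rewrite !exprMn mulnC exprM !exprVn divfK// !expf_neq0// gt_eqF.
Qed.

End rates.

Section littleo.
Variable R : realType.
Variable a0 : R.

Lemma half_width_littleo (p q : R) (I : R -> set (measurableTypeR R)) (c : R) : p < q ->
  (forall a, a != a0 -> (lebesgue_measure (I a) <= (c * half_width a0 q a)%:E)%E) ->
  measure_littleo a0 p I.
Proof.
move=> pq Ic; have q0 : 0 < q - p by rewrite subr_gt0.
have H : (c * `|a - a0| `^ (q - p)) @[a --> a0^'] --> 0.
  by apply: cvg0Ml (powR_dist_cvg0 a0 q0); exact: cvg_cst.
rewrite /measure_littleo.
have H2 : (c * `|a - a0| `^ (q - p))%:E @[a --> a0^'] --> 0%E by apply: cvg_EFin => //; exact: nearW.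
apply: (squeeze_cvge _ _ H2); last exact: cvg_cst.
apply: filterS (near_neq_centre a0) => a an.
have p0 : 0 < `|a - a0| by rewrite normr_gt0 subr_eq0.
rewrite mule_ge0 ?lee_fin ?invr_ge0 ?powR_ge0//=.
apply: (le_trans (lee_wpmul2r _ (Ic a an))); first by rewrite lee_fin invr_ge0 powR_ge0.
by rewrite -EFinM lee_fin /half_width (negbTE an) powRB ?(gt_eqF p0) ?implybT// mulrA.
Qed.

End littleo.

(** * The eigenbasis *)

Section span.
Context d0 (T : measurableType d0) (R : realType).
Variable nu : {measure set T -> \bar R}.
Local Notation L2 := (L2 nu).
Variables (phi : 'I_2 -> L2) (al : 'I_2 -> 'I_2 -> R[i]) (kappa : 'I_2 -> R).
Hypothesis eig : forall l k,
  \sum_(j < 2) al l j * innerL2 (phi j) (phi k) = (kappa l)%:C * al l k.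
Hypothesis kappa_neq0 : forall l, kappa l != 0.
Hypothesis kappa_neq : kappa 0 != kappa 1.
Hypothesis al_neq0 : forall l, al l 0 != 0 \/ al l 1 != 0.
Variable psi : 'I_2 -> L2.
Hypothesis psiE : forall l, psi l = \sum_(j < 2) al l j *: phi j.

Let S l m : R[i] := al l 0 * conjc (al m 0) + al l 1 * conjc (al m 1).

Lemma inner_psi_phi l k : innerL2 (psi l) (phi k) = (kappa l)%:C * al l k.
Proof. by rewrite -eig psiE inner_suml; apply: eq_bigr => j _; rewrite innerZl. Qed.

Let inner_psi l m : innerL2 (psi l) (psi m) = (kappa l)%:C * S l m.
Proof.
by rewrite (psiE m) sum_I2 innerDr !innerZr !inner_psi_phi /S; ring.
Qed.

Lemma inner_psi01 : innerL2 (psi 0) (psi 1) = 0.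
Proof.
have SC : S 1 0 = conjc (S 0 1) by rewrite /S conjD !conjM !conjcK; ring.
have h1 := inner_psi 0 1; have h2 := inner_psi 1 0.
rewrite innerC SC -(conjc_real (kappa 1)) -conjM in h2.
move/(congr1 conjc) : h2; rewrite !conjcK h1 => /eqP.
rewrite -subr_eq0 -mulrBl -rmorphB/= mulf_eq0 (negbTE (realC_neq0 _)) ?subr_eq0//.
by move=> /eqP ->; rewrite mulr0.
Qed.

Let normsum_neq0 l : S l l != 0.
Proof.
have -> : S l l = (Normc.normc (al l 0) ^+ 2 + Normc.normc (al l 1) ^+ 2)%:C.
  by rewrite /S !mulr_conjc -rmorphD.
apply: realC_neq0; rewrite paddr_eq0 ?sqr_ge0// !sqrf_eq0.
apply/negP => /andP[/eqP/Normc.eq0_normc a0 /eqP/Normc.eq0_normc a1].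
by case: (al_neq0 l); rewrite ?a0 ?a1 eqxx.
Qed.

Lemma psi_neq0 l : innerL2 (psi l) (psi l) != 0.
Proof. by rewrite inner_psi mulf_neq0 ?realC_neq0. Qed.

Lemma psi_complement f : (forall l, innerL2 f (psi l) = 0) ->
  forall k, innerL2 f (phi k) = 0.
Proof.
move=> f0; pose D := al 0 0 * al 1 1 - al 0 1 * al 1 0.
have DD : D * conjc D != 0.
  have S01 : S 0 1 = 0.
    have /eqP := inner_psi01; rewrite inner_psi mulf_eq0 (negbTE (realC_neq0 (kappa_neq0 0))).
    by move/eqP.
  have -> : D * conjc D = S 0 0 * S 1 1 - S 0 1 * S 1 0.
    by rewrite /D /S conjD conjN !conjM; ring.
  by rewrite S01 mul0r subr0 mulf_neq0.
have D0 : conjc D != 0 by apply: contraNneq DD => ->; rewrite mulr0.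
have h l : conjc (al l 0) * innerL2 f (phi 0) + conjc (al l 1) * innerL2 f (phi 1) = 0.
  by rewrite -(f0 l) psiE sum_I2 innerDr !innerZr.
have h0 := h 0; have h1 := h 1.
elim/ord2P; apply: (mulfI D0); rewrite mulr0 /D conjD conjN !conjM.
  have -> : (conjc (al 0 0) * conjc (al 1 1) - conjc (al 0 1) * conjc (al 1 0)) * innerL2 f (phi 0) =
    conjc (al 1 1) * (conjc (al 0 0) * innerL2 f (phi 0) + conjc (al 0 1) * innerL2 f (phi 1)) -
    conjc (al 0 1) * (conjc (al 1 0) * innerL2 f (phi 0) + conjc (al 1 1) * innerL2 f (phi 1)) by ring.
  by rewrite h0 h1 !mulr0 subrr.
have -> : (conjc (al 0 0) * conjc (al 1 1) - conjc (al 0 1) * conjc (al 1 0)) * innerL2 f (phi 1) =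
  conjc (al 0 0) * (conjc (al 1 0) * innerL2 f (phi 0) + conjc (al 1 1) * innerL2 f (phi 1)) -
  conjc (al 1 0) * (conjc (al 0 0) * innerL2 f (phi 0) + conjc (al 0 1) * innerL2 f (phi 1)) by ring.
by rewrite h0 h1 !mulr0 subrr.
Qed.

Let rest f := f - (proj_span (psi 0) f + proj_span (psi 1) f).

Lemma span_decomposition f : f = proj_span (psi 0) f + proj_span (psi 1) f + rest f.
Proof. by rewrite addrC subrK. Qed.

Lemma rest_perp f k : innerL2 (rest f) (phi k) = 0.
Proof.
apply: psi_complement => {k} l; rewrite /rest /proj_span innerBl innerDl !innerZl.
have o1 : innerL2 (psi 1) (psi 0) = 0 by rewrite innerC inner_psi01 conjc0.
elim/ord2P: l; rewrite ?o1 ?inner_psi01 mulr0 ?addr0 ?add0r divfK ?psi_neq0//.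
  by rewrite subrr.
by rewrite subrr.
Qed.

End span.

(** * The embedded eigenvalue *)

Section embedded.
Variable R : realType.
Variable Fr : L2R3 R -> L2R3 R.
Hypothesis hFr : is_fourier Fr.

Lemma uniform_vanishing_bounds (u : 'I_2 -> L2R3 R) (U : 'I_2 -> nat -> R -> L2S2 R)
    (s : R) n : 0 < s ->
  (forall j, in_calE Fr (u j) (U j)) -> (forall j, vanishes_to_order n (U j) s) ->
  exists rho K : R, [/\ 0 < rho, rho <= 1, rho <= s, 0 <= K &
    forall j, vanishing_bounds (U j 0%N) s n rho K].
Proof.
move=> s0 hu hvan.
have B j : exists rho K : R, [/\ 0 < rho, 0 <= K & vanishing_bounds (U j 0%N) s n rho K].
  have hV := calE_deriv (hu j).
  have [r1 [K1 [r10 K10 H1]]] := curve_vanish hV (k := 0%N) s0 (hvan j).1.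
  have [r2 [K2 [r20 K20 H2]]] := curve_lipschitz_near hV 0%N s0.
  exists (Num.min r1 r2), (Num.max K1 K2); split.
  - by rewrite lt_min r10.
  - by rewrite le_max K10.
  split=> [x|x y]; rewrite !lt_min.
    move=> /andP[x1 _]; rewrite (le_trans (H1 x x1))// ler_wpM2r ?exprn_ge0//.
    by rewrite le_max lexx.
  move=> /andP[_ x2] /andP[_ y2]; rewrite (le_trans (H2 x y x2 y2))// ler_wpM2r//.
  by rewrite le_max lexx orbT.
have [r0 [K0 [r00 K00 [A0 L0]]]] := B 0; have [r1 [K1 [r10 K10 [A1 L1]]]] := B 1.
exists (Num.min (Num.min r0 r1) (Num.min 1 s)), (Num.max K0 K1); split.
- by rewrite !lt_min r00 r10 s0 ltr01.
- by rewrite !ge_min lexx !orbT.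
- by rewrite !ge_min lexx !orbT.
- by rewrite le_max K00.
elim/ord2P; split=> [x|x y]; rewrite !lt_min.
- move=> /andP[/andP[x1 _] _]; rewrite (le_trans (A0 x x1))// ler_wpM2r ?exprn_ge0//.
  by rewrite le_max lexx.
- move=> /andP[/andP[x1 _] _] /andP[/andP[y1 _] _]; rewrite (le_trans (L0 x y x1 y1))//.
  by rewrite ler_wpM2r// le_max lexx.
- move=> /andP[/andP[_ x1] _]; rewrite (le_trans (A1 x x1))// ler_wpM2r ?exprn_ge0//.
  by rewrite le_max lexx orbT.
- move=> /andP[/andP[_ x1] _] /andP[/andP[_ y1] _]; rewrite (le_trans (L1 x y x1 y1))//.
  by rewrite ler_wpM2r// le_max lexx orbT.
Qed.

Lemma represents_Phi (v phi : L2R3 R) (V : nat -> R -> L2S2 R) (s : R) :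
  represents Fr v (V 0%N) -> represents Fr phi (Phi_curve V s) -> is_mul Fr (fun x => (x - s)^-1) v phi.
Proof.
move=> vV pV.
apply: (represents_is_mul (measurable_inv_sub s) vV).
have ns : \forall l \ae @lebesgue_measure R, l != s.
  exists [set s]; split => //.
  - exact: lebesgue_measure_set1.
  - by move=> x /= /negP; rewrite negbK => /eqP.
move: pV; rewrite /represents; apply: filterS2 ns => l ls H l0.
by move: (H l0); rewrite /Phi_curve (negbTE ls).
Qed.

Variables (u phi : 'I_2 -> L2R3 R) (alpha0 s : R).
Hypothesis alpha0_neq0 : alpha0 != 0.
Hypothesis uphi : forall j, is_mul Fr (fun x => (x - s)^-1) (u j) (phi j).
Hypothesis phiu : forall j k, innerL2 (phi j) (u k) = - ((j == k)%:R / alpha0%:C).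

(** The interaction cancels the source term $u_j$ of $(H_0 - s)\phi_j = u_j$. *)
Lemma embedded_eigenvector j : perturbed_H Fr u alpha0 (phi j) (s%:C *: phi j).
Proof.
exists (u j - (- s)%:C *: phi j).
  pose m x : R := 1 - - s * (x - s)^-1.
  have um : is_mul Fr m (u j) (u j - (- s)%:C *: phi j).
    exact: (is_mul_subm hFr (is_mul1 Fr (u j)) (is_mul_scale hFr (- s) (uphi j))).
  have um' : is_mul Fr (fun x => x * (x - s)^-1) (u j) (u j - (- s)%:C *: phi j).
    apply: (is_mul_ext (a := s) _ um) => x _ xs; rewrite /m.
    by have xs0 : x - s != 0; [rewrite subr_eq0|field].
  exact: (@is_mul_quot _ _ _ _ (fun x => x) _ _ _ (uphi j) um').
have -> : \sum_(k < 2) innerL2 (phi j) (u k) *: u k = - (alpha0%:C)^-1 *: u j.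
  rewrite sum_I2 !phiu; elim/ord2P: (j) => /=; rewrite mul0r oppr0 scale0r ?addr0 ?add0r mul1r//.
rewrite scalerA mulrN mulfV ?realC_neq0// scaleN1r rmorphN/= scaleNr opprK.
by rewrite addrAC subrr add0r.
Qed.

End embedded.

Section strong_limit.
Context d0 (T : measurableType d0) (R : realType).
Variable nu : {measure set T -> \bar R}.
Local Notation L2 := (L2 nu).
Variables (X : Type) (F : set_system X).
Context {FF : ProperFilter F}.
Variable P : X -> L2 -> L2.
Hypothesis PD : forall a f g, P a (f + g) = P a f + P a g.
Hypothesis PZ : forall a (c : R[i]) f, P a (c *: f) = c *: P a f.

Lemma strong_limit_sum (p0 p1 r q0 q1 : L2) (c0 c1 : R[i]) :
  vtends F (P ^~ p0) q0 -> vtends F (P ^~ p1) q1 -> vtends F (P ^~ r) 0 ->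
  vtends F (P ^~ (c0 *: p0 + c1 *: p1 + r)) (c0 *: q0 + c1 *: q1).
Proof.
move=> h0 h1 hr.
rewrite (_ : P ^~ _ = fun a => c0 *: P a p0 + c1 *: P a p1 + P a r); last first.
  by apply/funext => a; rewrite !PD !PZ.
rewrite -[X in vtends _ _ X]addr0; apply: vtendsD => //.
by apply: vtendsD; apply: vtendsZ => //; exact: ctends_cst.
Qed.

Lemma vtends_near (f g : X -> L2) h : (\forall a \near F, f a = g a) ->
  vtends F f h -> vtends F g h.
Proof.
move=> fg; rewrite /vtends; apply: cvg0_le; apply: filterS fg => a ->.
by rewrite normL2_ge0 lexx.
Qed.

End strong_limit.

Theorem theorem7p3 (R : realType)
  (Fr : L2R3 R -> L2R3 R) (hFr : is_fourier Fr)
  (u : 'I_2 -> L2R3 R) (U : 'I_2 -> nat -> R -> L2S2 R)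
  (hu : forall j, in_calE Fr (u j) (U j))
  (hperp : innerL2 (u 0) (u 1) = 0)
  (E : R -> set (measurableTypeR R) -> L2R3 R -> L2R3 R)
  (hE : forall alpha, spectral_measure_of (perturbed_H Fr u alpha) (E alpha))
  (alpha0 lambda0 : R) (hlambda0 : 0 < lambda0)
  (hb : (forall j, U j 0%N lambda0 = 0) /\
    forall j k : 'I_2,
      (j == k)%:R + alpha0%:C * pv_gamma (spec_pairing (U j) (U k)) lambda0 = 0)
  (phi : 'I_2 -> L2R3 R)
  (hphi : forall j, represents Fr (phi j) (Phi_curve (U j) lambda0))
  (hc : innerL2 (phi 0) (phi 1) <> 0 \/ normL2 (phi 0) <> normL2 (phi 1))
  (hlabel : normL2 (phi 0) <= normL2 (phi 1))
  (d : R)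
  (hd : d = Num.sqrt ((normL2 (phi 0) ^+ 2 - normL2 (phi 1) ^+ 2) ^+ 2 +
                      4 * Normc.normc (innerL2 (phi 0) (phi 1)) ^+ 2))
  (* the paths: I = ]i1, i2[ and J = ]j1, j2[ *)
  (i1 i2 j1 j2 : R)
  (hI : alpha0 \in `]i1, i2[) (hJ : lambda0 \in `]j1, j2[) (hJ0 : 0 < j1)
  (lam : 'I_2 -> R -> R)
  (hlamJ : forall j alpha, alpha \in `]i1, i2[ -> lam j alpha \in `]j1, j2[)
  (hlam_smooth : forall j n alpha, alpha \in `]i1, i2[ ->
     derivable (derive1n n (lam j)) alpha 1)
  (hlam_distinct : exists2 alpha, alpha \in `]i1, i2[ &
     lam 0 alpha <> lam 1 alpha)
  (hlam0 : forall j, lam j alpha0 = lambda0)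
  (hlam' : forall j : 'I_2, derive1 (lam j) alpha0 =
     (normL2 (phi 0) ^+ 2 + normL2 (phi 1) ^+ 2 + (-1) ^+ j * d) /
     (2 * alpha0 ^+ 2 * (normL2 (phi 0) ^+ 2 * normL2 (phi 1) ^+ 2 -
                         Normc.normc (innerL2 (phi 0) (phi 1)) ^+ 2)))
  (hzeros : forall alpha l, alpha \in `]i1, i2[ -> l \in `[j1, j2] ->
     (ReF U alpha l = 0 <-> l = lam 0 alpha \/ l = lam 1 alpha))
  (hF2 : forall alpha j, alpha \in `]i1, i2[ -> alpha <> alpha0 ->
     ImF U alpha (lam j alpha) <> 0)
  (a11 a12 a21 a22 : R[i]) (psi : 'I_2 -> L2R3 R)
  (ha11 : a11 = (Num.sqrt
     ((-1 + alpha0 ^+ 2 * normL2 (phi 1) ^+ 2 * derive1 (lam 0) alpha0) / d))%:C)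
  (ha12 : a12 = - phase (innerL2 (phi 0) (phi 1)) * (Num.sqrt
     ((-1 + alpha0 ^+ 2 * normL2 (phi 0) ^+ 2 * derive1 (lam 0) alpha0) / d))%:C)
  (ha21 : a21 = (Num.sqrt
     ((1 - alpha0 ^+ 2 * normL2 (phi 1) ^+ 2 * derive1 (lam 1) alpha0) / d))%:C)
  (ha22 : a22 = phase (innerL2 (phi 0) (phi 1)) * (Num.sqrt
     ((1 - alpha0 ^+ 2 * normL2 (phi 0) ^+ 2 * derive1 (lam 1) alpha0) / d))%:C)
  (hpsi0 : psi 0 = a11 *: phi 0 + a12 *: phi 1)
  (hpsi1 : psi 1 = a21 *: phi 0 + a22 *: phi 1)
  (n : nat) (hn : (1 <= n)%N)
  (hvan : forall j, vanishes_to_order n (U j) lambda0) :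
  (forall (p : R) (l : 'I_2), 0 <= p -> p < (2 * n)%:R ->
     exists I : R -> set (measurableTypeR R),
       [/\ (forall alpha, alpha \in `]i1, i2[ ->
              [/\ is_interval (I alpha), I alpha !=set0 &
                  forall x, I alpha (lam l alpha + x) <->
                            I alpha (lam l alpha - x)]),
           measure_littleo alpha0 p I &
           strong_cvg alpha0 (fun alpha => E alpha (I alpha))
             (proj_span (psi l))]) /\
  (forall p : R, 0 <= p -> p < (2 * n)%:R ->
     concentrated_to_order (perturbed_H Fr u) E alpha0 lambda0 p).
Proof.
have cU j : curve_continuous (U j 0%N).
  by move=> l l0; exact: (curve_is_continuous (calE_deriv (hu j)) 0%N l0).
have uU j := calE_repr (hu j).
have [rho [K [rho0 rho1 rhos K0 bU]]] := uniform_vanishing_bounds hlambda0 hu hvan.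
have uphi j : is_mul Fr (fun x => (x - lambda0)^-1) (u j) (phi j).
  exact: (represents_Phi (uU j) (hphi j)).
have a0 : alpha0 != 0.
  apply/eqP => a00; have := hb.2 0 0; rewrite a00 mul0r addr0 => /eqP.
  by rewrite eqxx oner_eq0.
have phiu j k : innerL2 (phi j) (u k) = - ((j == k)%:R / alpha0%:C).
  have := hb.2 j k.
  rewrite (pv_gamma_zero hFr rho0 rho1 rhos K0 hn (cU j) (cU k) (uU j) (uU k)
    (bU j) (bU k) (uphi j) (uphi k)) => /eqP; rewrite addrC addr_eq0 => /eqP H.
  by apply: (mulfI (realC_neq0 a0)); rewrite H mulrN mulrCA mulfV ?mulr1// realC_neq0.
pose L l := derive1 (lam l) alpha0.
pose al (l j : 'I_2) : R[i] :=
  if l == 0 then (if j == 0 then a11 else a12) else if j == 0 then a21 else a22.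
have hal0 l : al l 0 = (Num.sqrt
    ((- (-1) ^+ l + (-1) ^+ l * alpha0 ^+ 2 * normL2 (phi 1) ^+ 2 * L l) / d))%:C.
  elim/ord2P: l; rewrite /al/= ?ha11 ?ha21 ?expr0 ?expr1 ?mul1r//.
  by rewrite opprK mulN1r !mulNr.
have hal1 l : al l 1 = (- (-1) ^+ l)%:C * phase (innerL2 (phi 0) (phi 1)) * (Num.sqrt
    ((- (-1) ^+ l + (-1) ^+ l * alpha0 ^+ 2 * normL2 (phi 0) ^+ 2 * L l) / d))%:C.
  elim/ord2P: l; rewrite /al ?ha12 ?ha22.
    by rewrite expr0 mul1r rmorphN rmorph1 mulN1r.
  by rewrite expr1 opprK rmorph1 mul1r mulN1r !mulNr.
have psiE l : psi l = \sum_(j < 2) al l j *: phi j.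
  by elim/ord2P: l; rewrite sum_I2 ?hpsi0 ?hpsi1.
pose kappa := gram_eigenvalue phi d.
have kappa_gt0 l : 0 < kappa l by exact: (gram_eigenvalue_gt0 a0 phiu hc hd).
have d_gt0 : 0 < d by exact: (gap_gt0 hc hd).
have eig l k : \sum_(j < 2) al l j * innerL2 (phi j) (phi k) = (kappa l)%:C * al l k.
  exact: (gram_eigenvector a0 phiu hc hd hlam' hal0 hal1).
have L_gt0 l : 0 < L l by exact: (slope_gt0 a0 phiu hc hd hlam').
have kappa_neq : kappa 0 != kappa 1.
  rewrite /kappa /gram_eigenvalue expr0 expr1 mul1r mulN1r opprK.
  rewrite (inj_eq (mulIf _)) ?invr_eq0 ?pnatr_eq0// (inj_eq (addrI _)).
  by rewrite lt_eqF// (lt_trans _ d_gt0)// oppr_lt0.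
have kappa_neq0 l : kappa l != 0 by rewrite lt0r_neq0.
have al_neq0 l : al l 0 != 0 \/ al l 1 != 0.
  exact: (gram_eigenvector_neq0 a0 phiu hc hd hlam' hal0 hal1).
have psi0 := psi_neq0 eig kappa_neq0 al_neq0 psiE.
have dpsi := span_decomposition psi.
have rest0 := rest_perp eig kappa_neq0 kappa_neq al_neq0 psiE.
have lamd l : derivable (lam l) alpha0 1 by exact: (hlam_smooth l 0%N alpha0 hI).
have mL l : ((lam l a - lambda0) / (a - alpha0)) @[a --> alpha0^'] --> L l.
  by have := slope_cvg (lamd l); rewrite hlam0.
have ms l := branch_cvg (mL l).
have mI q l (a : R) : measurable
    (`[lam l a - half_width alpha0 q a, lam l a + half_width alpha0 q a]%classic
       : set (measurableTypeR R)) by exact: measurable_itv.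
have nearI : \forall a \near alpha0^', a \in `]i1, i2[.
  by apply: nbhs_dnbhs; exact: near_in_itvoo.
have conc q l : 1 < q -> q < (2 * n)%:R -> vtends alpha0^' (fun a => E a
    `[lam l a - half_width alpha0 q a, lam l a + half_width alpha0 q a]%classic (psi l)) (psi l).
  move=> q1 qn; rewrite psiE.
  have re := half_width_rate (mL l) qn.
  have er : \forall a \near alpha0^', half_width alpha0 q a < `|lam l a - lambda0|.
    have := half_width_lt (mL l) q1 ltr01 (L_gt0 l).
    by apply: filterS => a; rewrite mul1r.
  apply: (branch_concentration hFr cU uU rho0 rho1 rhos K0 hn bU uphi a0 phiu (ms l)
    (half_width_gt0 alpha0 q) er re (mL l) (eig l) (slope_eigenvalue a0 phiu hd hlam' l) _ hE).
    apply: (det_Cmx_small hFr cU uU rho0 rho1 rhos K0 hn bU (ms l) (half_width_gt0 alpha0 q) re (mL l)).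
    apply: filterS nearI => a aI.
    have lJ := hlamJ l a aI.
    apply/(hzeros a (lam l a) aI); first by exact: subset_itv_oo_cc.
    by elim/ord2P: (l); [left|right].
  exact: (slope_trace a0 phiu hc hd hlam' l).
have disj q : 1 < q -> \forall a \near alpha0^',
    `[lam 0 a - half_width alpha0 q a, lam 0 a + half_width alpha0 q a]%classic `&`
    `[lam 1 a - half_width alpha0 q a, lam 1 a + half_width alpha0 q a]%classic = set0.
  move=> q1.
  have L01 : 0 < L 0 - L 1.
    rewrite /L !hlam' expr0 expr1 -mulrBl mul1r mulN1r divr_gt0//.
      by rewrite opprD opprK addrACA subrr add0r addr_gt0.
    by rewrite mulr_gt0 ?(gram_gt0 a0 phiu)// mulr_gt0// exprn_even_gt0.
  have fL : ((lam 0 a - lam 1 a - 0) / (a - alpha0)) @[a --> alpha0^'] --> L 0 - L 1.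
    rewrite (_ : (fun a => _) = (fun a => (lam 0 a - lambda0) / (a - alpha0) - (lam 1 a - lambda0) / (a - alpha0))).
      by apply: cvgB; exact: mL.
    by apply/funext => a; rewrite -mulrBl; congr (_ / _); ring.
  have := half_width_lt fL q1 (ltr0n R 2) L01; apply: filterS => a.
  rewrite subr0 => H; apply/seteqP; split=> // x [/=]; rewrite !in_itv/= -!ler_distl => x1 x2.
  move: H; rewrite ltNge (le_trans (ler_distD x _ _))//.
  by rewrite mulr_natl mulr2n lerD// distrC.
pose W := half_width alpha0.
pose I (q : R) (l : 'I_2) (a : R) : set (measurableTypeR R) := `[lam l a - W q a, lam l a + W q a]%classic.
pose t (q : R) (l : 'I_2) (a : R) : R := `|lam l a - lambda0| + W q a.
have W0 q a : 0 < W q a by exact: half_width_gt0.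
have t_gt0 q l a : 0 < t q l a by rewrite ltr_wpDl.
have Wcvg q (l : 'I_2) : 1 < q -> W q a @[a --> alpha0^'] --> 0.
  move=> q1; have er : \forall a \near alpha0^', W q a < `|lam l a - lambda0|.
    have := half_width_lt (mL l) q1 ltr01 (L_gt0 l).
    by apply: filterS => a; rewrite mul1r.
  exact: (truncation_width (ms l) (W0 q) er).
have tcvg q l : 1 < q -> t q l a @[a --> alpha0^'] --> 0.
  by move=> q1; apply: cvg0D (Wcvg q l q1); apply/norm_cvg0P.
have It q l a x : I q l a x -> `|x - lambda0| <= t q l a.
  rewrite /I/= in_itv/= -ler_distl => h; rewrite (le_trans (ler_distD (lam l a) _ _))//.
  by rewrite addrC lerD2l.
have centre q l a : I q l a (lam l a).
  by rewrite /I/= in_itv/= -ler_distl subrr normr0 ltW.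
have compl q l f : 1 < q -> (forall j, innerL2 f (phi j) = 0) ->
    vtends alpha0^' (fun a => E a (I q l a) f) 0.
  move=> q1 f0.
  apply: (@complement_vanish _ _ hFr _ _ _ uphi _ _ _ id E alpha0 (I q l) (t q l) f) => //.
  - exact: nbhs_dnbhs.
  - exact: mI.
  - by apply: nearW => a x; exact: It.
  - exact: tcvg.
have cross q l m : 1 < q -> q < (2 * n)%:R -> l != m ->
    vtends alpha0^' (fun a => E a (I q l a) (psi m)) 0.
  move=> q1 qn lm; rewrite /vtends; apply: cvg0_le (conc q m q1 qn).
  have : \forall a \near alpha0^', I q l a `&` I q m a = set0.
    have := disj q q1; apply: filterS => a H.
    by move: lm; elim/ord2P: l; elim/ord2P: m => //= _; rewrite // setIC.
  apply: filterS => a H; rewrite normL2_ge0 andTb subr0.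
  have := spec_disj (hE a) (psi m) (mI q l a) (mI q m a) H => E0.
  rewrite -[X in normL2 X <= _]subr0 -E0 -(specB (hE a) (mI q l a)).
  rewrite (le_trans (spec_norm_le (hE a) _ (mI q l a)))//.
  by rewrite -normL2N opprB.
have strong q l : 1 < q -> q < (2 * n)%:R ->
    strong_cvg alpha0 (fun a => E a (I q l a)) (proj_span (psi l)).
  move=> q1 qn f.
  set c0 := innerL2 f (psi 0) / innerL2 (psi 0) (psi 0).
  set c1 := innerL2 f (psi 1) / innerL2 (psi 1) (psi 1).
  pose r := f - (proj_span (psi 0) f + proj_span (psi 1) f).
  have fE : f = c0 *: psi 0 + c1 *: psi 1 + r by exact: dpsi.
  have PD a g h : E a (I q l a) (g + h) = E a (I q l a) g + E a (I q l a) h.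
    exact: (specD (hE a) (mI q l a)).
  have PZ a c g : E a (I q l a) (c *: g) = c *: E a (I q l a) g.
    exact: (specZ (hE a) (mI q l a)).
  have hr := compl q l r q1 (rest0 f).
  suff : vtends alpha0^' (fun a => E a (I q l a) (c0 *: psi 0 + c1 *: psi 1 + r))
      (proj_span (psi l) f) by rewrite -fE.
  move: (conc q l q1 qn) (fun m => cross q l m q1 qn) PD PZ hr; rewrite -/W.
  elim/ord2P: l => hc0 hc1 PD PZ hr.
    rewrite -[proj_span _ _]addr0 -(scaler0 _ c1).
    exact: (@strong_limit_sum _ _ _ _ _ _ _ (fun a => E a (I q 0 a)) PD PZ
      (psi 0) (psi 1) r (psi 0) 0 c0 c1 hc0 (hc1 1 isT) hr).
  rewrite -[proj_span _ _]add0r -(scaler0 _ c0).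
  exact: (@strong_limit_sum _ _ _ _ _ _ _ (fun a => E a (I q 1 a)) PD PZ
    (psi 0) (psi 1) r 0 (psi 1) c0 c1 (hc1 0 isT) hc0 hr).
have lebI q l a : (lebesgue_measure (I q l a) <= (2 * W q a)%:E)%E.
  rewrite lebesgue_measure_itv/= lte_fin; case: ifPn => _; last first.
    by rewrite lee_fin mulr_ge0// ltW.
  by rewrite -EFinB lee_fin opprB addrC addrA subrK mulr_natl mulr2n.
have exponent p : p < (2 * n)%:R -> exists q : R, [/\ 1 < q, p < q & q < (2 * n)%:R].
  move=> pn; have n2 : (1 : R) < (2 * n)%:R.
    by rewrite ltr1n (leq_trans _ (leq_mul (leqnn 2) hn)).
  exists ((Num.max p 1 + (2 * n)%:R) / 2); have m2 : Num.max p 1 < (2 * n)%:R by rewrite gt_max pn.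
  have pm : p <= Num.max p 1 by rewrite le_max lexx.
  have m1 : 1 <= Num.max p 1 by rewrite le_max lexx orbT.
  have [h1 h2] := midf_lt m2; split=> //.
    exact: le_lt_trans m1 h1.
  exact: le_lt_trans pm h1.
split=> [p l p0 pn|p p0 pn]; have [q [q1 pq qn]] := exponent p pn.
  exists (I q l); split; last exact: strong.
    move=> a aI; split; first exact: interval_is_interval.
      by exists (lam l a); exact: centre.
    move=> x; rewrite /I/= !in_itv/= -!ler_distl.
    by rewrite addrAC subrr add0r addrAC subrr add0r normrN.
  by apply: (half_width_littleo (c := 2) pq) => a _; exact: lebI.
have eigen l : perturbed_H Fr u alpha0 (psi l) (lambda0%:C *: psi l).
  have ev := embedded_eigenvector hFr a0 uphi phiu.
  have H := selfadj_add (hE alpha0) (selfadj_scale (hE alpha0) (al l 0) (ev 0))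
    (selfadj_scale (hE alpha0) (al l 1) (ev 1)).
  rewrite psiE sum_I2 scalerDr; rewrite !scalerA in H *.
  by rewrite !(mulrC lambda0%:C).
have m0 : measurable ([set lambda0] : set (measurableTypeR R)) by exact: measurable_set1.
have proj_eigen f : E alpha0 [set lambda0] f = proj_span (psi 0) f + proj_span (psi 1) f.
  have r0 : E alpha0 [set lambda0] (f - (proj_span (psi 0) f + proj_span (psi 1) f)) = 0.
    have n2 : (1 : R) < 2 by rewrite ltr1n.
    have H : vtends alpha0^' (fun=> E alpha0 [set lambda0]
        (f - (proj_span (psi 0) f + proj_span (psi 1) f))) 0.
      apply: (@complement_vanish _ _ hFr _ _ _ uphi _ _ _ (fun=> alpha0) (fun=> E alpha0)
        alpha0 (fun=> [set lambda0]) (W 2)) => //.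
      - exact: cvg_cst.
      - by apply: nearW => a x /= ->; rewrite subrr normr0 ltW.
      - exact: (Wcvg 2 0 n2).
    apply: normL2_eq0; move: H; rewrite /vtends subr0 => H.
    by apply: (cvg_unique _ (cvg_cst _) H); exact: Rhausdorff.
  rewrite {1}(dpsi f) (specD (hE alpha0) m0) r0 addr0 (specD (hE alpha0) m0).
  by rewrite !(specZ (hE alpha0) m0) !(spec_eigenvector (hE alpha0)).
split; first exact: hE.
  exists (phi 0); last exact: (embedded_eigenvector hFr a0 uphi phiu 0).
  apply/eqP => h; have := phiu 0 0; rewrite h inner0l eqxx => /eqP.
  by rewrite eq_sym oppr_eq0 mul1r invr_eq0 (negbTE (realC_neq0 a0)).
pose J a := I q 0 a `|` I q 1 a.
pose t2 a := t q 0 a + t q 1 a.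
have t2cvg : t2 a @[a --> alpha0^'] --> 0 by apply: cvg0D; exact: tcvg.
have Jt a x : J a x -> `|x - lambda0| <= t2 a.
  by move=> [/It|/It] h; rewrite (le_trans h)// /t2; [rewrite lerDl ltW|rewrite lerDr ltW].
have lo : (lambda0 - t2 a)%:E @[a --> alpha0^'] --> lambda0%:E.
  apply: cvg_EFin; first exact: nearW.
  by rewrite -[X in _ --> X]subr0; apply: cvgB => //; exact: cvg_cst.
have hi : (lambda0 + t2 a)%:E @[a --> alpha0^'] --> lambda0%:E.
  apply: cvg_EFin; first exact: nearW.
  by rewrite -[X in _ --> X]addr0; apply: cvgD => //; exact: cvg_cst.
have JE a : ((lambda0 - t2 a)%:E <= ereal_inf (EFin @` J a) /\
    ereal_sup (EFin @` J a) <= (lambda0 + t2 a)%:E /\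
    ereal_inf (EFin @` J a) <= (lambda0 + t2 a)%:E /\
    (lambda0 - t2 a)%:E <= ereal_sup (EFin @` J a))%E.
  have b x : J a x -> lambda0 - t2 a <= x <= lambda0 + t2 a.
    by move=> /Jt; rewrite ler_distl.
  have c : J a (lam 0 a) by left; exact: centre.
  have /andP[c1 c2] := b _ c.
  split; first by apply: le_ereal_inf_tmp => _ [x /b/andP[h _] <-]; rewrite lee_fin.
  split; first by apply: ge_ereal_sup => _ [x /b/andP[_ h] <-]; rewrite lee_fin.
  split; first by apply: (@le_trans _ _ (lam 0 a)%:E); [apply: ereal_inf_lbound; exists (lam 0 a)|rewrite lee_fin].
  by apply: (@le_trans _ _ (lam 0 a)%:E); [rewrite lee_fin|apply: ereal_sup_ubound; exists (lam 0 a)].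
exists J; split.
- by move=> a; apply: measurableU; exact: mI.
- by apply: (squeeze_cvge _ lo hi); apply: nearW => a; have [-> [_ [-> _]]] := JE a.
- by apply: (squeeze_cvge _ lo hi); apply: nearW => a; have [_ [-> [_ ->]]] := JE a.
- move=> f; rewrite proj_eigen.
  have H : vtends alpha0^' (fun a => E a (I q 0 a) f + E a (I q 1 a) f)
      (proj_span (psi 0) f + proj_span (psi 1) f).
    by apply: vtendsD; exact: strong.
  apply: vtends_near H; apply: filterS (disj q q1) => a D.
  by rewrite (specU (hE a) f (mI q 0 a) (mI q 1 a) D).
apply: (half_width_littleo (c := 4) pq) => a _.
apply: (le_trans (measureU2 _ (mI q 0 a) (mI q 1 a))).
apply: (le_trans (leeD (lebI q 0 a) (lebI q 1 a))).
by rewrite -EFinD lee_fin -mulrDl -natrD.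
Qed.
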